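(* Assume that there exists a deterministic function $\rho:\mathbb R_+\to\mathbb R_+$ with $\rho(0^+)=0$ such that, $\mathbb P$-a.s., $\langle M\rangle_t-\langle M\rangle_s\le\rho(t-s)$ for all $0\le s\le t\le T$, and that there exists a constant $\bar K\ge0$ such that $|\alpha_t(\omega)|\le\bar K$, $(\mathbb P\otimes\langle M\rangle)$-a.e. on $\Omega\times[0,T]$. Then every $\xi\in L^2(\Omega,\mathcal F_T,\mathbb P;\mathbb R)$ admits the decomposition $$\xi=\bar U_0+\int_0^T\beta^{\mathcal H}_t\,dS_t+A_T,\quad\mathbb P\text{-a.s.},$$ where $\bar U_0\in L^2(\Omega,\mathcal F_0,\mathbb P;\mathbb R)$, $\beta^{\mathcal H}=(\beta^{\mathcal H}_t)_{0\le t\le T}\in\mathcal M^2_{\mathcal H}(0,T)$ and $A\in\mathcal L^2_{\mathcal F}(0,T)$ is weakly orthogonal to $M$.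
   Context: $T\in(0,\infty)$ is fixed. $(\Omega,\mathcal F,\mathbb P)$ is a probability space with two filtrations $\mathbb F=(\mathcal F_t)_{0\le t\le T}$ and $\mathbb H=(\mathcal H_t)_{0\le t\le T}$, both satisfying the usual conditions, with $\mathcal F=\mathcal F_T$ and $\mathcal H_t\subseteq\mathcal F_t$ for all $t$. $S=(S_t)_{0\le t\le T}$ is a real-valued square-integrable càdlàg $\mathbb F$-semimartingale of the form $$S_t=S_0+M_t+\int_0^t\alpha_s\,d\langle M\rangle_s,\quad 0\le t\le T,$$ where $M$ is a real-valued square-integrable càdlàg $\mathbb F$-martingale with $M_0=0$ and $\mathbb F$-predictable quadratic variation $\langle M\rangle$, and $\alpha$ is an $\mathbb F$-predictable process with $\mathbb E[\int_0^T|\alpha_t|^2\,d\langle M\rangle_t]<\infty$. Spaces: $\mathcal M^2_{\mathcal H}(0,T)$ is the set of $\mathbb H$-predictable processes $\varphi$ with $\mathbb E[\int_0^T|\varphi_s|^2\,d\langle M\rangle_s]<\infty$; $\mathcal L^2_{\mathcal F}(0,T)$ is the set of $\mathbb F$-martingales $\psi$ with $\psi_0=0$ and $\mathbb E[\psi_T^2]<\infty$. A square-integrable $\mathbb F$-martingale $O$ is weakly orthogonal to $M$ if $\mathbb E\big[O_T\int_0^T\varphi_t\,dM_t\big]=0$ for all $\varphi\in\mathcal M^2_{\mathcal H}(0,T)$. *)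

(* Defs.v *)
From HB Require Import structures.
From mathcomp Require Import all_boot all_order all_algebra.
From mathcomp Require Import all_classical all_reals all_analysis.

Set Implicit Arguments.
Unset Strict Implicit.
Unset Printing Implicit Defensive.

Import Order.TTheory GRing.Theory Num.Theory.
Import numFieldNormedType.Exports.

Local Open Scope classical_set_scope.
Local Open Scope ring_scope.

(* Conventions.  A process is a function X : R -> Omega -> R (time first), of
   which only the values at times in [0, T] matter; a filtration is a family
   of sets of events indexed by R, again relevant on [0, T] only. Equalities
   of random variables and path properties are required almost surely. *)

Section paths.
Context {R : realType}.
Variable T : R.

Definition right_continuous_path (f : R -> R) : Prop :=
  forall t, 0 <= t < T -> f x @[x --> t^'+] --> f t.

Definition cadlag_path (f : R -> R) : Prop :=
  right_continuous_path f /\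
  forall t, 0 < t <= T -> cvg (f x @[x --> t^'-]).

Definition increasing_path (f : R -> R) : Prop :=
  (forall s t, 0 <= s -> s <= t -> t <= T -> f s <= f t) /\
  right_continuous_path f.

(* f restricted to [0, T] and extended to R by constants. *)
Definition clamp (f : R -> R) : R -> R := fun t => f (Num.max 0 (Num.min t T)).

Definition cumulative_of (f : R -> R)
    (h : nondecreasing f /\ right_continuous f) : cumulative R R :=
  HB.pack f (isCumulative.Build R _ R f h.1 h.2).

(* The Stieltjes measure df on [0, T] of an increasing path. Since clamp f is
   constant on ]-oo, 0] and on [T, +oo[, this measure does not charge {0} nor
   the complement of [0, T]: integrals over [0, t] are integrals over ]0, t].
   For a path that is not increasing it is the zero measure (junk value). *)
Definition stieltjes (f : R -> R) : {measure set (measurableTypeR R) -> \bar R} :=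
  match pselect (nondecreasing (clamp f) /\ right_continuous (clamp f)) with
  | left h => lebesgue_stieltjes_measure (cumulative_of h)
  | right _ => mzero
  end.

Lemma clamp_id (f : R -> R) (t : R) : 0 <= t <= T -> clamp f t = f t.
Proof. by move=> /andP[t0 tT]; rewrite /clamp (min_idPl tT) (max_idPr t0). Qed.

Lemma clamp_le0 (f : R -> R) (t : R) : 0 <= T -> t <= 0 -> clamp f t = f 0.
Proof.
by move=> T0 t0; rewrite /clamp (max_idPl _)// (min_idPl (le_trans t0 T0)).
Qed.

Lemma clamp_geT (f : R -> R) (t : R) : 0 <= T -> T <= t -> clamp f t = f T.
Proof. by move=> T0 Tt; rewrite /clamp (min_idPr Tt) (max_idPr T0). Qed.

Lemma clamp_increasing (f : R -> R) : 0 <= T -> increasing_path f ->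
  nondecreasing (clamp f) /\ right_continuous (clamp f).
Proof.
move=> T0 [ndf rcf]; split.
  move=> x y xy; rewrite /clamp; apply: ndf.
  - by rewrite le_max lexx.
  - rewrite ge_max le_max lexx /= le_max; apply/orP; right.
    by rewrite le_min !ge_min xy lexx orbT.
  - by rewrite ge_max T0 ge_min lexx orbT.
move=> t; case: (ltP t 0) => [t0|t0].
  rewrite (clamp_le0 f T0 (ltW t0)); apply: cvg_near_cst.
  near=> x; apply: clamp_le0 => //; apply: ltW; near: x.
  exact: nbhs_right_lt.
case: (ltP t T) => [tT|Tt].
  rewrite (clamp_id f) ?t0 ?(ltW tT)//.
  apply: cvg_trans (rcf t _); last by rewrite t0.
  apply: near_eq_cvg; near=> x; rewrite clamp_id//; apply/andP; split.
    by apply: le_trans t0 _; apply: ltW; near: x; exact: nbhs_right_gt.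
  by apply: ltW; near: x; exact: nbhs_right_lt.
rewrite (clamp_geT f T0 Tt); apply: cvg_near_cst.
near=> x; apply: clamp_geT => //; apply: (le_trans Tt); apply: ltW; near: x.
exact: nbhs_right_gt.
Unshelve. all: by end_near. Qed.

Lemma stieltjes_itv (f : R -> R) (s t : R) : increasing_path f ->
  0 <= s -> s <= t -> t <= T -> stieltjes f `]s, t]%classic = (f t - f s)%:E.
Proof.
move=> incf s0 st tT.
have T0 : 0 <= T by rewrite (le_trans s0)// (le_trans st).
rewrite /stieltjes; case: pselect => [h|/(_ (clamp_increasing T0 incf))//].
transitivity (wlength (cumulative_of h) `]s, t]%classic); last first.
  by rewrite wlength_itv_bnd//= !clamp_id ?s0 ?(le_trans s0 st) ?tT ?(le_trans st tT).
by apply: measurable_mu_extE; exact: is_ocitv.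
Qed.

End paths.

Section processes.
Context {d : measure_display} {Omega : measurableType d} {R : realType}.
Variables (P : probability Omega R) (T : R).
Implicit Types (F H : R -> set (set Omega)) (G : set (set Omega)).
Implicit Types (X M V phi : R -> Omega -> R).

Definition usual_filtration F : Prop :=
  [/\ forall t, 0 <= t <= T -> sigma_algebra setT (F t),
      forall t, 0 <= t <= T -> F t `<=` measurable,
      forall s t, 0 <= s -> s <= t -> t <= T -> F s `<=` F t,
      forall t, 0 <= t < T -> \bigcap_(s in `]t, T]%classic) F s `<=` F t &
      forall N, P.-negligible N -> F 0 N].

Definition G_measurable G (Y : Omega -> R) : Prop :=
  measurable_fun setT (Y : g_sigma_algebraType G -> R).

Definition square_integrable (Y : Omega -> R) : Prop :=
  ('E_P[(fun w => Y w ^+ 2)%R] < +oo)%E.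

Definition L2_rv G (Y : Omega -> R) : Prop :=
  G_measurable G Y /\ square_integrable Y.

Definition adapted F X : Prop :=
  forall t, 0 <= t <= T -> G_measurable (F t) (X t).

Definition is_cond_exp G (Y Z : Omega -> R) : Prop :=
  [/\ G_measurable G Z, P.-integrable setT (EFin \o Z) &
      forall B, G B ->
        (\int[P]_(w in B) (Z w)%:E = \int[P]_(w in B) (Y w)%:E)%E].

Definition martingale F X : Prop :=
  [/\ adapted F X,
      forall t, 0 <= t <= T -> P.-integrable setT (EFin \o X t) &
      forall s t, 0 <= s -> s <= t -> t <= T ->
        is_cond_exp (F s) (X t) (X s)].

Definition square_integrable_martingale F X : Prop :=
  martingale F X /\ forall t, 0 <= t <= T -> square_integrable (X t).

Definition cadlag X : Prop := {ae P, forall w, cadlag_path T (X ^~ w)}.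

(* Generators of the predictable sigma-algebra on Omega * [0, T]. *)
Definition predictable_rect F : set (set (Omega * R)) :=
  [set B | (exists2 A, F 0 A & B = A `*` [set 0]) \/
           (exists s t A, [/\ 0 <= s, s < t, t <= T, F s A &
                              B = A `*` `]s, t]%classic])].

Definition predictable F phi : Prop :=
  measurable_fun ([set: Omega] `*` `[0, T]%classic : set (g_sigma_algebraType (predictable_rect F)))
    (fun z : g_sigma_algebraType (predictable_rect F) => phi z.2 z.1).

(* V is the F-predictable quadratic variation <M> of M. *)
Definition is_predictable_qv F M V : Prop :=
  [/\ predictable F V,
      {ae P, forall w, V 0 w = 0},
      {ae P, forall w, increasing_path T (V ^~ w)} &
      martingale F (fun t w => M t w ^+ 2 - V t w)].

(* E[int_0^T phi_t d<M>_t], for phi with values in \bar R. *)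
Definition dol_integral V (phi : R -> Omega -> \bar R) : \bar R :=
  (\int[P]_w \int[stieltjes T (V ^~ w)]_(t in `[0%R, T]%classic) phi t w)%E.

(* The measure (P (x) <M>)(B) = E[int_0^T 1_B(., t) d<M>_t]. *)
Definition dol_measure V (B : set (Omega * R)) : \bar R :=
  dol_integral V (fun t w => (\1_B (w, t))%:E).

(* M^2_H(0,T), with V = <M> *)
Definition M2 H V phi : Prop :=
  predictable H phi /\ (dol_integral V (fun t w => (phi t w ^+ 2)%:E) < +oo)%E.

(* L^2_F(0,T) *)
Definition L2_martingale F X : Prop :=
  [/\ martingale F X, {ae P, forall w, X 0 w = 0} & square_integrable (X T)].

(* A simple integrand sum_i h_i 1_{]s_i, t_i]} is coded by the list of the
   triples (s_i, t_i, h_i). *)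
Definition simple_integrand : Type := seq (R * R * (Omega -> R)).

Definition is_simple F (L : simple_integrand) : Prop :=
  forall s t h, (s, t, h) \in L ->
    [/\ 0 <= s, s <= t, t <= T, G_measurable (F s) h &
        exists C, forall w, `|h w| <= C].

Definition simple_process (L : simple_integrand) : R -> Omega -> R :=
  fun t w => \sum_(x <- L) x.2 w * \1_(`]x.1.1, x.1.2]%classic) t.

Definition simple_integral M (L : simple_integrand) : Omega -> R :=
  fun w => \sum_(x <- L) x.2 w * (M x.1.2 w - M x.1.1 w).

(* I is (a version of) the Ito integral int_0^T phi_t dM_t: the L^2(P)-limit
   of the integrals of simple integrands which tend to phi in L^2(P (x) <M>). *)
Definition is_ito_integral F M V phi (I : Omega -> R) : Prop :=
  [/\ M2 F V phi, L2_rv (F T) I &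
    exists L : nat -> simple_integrand,
      [/\ forall n, is_simple F (L n),
          dol_integral V (fun t w => ((phi t w - simple_process (L n) t w) ^+ 2)%:E)
            @[n --> \oo] --> 0%E &
          'E_P[(fun w => (I w - simple_integral M (L n) w) ^+ 2)%R]%E
            @[n --> \oo] --> 0%E]].

(* int_0^t phi_s d<M>_s *)
Definition qv_integral V phi (t : R) (w : Omega) : R :=
  \int[stieltjes T (V ^~ w)]_(s in `[0, t]%classic) phi s w.

(* S = S_0 + M + int alpha d<M>, up to indistinguishability. *)
Definition semimartingale_decomposition F M V (alpha S : R -> Omega -> R) : Prop :=
  [/\ predictable F alpha,
      (dol_integral V (fun t w => (alpha t w ^+ 2)%:E) < +oo)%E &
      {ae P, forall w, forall t, 0 <= t <= T ->
        S t w = S 0 w + M t w + qv_integral V alpha t w}].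

(* J is (a version of) int_0^T phi_t dS_t for a semimartingale S with martingale
   part M and finite variation part int alpha d<M>: as usual this integral is
   int phi dM + int phi alpha d<M>. *)
Definition is_semimartingale_integral F M V (alpha S : R -> Omega -> R) phi
    (J : Omega -> R) : Prop :=
  semimartingale_decomposition F M V alpha S /\
  exists2 I, is_ito_integral F M V phi I &
    {ae P, forall w,
      J w = I w + qv_integral V (fun t w' => phi t w' * alpha t w') T w}.

(* The Ito integral exists and is a.s. unique for phi in M^2_H(0,T), so that
   "exists2" and "forall" over its versions say the same here; "exists2" cannot
   be vacuous. *)
Definition weakly_orthogonal F H M V X : Prop :=
  forall phi, M2 H V phi ->
    exists2 I, is_ito_integral F M V phi I & 'E_P[(fun w => X T w * I w)%R]%E = 0%E.

End processes.

(* Main.v *)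
Require Import Defs.
From HB Require Import structures.
From mathcomp Require Import all_boot all_order all_algebra.
From mathcomp Require Import all_classical all_reals all_analysis.
From mathcomp Require Import measurable_realfun ring lra.
Import Order.TTheory GRing.Theory Num.Theory.
Import numFieldNormedType.Exports.
Local Open Scope classical_set_scope.
Local Open Scope ring_scope.

(* Extended by L^2 limits of step integrands, the Ito integral [I] is an isometry
   from the F-predictable processes in L^2(P x <M>) to L^2(P). Write
   [C beta = int beta alpha d<M>]. Everything reduces to finding an H-predictable
   [beta] with [xi - I beta - C beta] orthogonal to every [I phi], [phi] being
   H-predictable; that is, to the equations
     <beta, phi> + E[C beta * I phi] = E[xi * I phi].
   The conditional expectation given [F 0] of the remainder is then [U0], and
   its centred version closes the martingale [A].
   By Cauchy-Schwarz along each path, |C beta|^2 <= K^2 rho(t - s) |beta|^2 for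
   [beta] supported in ]s, t], so on short time intervals the bilinear form is
   coercive and the Lax-Milgram argument applies. Short intervals are glued
   backward in time: if [beta] lives before [s] and [phi] after [s], then [C beta]
   is F_s-measurable and E[C beta * I phi] = 0, so the equations on a later
   interval are not disturbed by the part of [beta] on an earlier one. *)

Set Implicit Arguments.
Unset Strict Implicit.
Unset Printing Implicit Defensive.

(** * Semi-inner product spaces *)

Section geometric.
Context {R : realType}.

(** Functions are never identified modulo null sets: [L2] consists of genuine functions and carries
    only a semi-inner product. Limits, Riesz representatives and Ito integrals are therefore chosen,
    not unique, and linearity in the integrand is used only after pairing with a fixed variable.
    Completeness is stated for increments dominated by a geometric sequence, because every sequence
    that occurs can be built with such a rate.

    The obstacle is the drift. For [alpha = 0] the equations describe an orthogonal projection and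
    Riesz suffices; in general the form need be neither symmetric nor coercive on [[0, T]]. Moreover
    [C beta] is only F_T-measurable, so the equations cannot be read inside H; tested against
    H-predictable processes only, they still live in the complete space of those processes.

    The pathwise hypotheses hold almost everywhere, whereas the product measure and the uniform
    estimates want them everywhere. Hence <M> is replaced by a version with good paths and [alpha]
    by a bounded version, and the result is carried back at the end. *)

Lemma geo2_gt0 (n : nat) : 0 < (2^-1 : R) ^+ n.
Proof. by rewrite exprn_gt0// invr_gt0. Qed.

Lemma geo2_small (C e : R) : 0 < e -> exists n : nat, C * 2^-1 ^+ n < e.
Proof.
move=> e0; have [C0|C0] := leP C 0.
  by exists 0; rewrite expr0 mulr1 (le_lt_trans C0).
have : (fun n : nat => C * 2^-1 ^+ n) @ \oo --> (0 : R).
  by apply: cvg_geometric; rewrite ger0_norm ?invr_ge0// invf_lt1// ltr1n.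
move=> /cvgrPdist_lt /(_ _ e0)[n _ /(_ n (leqnn n))].
rewrite sub0r normrN => h; exists n; exact: le_lt_trans (ler_norm _) h.
Qed.

Lemma geo2_le0 (C x : R) : (forall n : nat, x <= C * 2^-1 ^+ n) -> x <= 0.
Proof.
move=> h; rewrite leNgt; apply/negP => /(geo2_small C)[n].
by rewrite ltNge h.
Qed.

Lemma le_small (x : R) : (forall e, 0 < e -> x <= e) -> x <= 0.
Proof. by move=> h; apply/ler_addgt0Pl => e /h; rewrite addr0. Qed.

End geometric.

Section forms.
Context {R : realType} {X : lmodType R}.
Variable b : X -> X -> R.
Implicit Types (D : set X) (x y z : X).

Definition linear_subspace D := D 0 /\ forall a x y, D x -> D y -> D (a *: x + y).

(** Linearity is relative to a subspace because real-valued integrals of products are additive only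
    under integrability. *)
Definition linear_on D (l : X -> R) :=
  forall a x y, D x -> D y -> l (a *: x + y) = a * l x + l y.

Record semi_inner D : Prop := SemiInner {
  si_sub : linear_subspace D ;
  si_sym : forall x y, D x -> D y -> b x y = b y x ;
  si_lin : forall z, D z -> linear_on D (b ^~ z) ;
  si_ge0 : forall x, D x -> 0 <= b x x }.

Definition seminorm x := Num.sqrt (b x x).

(** The bound [C * 2 * 2^-1 ^+ n] is the tail of the geometric series of increments, so a limit
    comes with its rate. It need not be unique, as the seminorm may have a kernel. *)
Definition geo_complete D := forall (u : nat -> X) (C : R), 0 <= C ->
  (forall n, D (u n)) ->
  (forall n, seminorm (u n.+1 - u n) <= C * 2^-1 ^+ n) ->
  exists2 x, D x & forall n, seminorm (u n - x) <= C * 2 * 2^-1 ^+ n.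

Lemma seminorm_ge0 x : 0 <= seminorm x. Proof. exact: sqrtr_ge0. Qed.

Section subspaces.
Variables (D : set X) (hD : linear_subspace D).
Lemma subspaceD x y : D x -> D y -> D (x + y).
Proof. by move=> dx dy; rewrite -[x]scale1r; apply: hD.2. Qed.
Lemma subspaceZ a x : D x -> D (a *: x).
Proof. by move=> dx; rewrite -[_ *: _]addr0; apply: hD.2 => //; exact: hD.1. Qed.
Lemma subspaceN x : D x -> D (- x).
Proof. by rewrite -scaleN1r; exact: subspaceZ. Qed.
Lemma subspaceB x y : D x -> D y -> D (x - y).
Proof. by move=> dx dy; apply: subspaceD => //; exact: subspaceN. Qed.
Lemma subspace_sum I (r : seq I) (f : I -> X) :
  (forall i, D (f i)) -> D (\sum_(i <- r) f i).
Proof.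
move=> h; elim: r => [|i r IH]; first by rewrite big_nil; exact: hD.1.
by rewrite big_cons; exact: subspaceD.
Qed.

Variables (l : X -> R) (hl : linear_on D l).
Lemma linear_on0 : l 0 = 0.
Proof.
have := hl 1 hD.1 hD.1; rewrite scale1r addr0 mul1r => /eqP.
by rewrite -subr_eq subrr => /eqP.
Qed.
Lemma linear_onD x y : D x -> D y -> l (x + y) = l x + l y.
Proof. by move=> dx dy; rewrite -{1}[x]scale1r hl// mul1r. Qed.
Lemma linear_onZ a x : D x -> l (a *: x) = a * l x.
Proof. by move=> dx; rewrite -[_ *: _]addr0 hl//; [rewrite linear_on0 addr0|exact: hD.1]. Qed.
Lemma linear_onN x : D x -> l (- x) = - l x.
Proof. by move=> dx; rewrite -scaleN1r linear_onZ// mulN1r. Qed.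
Lemma linear_onB x y : D x -> D y -> l (x - y) = l x - l y.
Proof. by move=> dx dy; rewrite linear_onD ?linear_onN//; exact: subspaceN. Qed.
End subspaces.

Section semi_inner_theory.
Variables (D : set X) (hD : semi_inner D).
Let sD := si_sub hD.

Lemma si_linr z : D z -> linear_on D (b z).
Proof.
move=> dz a x y dx dy; rewrite (si_sym hD dz (sD.2 a x y dx dy)) (si_lin hD dz)//.
by rewrite (si_sym hD dx dz) (si_sym hD dy dz).
Qed.

Lemma seminorm_sqr x : D x -> seminorm x ^+ 2 = b x x.
Proof. by move=> dx; rewrite sqr_sqrtr// (si_ge0 hD). Qed.

Lemma siDD x y : D x -> D y -> b (x + y) (x + y) = b x x + 2 * b x y + b y y.
Proof.
move=> dx dy; have dxy : D (x + y) by exact: subspaceD.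
rewrite (linear_onD (si_lin hD dxy))// !(linear_onD (si_linr _))//.
by rewrite (si_sym hD dy dx); ring.
Qed.

Lemma siZZ a x : D x -> b (a *: x) (a *: x) = a ^+ 2 * b x x.
Proof.
move=> dx; have dax : D (a *: x) by exact: subspaceZ.
by rewrite (linear_onZ sD (si_lin hD dax))// (linear_onZ sD (si_linr dx))//; ring.
Qed.

Lemma seminormZ a x : D x -> seminorm (a *: x) = `|a| * seminorm x.
Proof. by move=> dx; rewrite /seminorm siZZ// sqrtrM ?sqr_ge0// sqrtr_sqr. Qed.

Lemma seminormN x : D x -> seminorm (- x) = seminorm x.
Proof. by move=> dx; rewrite -scaleN1r seminormZ// normrN1 mul1r. Qed.

Lemma cauchy_schwarz_sqr x y : D x -> D y -> b x y ^+ 2 <= b x x * b y y.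
Proof.
move=> dx dy.
have h t : 0 <= b x x + 2 * (t * b x y) + t ^+ 2 * b y y.
  rewrite -siZZ// -(linear_onZ sD (si_linr dx))// -siDD//; last exact: subspaceZ.
  by apply: (si_ge0 hD) => //; apply: subspaceD => //; exact: subspaceZ.
(* The form may be degenerate: for a null [y] the polynomial [h] is affine in [t], and a nonzero
   slope would let it take the value -1. *)
have [by0|by0] := eqVneq (b y y) 0.
  rewrite by0 mulr0; have [->|bxy0] := eqVneq (b x y) 0; first by rewrite expr0n.
  have := h (- (b x x + 1) / (2 * b x y)).
  rewrite by0 mulr0 addr0 [2 * _](_ : _ = - (b x x + 1)); last by field.
  by lra.
have byp : 0 < b y y by rewrite lt_def by0 (si_ge0 hD).
have := h (- b x y / b y y).
rewrite (_ : _ + _ = (b x x * b y y - b x y ^+ 2) / b y y); last by field.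
by rewrite pmulr_lge0 ?invr_gt0// subr_ge0.
Qed.

Lemma cauchy_schwarz x y : D x -> D y -> `|b x y| <= seminorm x * seminorm y.
Proof.
move=> dx dy; rewrite -sqrtrM ?(si_ge0 hD)// -sqrtr_sqr ler_wsqrtr//.
exact: cauchy_schwarz_sqr.
Qed.

Lemma seminormD x y : D x -> D y -> seminorm (x + y) <= seminorm x + seminorm y.
Proof.
move=> dx dy; rewrite -(@ler_pXn2r _ 2)// ?nnegrE ?addr_ge0 ?seminorm_ge0//.
rewrite seminorm_sqr ?siDD//; last exact: subspaceD.
rewrite sqrrD !seminorm_sqr//.
by have := le_trans (ler_norm _) (cauchy_schwarz dx dy); lra.
Qed.

Lemma seminorm_dist x y z : D x -> D y -> D z ->
  seminorm (x - z) <= seminorm (x - y) + seminorm (y - z).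
Proof.
move=> dx dy dz; rewrite -[x - z](subrKA y).
by apply: seminormD; exact: subspaceB.
Qed.

Lemma seminorm_distC x y : D x -> D y -> seminorm (x - y) = seminorm (y - x).
Proof. by move=> dx dy; rewrite -seminormN ?opprB//; exact: subspaceB. Qed.

Lemma seminorm_geo (u : nat -> X) C : 0 <= C -> (forall n, D (u n)) ->
  (forall n, seminorm (u n.+1 - u n) <= C * 2^-1 ^+ n) ->
  forall n k, seminorm (u n - u (n + k)%N) <= C * 2 * 2^-1 ^+ n.
Proof.
move=> C0 du hu n k.
(* The exact partial sum of the geometric series is a bound that the induction on [k] can carry. *)
suff : seminorm (u n - u (n + k)%N) <= C * 2 * (2^-1 ^+ n - 2^-1 ^+ (n + k)).
  move/le_trans; apply; rewrite ler_wpM2l ?mulr_ge0// gerBl.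
  by rewrite ltW// geo2_gt0.
elim: k => [|k IH].
  by rewrite addn0 !subrr mulr0 /seminorm (linear_on0 sD (si_lin hD sD.1)) sqrtr0.
apply: (le_trans (seminorm_dist (du n) (du (n + k)%N) (du _))).
have := hu (n + k)%N; rewrite seminorm_distC// -addnS => h.
apply: (le_trans (lerD IH h)); rewrite addnS exprS.
by set x := 2^-1 ^+ n; set y := 2^-1 ^+ (n + k); lra.
Qed.

Hypothesis cD : geo_complete D.

(* The representative minimises [b x x / 2 - l x]; a minimising sequence is
   Cauchy by the parallelogram identity. *)
Lemma riesz (l : X -> R) (c : R) : linear_on D l ->
  (forall x, D x -> `|l x| <= c * seminorm x) ->
  exists2 x, D x & forall y, D y -> b x y = l y.
Proof.
move=> ll lb; pose J x := b x x / 2 - l x.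
have Jlb x : D x -> - (c ^+ 2 / 2) <= J x.
  move=> dx; have := lb _ dx; rewrite ler_norml => /andP[_ h].
  have := sqr_ge0 (seminorm x - c); rewrite /J -seminorm_sqr//.
  by move: h; set s := seminorm x; nra.
pose E := [set J x | x in D]; pose m := inf E.
have hE : has_inf E.
  split; first by exists (J 0), 0 => //; exact: sD.1.
  by exists (- (c ^+ 2 / 2)) => _ [x dx <-]; exact: Jlb.
have mJ x : D x -> m <= J x by move=> dx; apply: ge_inf; [exact: hE.2|exists x].
have /choice[u hu] n : exists x, D x /\ J x < m + (2^-1 ^+ n) ^+ 2.
  have [_ [x dx <-] h] := @inf_adherent _ E _ (exprn_gt0 2 (@geo2_gt0 R n)) hE.
  by exists x; split.
have du n : D (u n) by have [] := hu n.
have Jdist x y : D x -> D y -> b (x - y) (x - y) <= 4 * (J x + J y - 2 * m).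
  move=> dx dy; have dxy : D (x + y) by exact: subspaceD.
  have dN : D (- y) by exact: subspaceN.
  have := mJ _ (subspaceZ sD 2^-1 dxy).
  rewrite /J siZZ// (linear_onZ sD ll)// (linear_onD ll)// !siDD//.
  rewrite -[- y]scaleN1r siZZ// (linear_onZ sD (si_linr dx))//.
  by lra.
(* By [Jdist] the squared distance from [u n] to [u n.+1] is at most [4 * (1 + 1/4) = 5] times
   [4^-n], whence the constant 3. *)
have [x dx hx] : exists2 x, D x & forall n, seminorm (u n - x) <= 3 * 2 * 2^-1 ^+ n.
  apply: cD => // n; rewrite -(@ler_pXn2r _ 2)// ?nnegrE ?seminorm_ge0//.
  rewrite seminorm_sqr//; last exact: subspaceB.
  apply: (le_trans (Jdist _ _ (du _) (du _))).
  have := (hu n).2; have := (hu n.+1).2; rewrite [2^-1 ^+ n.+1]exprS.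
  by have := @geo2_gt0 R n; set e := 2^-1 ^+ n => *; nra.
exists x => // y dy.
(* The almost minimiser [u n] is perturbed by [2^-n y] and [- 2^-n y]: its defect [4^-n] and the
   quadratic term are both of order [4^-n], and are divided by [2^-n]. *)
have key n : `|b (u n) y - l y| <= (1 + b y y) * 2^-1 ^+ n.
  have ht t : m <= J (u n) + t * (b (u n) y - l y) + t ^+ 2 / 2 * b y y.
    have dty : D (t *: y) by exact: subspaceZ.
    have := mJ _ (subspaceD sD (du n) dty).
    rewrite /J siDD// (linear_onD ll)// siZZ// (linear_onZ sD ll)//.
    by rewrite (linear_onZ sD (si_linr (du n)))//; lra.
  have := ht (2^-1 ^+ n); have := ht (- 2^-1 ^+ n); have := (hu n).2.
  have := si_ge0 hD dy.
  have := @geo2_gt0 R n; set e := 2^-1 ^+ n; set v := _ - l y.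
  set B := b y y; set j := J _ => e0 B0 h1 h2 h3.
  by rewrite ler_norml; apply/andP; split; nra.
suff : `|b x y - l y| <= 0 by rewrite normr_le0 subr_eq0 => /eqP.
apply: (@geo2_le0 _ (1 + b y y + 3 * 2 * seminorm y)) => n.
rewrite (_ : b x y - l y = (b (u n) y - l y) - b (u n - x) y); last first.
  by rewrite (linear_onB sD (si_lin hD dy))//; ring.
apply: (le_trans (ler_normB _ _)); rewrite mulrDl; apply: lerD => //.
apply: (le_trans (cauchy_schwarz (subspaceB sD (du n) dx) dy)).
by rewrite mulrAC ler_wpM2r ?seminorm_ge0.
Qed.

(** Since [c] need not be symmetric there is nothing to minimise. The solution is a fixed point of
    the map sending [x] to a Riesz representative of [l - c x]; this map contracts with factor 1/2,
    so the increments decrease exactly as [geo_complete] asks. *)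
Lemma lax_milgram (c : X -> X -> R) (l : X -> R) (k : R) :
  (forall y, D y -> linear_on D (c ^~ y)) ->
  (forall x, D x -> linear_on D (c x)) ->
  (forall x y, D x -> D y -> `|c x y| <= 2^-1 * (seminorm x * seminorm y)) ->
  linear_on D l -> (forall x, D x -> `|l x| <= k * seminorm x) ->
  exists2 x, D x & forall y, D y -> b x y + c x y = l y.
Proof.
move=> cl cr cb ll lb.
(* The condition [D x] is placed under the existential to make the statement total, so that [choice]
   applies. *)
have step x : exists x', D x -> D x' /\ forall y, D y -> b x' y = l y - c x y.
  have [dx|ndx] := pselect (D x); last by exists x.
  have [||x' dx' hx'] := @riesz (fun y => l y - c x y) (k + 2^-1 * seminorm x).
  - by move=> a y z dy dz; rewrite ll// cr//; ring.
  - move=> y dy; apply: (le_trans (ler_normB _ _)); rewrite mulrDl.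
    by apply: lerD; [exact: lb|rewrite -mulrA; exact: cb].
  by exists x'.
have {step}[f hf] := choice step.
pose u n := iter n f 0.
have du n : D (u n) by elim: n => [|n /hf[]//]; exact: sD.1.
have hu n y : D y -> b (u n.+1) y = l y - c (u n) y by move=> dy; exact: (hf _ (du n)).2.
(* The difference of two successive equations is tested against the new increment, then divided by
   its seminorm, the null case being treated apart. *)
have contr n : seminorm (u n.+2 - u n.+1) <= 2^-1 * seminorm (u n.+1 - u n).
  have dd k' : D (u k'.+1 - u k') by exact: subspaceB.
  have := seminorm_sqr (dd n.+1).
  rewrite (linear_onB sD (si_lin hD (dd n.+1)))// !hu//.
  rewrite (_ : _ - _ - _ = c (u n) (u n.+2 - u n.+1) - c (u n.+1) (u n.+2 - u n.+1)); last by ring.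
  rewrite -(linear_onB sD (cl _ (dd n.+1)))// => h.
  have : `|c (u n - u n.+1) (u n.+2 - u n.+1)| <=
      2^-1 * (seminorm (u n - u n.+1) * seminorm (u n.+2 - u n.+1)).
    by apply: cb => //; exact: subspaceB.
  rewrite -h (seminorm_distC (du n))// ger0_norm ?sqr_ge0//.
  have := seminorm_ge0 (u n.+2 - u n.+1); have := seminorm_ge0 (u n.+1 - u n).
  set s := seminorm (u n.+1 - u n); set t := seminorm (u n.+2 - u n.+1) => s0 t0.
  have [->|t0'] := eqVneq t 0; first by lra.
  have tp : 0 < t by rewrite lt_def t0'.
  by rewrite expr2 mulrA ler_pM2r.
pose C := seminorm (u 1 - u 0).
have [x dx hx] : exists2 x, D x & forall n, seminorm (u n - x) <= C * 2 * 2^-1 ^+ n.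
  apply: cD => //; first exact: seminorm_ge0.
  elim=> [|n IH]; first by rewrite expr0 mulr1.
  by rewrite exprS mulrCA; apply: (le_trans (contr n)); rewrite ler_pM2l ?invr_gt0.
exists x => // y dy; apply/eqP; rewrite -subr_eq0 -normr_le0.
apply: (@geo2_le0 _ (C * 2 * seminorm y * 2)) => n.
rewrite (_ : _ - l y = c (x - u n) y - b (u n.+1 - x) y); last first.
  by rewrite (linear_onB sD (cl _ dy))// (linear_onB sD (si_lin hD dy))// hu//; ring.
apply: (le_trans (ler_normB _ _)).
have := cauchy_schwarz (subspaceB sD (du n.+1) dx) dy.
have := cb _ _ (subspaceB sD dx (du n)) dy; rewrite (seminorm_distC dx)//.
have := hx n.+1; have := hx n; rewrite exprS; have := seminorm_ge0 y.
have := @geo2_gt0 R n; have := seminorm_ge0 (u 1 - u 0); rewrite -/C.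
set e := 2^-1 ^+ n; set s := seminorm y.
set p := seminorm (u n - x); set q := seminorm (u n.+1 - x) => C0 e0 s0 hp hq h1 h2.
have := ler_wpM2r s0 hp; have := ler_wpM2r s0 hq.
have : 0 <= C * s * e by rewrite !mulr_ge0// ltW.
by lra.
Qed.

End semi_inner_theory.
End forms.

(** * Square-integrable functions *)

Lemma sub_G_measurable d (T : measurableType d) (R : realType)
    (G G' : set (set T)) (f : T -> R) :
  G `<=` <<s G' >> -> G_measurable G f -> G_measurable G' f.
Proof.
move=> GG' mf _ Y mY; have := mf measurableT Y mY.
by apply: smallest_sub => //; exact: smallest_sigma_algebra.
Qed.

Lemma G_measurable_measurable d (T : measurableType d) (R : realType)
    (G : set (set T)) (f : T -> R) :
  G `<=` measurable -> G_measurable G f -> measurable_fun setT f.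
Proof.
move=> GM mf _ Y mY; have := mf measurableT Y mY.
by apply: smallest_sub => //; exact: sigma_algebra_measurable.
Qed.

Section inner_product.
Context d {T : measurableType d} {R : realType}.
Variable mu : {measure set T -> \bar R}.
Implicit Types (f g h : T -> R^o).

Definition ip f g : R := \int[mu]_x (f x * g x).

(** Measurability refers to the sigma-algebra generated by [G], so one notion serves the members
    [F t] of a filtration and the generators [predictable_rect]. Values lie in [R^o] to make the
    functions an [lmodType]. *)
Definition L2 (G : set (set T)) : set (T -> R^o) :=
  [set f | G_measurable G f /\ (\int[mu]_x (f x ^+ 2)%:E < +oo)%E].

Notation L2m := (L2 measurable).

Lemma L2mP f : L2m f <->
  measurable_fun setT f /\ mu.-integrable setT (fun x => (f x ^+ 2)%:E).
Proof.
split=> [[mf lf]|[mf lf]].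
  have mf' : measurable_fun setT f by exact: G_measurable_measurable mf.
  split=> //; apply/integrableP; split.
    by apply/measurable_EFinP; exact: measurable_funX.
  apply: le_lt_trans lf; apply: ge0_le_integral => //.
  - by apply/measurableT_comp => //; apply/measurable_EFinP; exact: measurable_funX.
  - by apply/measurable_EFinP; exact: measurable_funX.
  - by move=> x _ /=; rewrite ger0_norm// sqr_ge0.
split.
  by move=> _ Y mY; apply: sub_sigma_algebra; exact: mf.
exact: (integrable_lty measurableT lf).
Qed.

Lemma L2_sub (G G' : set (set T)) f : G `<=` <<s G' >> -> L2 G f -> L2 G' f.
Proof. by move=> GG' [mf lf]; split => //; exact: sub_G_measurable mf. Qed.

Lemma L2_L2m (G : set (set T)) f : G `<=` measurable -> L2 G f -> L2m f.
Proof. by move=> GG'; apply: L2_sub => A /GG'; exact: sub_sigma_algebra. Qed.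

Lemma L2m_mul f g : L2m f -> L2m g -> mu.-integrable setT (fun x => (f x * g x)%:E).
Proof.
move=> /L2mP[mf lf] /L2mP[mg lg].
apply: (le_integrable measurableT _ _ (integrableD measurableT lf lg)).
  by apply/measurable_EFinP; exact: measurable_funM.
move=> x _ /=; rewrite lee_fin ler_norml.
rewrite [`|f x ^+2 + _|]ger0_norm ?addr_ge0 ?sqr_ge0//.
by apply/andP; split; have := sqr_ge0 (f x + g x); have := sqr_ge0 (f x - g x); nra.
Qed.

Lemma L2_subspace G : G `<=` measurable -> linear_subspace (L2 G).
Proof.
move=> GM; split.
  rewrite /L2 /=; split; first exact: measurable_cst.
  by under eq_integral do rewrite expr0n/=; rewrite integral0.
move=> a f g lf lg; split.
  apply: (@measurable_funD _ (g_sigma_algebraType G)); last exact: lg.1.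
  by apply: (@measurable_funM _ (g_sigma_algebraType G)); [exact: measurable_cst|exact: lf.1].
have hf := L2_L2m GM lf; have hg := L2_L2m GM lg.
have /L2mP[mf if_] := hf; have /L2mP[mg ig] := hg.
have h : mu.-integrable setT (fun x => ((a * f x) * (a * f x) + 2 * (a * f x * g x) + g x ^+ 2)%:E).
  have h1 : mu.-integrable setT (fun x => (a ^+ 2)%:E * (f x ^+ 2)%:E)%E by exact: integrableZl.
  have h2 : mu.-integrable setT (fun x => (2 * a)%:E * (f x * g x)%:E)%E.
    by apply: integrableZl => //; exact: L2m_mul.
  apply: eq_integrable (integrableD measurableT (integrableD measurableT h1 h2) ig) => //.
  by move=> x _ /=; congr EFin; ring.
apply: le_lt_trans (integrable_lty measurableT h); rewrite le_eqVlt; apply/orP; left; apply/eqP.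
apply: eq_integral => x _; congr EFin.
by rewrite [(a *: f + g) x](_ : _ = a * f x + g x)//; ring.
Qed.

Lemma L2_semi_inner G : G `<=` measurable -> semi_inner ip (L2 G).
Proof.
move=> GM; split; first exact: L2_subspace.
- by move=> f g _ _; apply: eq_Rintegral => x _; rewrite mulrC.
- move=> h lh a f g lf lg; rewrite /ip.
  have h1 := L2m_mul (L2_L2m GM lf) (L2_L2m GM lh).
  have h2 := L2m_mul (L2_L2m GM lg) (L2_L2m GM lh).
  rewrite -RintegralZl// -RintegralD//; last exact: (integrableZl measurableT a h1).
  apply: eq_Rintegral => x _.
  by rewrite [(a *: f + g) x](_ : _ = a * f x + g x)//; ring.
- by move=> f lf; apply: Rintegral_ge0 => x _; rewrite -expr2 sqr_ge0.
Qed.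

Lemma EFin_ip f g : L2m f -> L2m g -> (ip f g)%:E = (\int[mu]_x (f x * g x)%:E)%E.
Proof. by move=> lf lg; rewrite /ip fineK//; apply: integrable_fin_num => //; exact: L2m_mul. Qed.

Lemma EFin_ip_sqr f : L2m f -> (ip f f)%:E = (\int[mu]_x (f x ^+ 2)%:E)%E.
Proof. by move=> lf; rewrite (EFin_ip lf lf). Qed.

Lemma L2_bounded (G : set (set T)) f : G `<=` measurable -> G_measurable G f ->
  forall g, L2m g -> (forall x, `|f x| <= `|g x|) -> L2 G f.
Proof.
move=> GM mf g /L2mP[mg lg] fg; split => //.
apply: le_lt_trans (integrable_lty measurableT lg); apply: ge0_le_integral => //.
- by move=> x _; rewrite lee_fin sqr_ge0.
- by apply/measurable_EFinP/measurable_funX; exact: G_measurable_measurable mf.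
- by apply/measurable_EFinP/measurable_funX.
- move=> x _; rewrite lee_fin -[f x ^+ 2]real_normK ?num_real//.
  by rewrite -[g x ^+ 2]real_normK ?num_real// ler_sqr ?nnegrE.
Qed.

End inner_product.
Notation L2m mu := (L2 mu measurable).

Lemma sum_geo2_le {R : realType} (N : nat) :
  \sum_(0 <= n < N) (2^-1 : R) ^+ n <= 2.
Proof.
have := @geometric_le_lim R N 1 2^-1 ler01.
rewrite invr_gt0 ltr0n ger0_norm ?invr_ge0// invf_lt1// ltr1n => /(_ erefl erefl).
rewrite (_ : 1 / _ = 2); last by field.
by apply: le_trans; rewrite /series/= le_eqVlt; apply/orP; left; apply/eqP;
  apply: eq_bigr => i _; rewrite mul1r.
Qed.

(* By AM-GM each increment is at most [2^-n + 2^n (v n.+1 - v n)^2]. *)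
Lemma cvg_weighted_increments {R : realType} (v : nat -> R) (B : R) :
  (forall N, \sum_(0 <= n < N) 2 ^+ n * (v n.+1 - v n) ^+ 2 <= B) -> cvgn v.
Proof.
move=> hB.
have -> : v = (fun n => v 0%N + series (telescope v) n).
  by apply/funext => n; exact: eq_sum_telescope.
apply: is_cvgD; first exact: is_cvg_cst.
apply: normed_cvg; apply: nondecreasing_is_cvgn.
  by apply: nondecreasing_series => i _ _; exact: normr_ge0.
exists (2 + B) => _ [N _ <-]; rewrite /series/=.
apply: le_trans (lerD (sum_geo2_le N) (hB N)).
rewrite -big_split/=; apply: ler_sum => n _; rewrite /telescope exprVn.
set a := v n.+1 - v n; have := exprn_gt0 n (@ltr0n R 2).
set e := 2 ^+ n => e0.
have := sqr_ge0 (e * `|a| - 1); rewrite -[a ^+ 2]real_normK ?num_real//.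
set b := `|a| => h.
rewrite -(ler_pM2l e0) mulrDr mulfV ?gt_eqF//.
have := normr_ge0 a; rewrite -/b => b0; nra.
Qed.

Lemma limn_einf_le {R : realType} (u : nat -> \bar R) (x : \bar R) :
  (forall n, u n <= x)%E -> (limn_einf u <= x)%E.
Proof.
move=> h; rewrite limn_einf_lim; apply: lime_le; first exact: is_cvg_einfs.
apply: nearW => n; apply: le_trans (h n); apply: ereal_inf_lbound.
by exists n => /=.
Qed.

(** * Completeness of L2 over a sub-sigma-algebra *)

Section completeness.
Context d {T : measurableType d} {R : realType}.
Variable mu : {measure set T -> \bar R}.
Variables (G : set (set T)) (GM : G `<=` measurable).
Let sG := L2_semi_inner mu GM.
Let sM := L2_semi_inner mu (@subset_refl _ (@measurable _ T)).

(** The series of the squared increments weighted by [2 ^+ n] has integral at most the sum of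
    [2^n C^2 4^-n], that is [2 C^2], hence is finite almost everywhere. Squares are used because the
    increments themselves need not be integrable when [mu] is infinite. *)
Lemma L2_geo_ae_cvg (u : nat -> T -> R^o) (C : R) : 0 <= C ->
  (forall n, L2m mu (u n)) ->
  (forall n, seminorm (ip mu) (u n.+1 - u n) <= C * 2^-1 ^+ n) ->
  {ae mu, forall x, cvgn (u ^~ x)}.
Proof.
move=> C0 du hu.
pose a n x : R := u n.+1 x - u n x.
have da n : L2m mu (a n) by exact: (subspaceB (si_sub sM) (du _) (du _)).
pose g n x := (2 ^+ n * a n x ^+ 2)%:E.
have mg n : measurable_fun setT (g n).
  apply/measurable_EFinP; apply: measurable_funM => //; apply: measurable_funX.
  by have /L2mP[] := da n.
have g0 n x : setT x -> (0 <= g n x)%E by rewrite lee_fin mulr_ge0// ?sqr_ge0// exprn_ge0.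
pose S x := (\sum_(n <oo) g n x)%E.
have mS : measurable_fun setT S by apply: (@ge0_emeasurable_sum _ _ _ setT g predT) => // n x h _; exact: g0.
have S0 x : (0 <= S x)%E by apply: nneseries_ge0 => n _ _; exact: g0.
have iS : mu.-integrable setT S.
  apply/integrableP; split=> //.
  under eq_integral do rewrite gee0_abs//.
  rewrite /S integral_nneseries//.
  apply: (@le_lt_trans _ _ (C ^+ 2 * 2)%:E); last exact: ltry.
  apply: lime_le; first by apply: is_cvg_nneseries => n _ _; apply: integral_ge0 => x h; exact: g0.
  apply: nearW => N.
  have hg n : (\int[mu]_x g n x = (2 ^+ n * ip mu (a n) (a n))%:E)%E.
    rewrite EFinM EFin_ip_sqr// -ge0_integralZl//.
    - by apply/measurable_EFinP/measurable_funX; have /L2mP[] := da n.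
    - by move=> x _; rewrite lee_fin sqr_ge0.
  rewrite (eq_bigr _ (fun n _ => hg n)) sumEFin lee_fin.
  apply: (@le_trans _ _ (C ^+ 2 * \sum_(0 <= n < N) 2^-1 ^+ n)); last first.
    by rewrite ler_wpM2l ?sqr_ge0// sum_geo2_le.
  rewrite mulr_sumr; apply: ler_sum => n _.
  rewrite -(seminorm_sqr sM (da n)).
  have hs : seminorm (ip mu) (a n) <= C * 2^-1 ^+ n by exact: hu.
  have := seminorm_ge0 (ip mu) (a n); move: hs; set s := seminorm _ (a n) => hs s0.
  have : s ^+ 2 <= (C * 2^-1 ^+ n) ^+ 2.
    by rewrite ler_sqr ?nnegrE// mulr_ge0// exprn_ge0// invr_ge0.
  rewrite exprVn; have := exprn_gt0 n (@ltr0n R 2); set e := 2 ^+ n => e0 h.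
  apply: (le_trans (ler_wpM2l (ltW e0) h)).
  by rewrite le_eqVlt; apply/orP; left; apply/eqP; field; rewrite gt_eqF.
apply: filterS (integrable_ae measurableT iS) => x /(_ I) Sfin.
apply: (@cvg_weighted_increments _ _ (fine (S x))) => N.
rewrite -lee_fin fineK// -sumEFin.
by apply: nneseries_lim_ge => n _ _; exact: g0.
Qed.

Lemma L2_complete : geo_complete (ip mu) (L2 mu G).
Proof.
move=> u C C0 duG hu.
have du n : L2m mu (u n) by exact: L2_L2m (duG n).
have ae_cvg := L2_geo_ae_cvg C0 du hu.
(* The upper limit is defined at every point and is measurable for the generated sigma-algebra, to
   which the null set of divergence need not belong. *)
pose f x : R := fine (limn_esup (fun n => (u n x)%:E)).
have mfG : G_measurable G f.
  apply: measurableT_comp => //; apply: measurable_fun_limn_esup => n.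
  by apply/measurable_EFinP; exact: (duG n).1.
have mf : measurable_fun setT f by exact: G_measurable_measurable mfG.
have cvgf : {ae mu, forall x, u n x @[n --> \oo] --> f x}.
  apply: filterS ae_cvg => x /cvg_ex[l hl].
  have hl' : (u n x)%:E @[n --> \oo] --> l%:E by apply: cvg_EFin => //; exact: nearW.
  by rewrite /f (cvg_limn_einf_sup hl').2.
(* Fatou along [k] transfers the geometric bound on [u n - u (k + n)] to the limit. It also puts [f]
   in L2, as [u 0 - (u 0 - f)]. *)
have bound n : (\int[mu]_x ((u n x - f x) ^+ 2)%:E <= ((C * 2 * 2^-1 ^+ n) ^+ 2)%:E)%E.
  pose v k x : R := u n x - u (k + n)%N x.
  have dv k : L2m mu (v k) by exact: (subspaceB (si_sub sM) (du _) (du _)).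
  have mv k : measurable_fun setT (fun x => (v k x ^+ 2)%:E).
    by apply/measurable_EFinP/measurable_funX; have /L2mP[] := dv k.
  apply: (@le_trans _ _ (\int[mu]_x limn_einf (fun k => (v k x ^+ 2)%:E))%E).
    apply: ae_ge0_le_integral => //.
    - by move=> x _; rewrite lee_fin sqr_ge0.
    - apply/measurable_EFinP/measurable_funX/measurable_funB => //.
      by have /L2mP[] := du n.
    - move=> x _; rewrite limn_einf_lim; apply: lime_ge; first exact: is_cvg_einfs.
      apply: nearW => k; apply: le_ereal_inf_tmp => _ [m _ <-].
      by rewrite lee_fin sqr_ge0.
    - under eq_fun do rewrite -[limn_einf _]oppeK -limn_esupN.
      apply: measurableT_comp => //; apply: measurable_fun_limn_esup => k /=.
      by have /measurable_EFinP := mv k => h; apply/measurable_EFinP; exact: measurable_funN.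
    - apply: filterS cvgf => x hx _.
      suff h : (v k x ^+ 2)%:E @[k --> \oo] --> ((u n x - f x) ^+ 2)%:E.
        by rewrite (cvg_limn_einf_sup h).1.
      apply: cvg_EFin; first exact: nearW.
      have h : v k x @[k --> \oo] --> u n x - f x.
        apply: cvgB; first exact: cvg_cst.
        by rewrite -(cvg_shiftn n) in hx.
      by under eq_fun do rewrite expr2; rewrite expr2; exact: cvgM.
  apply: le_trans (fatou mu measurableT mv _) _.
    by move=> k x _; rewrite lee_fin sqr_ge0.
  apply: limn_einf_le => k; rewrite -EFin_ip_sqr// lee_fin.
  rewrite -(seminorm_sqr sM (dv k)) ler_sqr ?nnegrE ?seminorm_ge0//.
    by have := seminorm_geo sM C0 du hu n k; rewrite addnC.
  by rewrite !mulr_ge0// exprn_ge0// invr_ge0.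
have duf n : L2m mu (u n - f).
  split; last exact: le_lt_trans (bound n) (ltry _).
  have [_ h] := @L2mP _ _ _ mu (u n).
  apply: (@measurable_funB _ (g_sigma_algebraType measurable)).
    exact: (du n).1.
  by move=> _ Y mY; apply: sub_sigma_algebra; exact: mf.
have df : L2 mu G f.
  split=> //; have [_] := subspaceB (si_sub sM) (du 0%N) (duf 0%N).
  by under eq_integral => x _ do rewrite (_ : (_ - _) x = f x) ?opprB ?subrKC//.
exists f => // n; rewrite -(@ler_pXn2r _ 2)// ?nnegrE ?seminorm_ge0//; last first.
  by rewrite !mulr_ge0// exprn_ge0// invr_ge0.
by rewrite (seminorm_sqr sM)// -lee_fin EFin_ip_sqr//; exact: bound.
Qed.

End completeness.

Import HBNNSimple.

(** * Monotone class arguments in L2 of a finite measure *)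

Section induction.
Context d {T : measurableType d} {R : realType}.
Variable mu : {finite_measure set T -> \bar R}.
Variables (G : set (set T)) (GM : G `<=` measurable).
Let sM := L2_semi_inner mu (@subset_refl _ (@measurable _ T)).

Lemma g_sigma_sub_measurable : <<s G >> `<=` measurable.
Proof. by apply: smallest_sub => //; exact: sigma_algebra_measurable. Qed.

Lemma L2_indic (B : set T) : <<s G >> B -> L2 mu G (\1_B).
Proof.
move=> GB; split.
  by apply: (@measurable_indic _ (g_sigma_algebraType G)).
rewrite (@le_lt_trans _ _ (\int[mu]_x (\1_B x)%:E)%E)//.
  rewrite le_eqVlt; apply/orP; left; apply/eqP; apply: eq_integral => x _.
  by rewrite indicE; case: (x \in B); rewrite ?expr1n ?expr0n.
have mB := g_sigma_sub_measurable GB.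
by rewrite integral_indic// setIT ltey_eq fin_num_measure.
Qed.

Lemma L2_cvg_approx (f : T -> R^o) (u : nat -> T -> R^o) :
  L2 mu measurable f -> (forall n, L2 mu measurable (u n)) ->
  (forall x, u n x @[n --> \oo] --> f x) -> (forall n x, `|u n x| <= `|f x|) ->
  forall e, 0 < e -> exists n, seminorm (ip mu) (f - u n) <= e.
Proof.
move=> lf lu cvgu uf e e0.
have du n : L2 mu measurable (f - u n) by exact: (subspaceB (si_sub sM)).
have /L2mP[mf if_] := lf.
have [|||||_ _] := @dominated_convergence _ _ _ mu setT measurableT
   (* As [|u n x| <= |f x|], the difference is at most [2 |f x|], whence the dominating function
      [4 f^2]. *)
   (fun n x => ((f x - u n x) ^+ 2)%:E) (cst 0%E) (fun x => 4%:E * (f x ^+ 2)%:E)%E.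
- by move=> n; have /L2mP[md _] := du n; apply/measurable_EFinP/measurable_funX.
- exact: measurable_cst.
- apply: nearW => x _; apply: cvg_EFin; first exact: nearW.
  have h : f x - u n x @[n --> \oo] --> (0 : R).
    by rewrite -(subrr (f x)); apply: cvgB => //; exact: cvg_cst.
  by have := cvgM h h; rewrite mulr0; exact.
- exact: integrableZl.
- apply: nearW => x n _; rewrite lee_fin ger0_norm ?sqr_ge0//.
  have := uf n x; rewrite -[f x ^+ 2]real_normK ?num_real//.
  rewrite -[(_ - _) ^+ 2]real_normK ?num_real//.
  have := ler_normB (f x) (u n x); have := normr_ge0 (f x - u n x).
  by have := normr_ge0 (u n x); nra.
rewrite /= integral0 => /fine_cvgP[_] /cvgrPdist_le /(_ (e ^+ 2) (exprn_gt0 _ e0)).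
move=> [n _ /(_ n (leqnn n))] /=; rewrite sub0r normrN => h; exists n.
rewrite -(@ler_pXn2r _ 2)// ?nnegrE ?seminorm_ge0 ?(ltW e0)//.
rewrite (seminorm_sqr sM)//; apply: le_trans h; apply: le_trans (ler_norm _).
by rewrite -lee_fin EFin_ip_sqr// fineK// -EFin_ip_sqr.
Qed.

Definition L2_closed (U : set (T -> R^o)) := forall f, L2 mu G f ->
  (forall e, 0 < e -> exists g, [/\ U g, L2 mu G g & seminorm (ip mu) (f - g) <= e]) ->
  U f.

Lemma L2_ind (U : set (T -> R^o)) : linear_subspace U -> L2_closed U ->
  (forall B, <<s G >> B -> U (\1_B)) -> L2 mu G `<=` U.
Proof.
move=> sU cU indU.
have key f : (forall x, 0 <= f x) -> L2 mu G f -> U f.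
  move=> f0 lf; apply: cU => // e e0.
  (* Simple functions are taken on the space endowed with [<<s G >>], so that their level sets lie
     in it. *)
  pose T' : measurableType _ := g_sigma_algebraType G.
  have mf : measurable_fun [set: T'] (EFin \o (f : T' -> R)).
    by apply/measurable_EFinP; exact: lf.1.
  have [|g [ndg cvgg]] := approximation (@measurableT _ T') mf.
    by move=> x _; rewrite lee_fin.
  have cg (x : T) : (g n : T' -> R) x @[n --> \oo] --> f x.
    have := cvgg x I => /fine_cvgP[_]; exact.
  have gf n (x : T) : `|(g n : T' -> R) x| <= `|f x|.
    rewrite !ger0_norm//.
    have nd : nondecreasing_seq (fun n => (g n : T' -> R) x).
      by move=> m k mk; exact/lefP/ndg.
    rewrite -(cvg_lim _ (cg x))//; apply: nondecreasing_cvgn_le => //.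
    by apply/cvg_ex; exists (f x); exact: cg.
  have lfM := L2_L2m GM lf.
  have lg n : L2 mu G (g n : T' -> R).
    by apply: (L2_bounded GM _ lfM) => //; exact: (@measurable_funPT _ _ T').
  have [n hn] := L2_cvg_approx lfM (fun n => L2_L2m GM (lg n)) cg gf e0.
  exists (g n : T' -> R); split => //.
  have -> : (g n : T' -> R) = \sum_(y <- finmap.enum_fset (fset_set (range (g n : T' -> R))))
      (y : R) *: (\1_((g n : T' -> R) @^-1` [set y]) : T -> R^o).
    apply/funext => x; rewrite fimfunE fsbig_finite//= fct_sumE.
    by apply: eq_bigr.
  apply: (@subspace_sum _ _ _ sU) => y; apply: (subspaceZ sU); apply: indU.
  have := @measurable_funPT _ _ T' _ (g n) measurableT _ (measurable_set1 y).
  by rewrite setTI.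
move=> f lf.
have fpn : f = (-1) *: f^\- + f^\+.
  apply/funext => x; rewrite [RHS](_ : _ = -1 * f^\- x + f^\+ x)//.
  rewrite /funrpos /funrneg; have [h|h] := leP (f x) 0.
    by rewrite (max_l (_ : 0 <= - f x)) ?oppr_ge0//; ring.
  by rewrite (max_r (_ : - f x <= 0)) ?oppr_le0 ?ltW//; ring.
rewrite fpn; apply: sU.2; apply: key => //.
- apply: (L2_bounded GM _ (L2_L2m GM lf)).
    by apply: (@measurable_funrneg _ (g_sigma_algebraType G)); exact: lf.1.
  move=> x; rewrite /funrneg ger0_norm ?le_max ?lexx ?orbT//.
  by rewrite ge_max normr_ge0 -normrN ler_norm.
- apply: (L2_bounded GM _ (L2_L2m GM lf)).
    by apply: (@measurable_funrpos _ (g_sigma_algebraType G)); exact: lf.1.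
  move=> x; rewrite /funrpos ger0_norm ?le_max ?lexx ?orbT//.
  by rewrite ge_max normr_ge0 ler_norm.
Qed.

(** A pi-lambda argument: the sets whose indicator lies in [U] form a lambda-system, increasing
    unions being handled by closedness. The whole space is a separate premise because it need not be
    a generator: no predictable rectangle contains times outside [[0, T]]. *)
Lemma L2_ind_setI (U : set (T -> R^o)) : setI_closed G ->
  linear_subspace U -> L2_closed U -> U (\1_setT) ->
  (forall B, G B -> U (\1_B)) -> L2 mu G `<=` U.
Proof.
move=> GI sU cU UT indU; apply: L2_ind => // B GB.
suff [] : [set B | <<s G >> B /\ U (\1_B)] B by [].
apply: (lambda_system_subset GI _ _ _ GB) => //; last first.
  by move=> A GA; split; [exact: sub_sigma_algebra|exact: indU].
split => //.
- by split => //; exact: (@measurableT _ (g_sigma_algebraType G)).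
- move=> A C CA [GA UA] [GC UC]; split.
    exact: (@measurableD _ (g_sigma_algebraType G)).
  have -> : \1_(A `\` C) = (-1) *: (\1_C : T -> R^o) + \1_A.
    apply/funext => x; rewrite [RHS](_ : _ = -1 * \1_C x + \1_A x)//.
    rewrite !indicE in_setD; have [xC|xC] := boolP (x \in C).
      by rewrite (_ : x \in A) ?mulr1 ?addNr//; apply/mem_set/CA/set_mem.
    by rewrite andbT mulr0 add0r.
  exact: sU.2.
- move=> A ndA hA; have GU : <<s G >> (\bigcup_n A n).
    by apply: (@bigcup_measurable _ (g_sigma_algebraType G)) => n _; exact: (hA n).1.
  split=> //; apply: cU; first exact: L2_indic.
  move=> e e0; have LA n := L2_indic (hA n).1.
  have [||n hn] := L2_cvg_approx (L2_L2m GM (L2_indic GU)) (fun n => L2_L2m GM (LA n)) _ _ e0.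
  + move=> x; have [[n _ Ax]|nx] := pselect ((\bigcup_n A n) x).
      apply: cvg_near_cst; exists n => // m /= nm.
      rewrite !indicE mem_set; last by have /subsetPset := ndA _ _ nm; exact.
      by rewrite mem_set//; exists n.
    apply: cvg_near_cst; apply: nearW => n.
    by rewrite !indicE !memNset// => Ax; apply: nx; exists n.
  + move=> n x; rewrite !ger0_norm// !indicE ler_nat.
    have [/set_mem Ax|//] := boolP (x \in A n).
    by rewrite mem_set//; exists n.
  by exists (\1_(A n)); split => //; exact: (hA n).2.
Qed.

End induction.

(** * The measure P x <M> on Omega x [0, T] *)

Section stieltjes_measure.
Context {R : realType}.
Variables (T : R) (T0 : 0 <= T) (f : R -> R) (incf : increasing_path T f).

Lemma stieltjes_oc (a b : R) : a <= b ->
  stieltjes T f `]a, b]%classic = (clamp T f b - clamp T f a)%:E.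
Proof.
move=> ab; rewrite /stieltjes.
case: pselect => [h|/(_ (clamp_increasing T0 incf))//].
transitivity (wlength (cumulative_of h) `]a, b]%classic); last first.
  by rewrite wlength_itv_bnd.
by apply: measurable_mu_extE; exact: is_ocitv.
Qed.

Lemma stieltjes_setT : stieltjes T f setT = (f T - f 0)%:E.
Proof.
pose A n : set (measurableTypeR R) := `]- n%:R, n%:R]%classic.
have ndA : nondecreasing_seq A.
  move=> m n mn; apply/subsetPset => x; rewrite /A /= !in_itv/= => /andP[h1 h2].
  rewrite (le_trans h2) ?ler_nat// andbT; apply: le_lt_trans h1.
  by rewrite lerN2 ler_nat.
have UA : \bigcup_n A n = setT.
  apply/seteqP; split => // x _; exists (Num.bound `|x|).+1 => //.
  have := archi_boundP (normr_ge0 x); rewrite /A/= in_itv/=.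
  rewrite -natr1; have := ler_norm x; have := ler_norm (- x); rewrite normrN.
  by move=> h1 h2 h3; apply/andP; split; lra.
have mA n : measurable (A n) by exact: measurable_itv.
have := @nondecreasing_cvg_mu _ _ _ (stieltjes T f) A mA.
rewrite UA => /(_ measurableT ndA) h; rewrite -(cvg_lim _ h)//.
apply: lim_near_cst => //; exists (Num.bound T) => // n /= Tn.
have TN : T <= n%:R.
  apply: ltW; apply: lt_le_trans (archi_boundP T0) _.
  by rewrite ler_nat.
have nN : - n%:R <= 0 :> R by rewrite oppr_le0.
by rewrite stieltjes_oc ?(le_trans nN)// clamp_geT// clamp_le0.
Qed.

Lemma stieltjes_support : stieltjes T f (~` `]0, T]%classic) = 0%E.
Proof.
have fin : (stieltjes T f setT < +oo)%E by rewrite stieltjes_setT ltry.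
have m0T : measurable (`]0, T]%classic : set (measurableTypeR R)) by exact: measurable_itv.
rewrite -setTD measureD// setTI; have hT := stieltjes_oc T0.
transitivity ((f T - f 0)%:E - (f T - f 0)%:E)%E; last by rewrite subee.
congr (_ - _)%E; first exact: stieltjes_setT.
by apply: (etrans hT); rewrite clamp_geT// clamp_le0.
Qed.

End stieltjes_measure.

(** * Composition of a probability with the kernel of path measures *)

Section stieltjes_kernel.
Context d {X : measurableType d} {R : realType}.
Variables (T : R) (W : R -> X -> R) (M : R).
Hypothesis T0 : 0 <= T.
Hypothesis W_inc : forall x, increasing_path T (W ^~ x).
Hypothesis W_meas : forall t, 0 <= t <= T -> measurable_fun setT (W t).
Hypothesis W_bd : forall x, W T x - W 0 x < M.

Definition path_measure (x : X) : {measure set (measurableTypeR R) -> \bar R} :=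
  stieltjes T (W ^~ x).

Let kernel_measurable (U : set (measurableTypeR R)) : measurable U ->
  measurable_fun setT (path_measure ^~ U).
Proof.
move: U; apply: (@dynkin_induction _ (measurableTypeR R) (@ocitv R)).
- by rewrite /measurable/=.
- exact: ocitvI.
- rewrite /path_measure; under eq_fun do rewrite stieltjes_setT//.
  by apply/measurable_EFinP/measurable_funB; apply: W_meas; rewrite lexx T0.
- move=> _ [[a b] _ <-] /=; have [ab|ba] := leP a b; last first.
    rewrite set_itv_ge ?bnd_simp -?leNgt ?ltW//.
    by under eq_fun do rewrite measure0; exact: measurable_cst.
  rewrite (_ : (fun _ => _) = (fun x => (clamp T (W ^~ x) b - clamp T (W ^~ x) a)%:E)); last first.
    by apply/funext => x; exact: (stieltjes_oc T0 (W_inc x) ab).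
  apply/measurable_EFinP/measurable_funB; apply: W_meas.
    by rewrite le_max lexx ge_max T0 ge_min lexx orbT.
  by rewrite le_max lexx ge_max T0 ge_min lexx orbT.
- move=> S mS hS.
  rewrite (_ : (fun _ => _) = (fun x => (W T x - W 0 x)%:E - path_measure x S)%E).
    apply: emeasurable_funB => //.
    by apply/measurable_EFinP/measurable_funB; apply: W_meas; rewrite lexx T0.
  apply/funext => x; have hT := stieltjes_setT T0 (W_inc x).
  have fin : (path_measure x setT < +oo)%E by rewrite /path_measure hT ltry.
  by rewrite -setTD measureD// setTI; congr (_ - _)%E.
- move=> S mS tS hS.
  rewrite (_ : (fun _ => _) = (fun x => \sum_(n <oo) path_measure x (S n))%E).
    by apply: (@ge0_emeasurable_sum _ _ _ setT (fun n x => path_measure x (S n)) predT).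
  apply/funext => x; rewrite measure_bigcup//.
  by apply: eq_eseriesl => n; rewrite in_setT.
Qed.

HB.instance Definition _ := isKernel.Build _ _ X (measurableTypeR R) R
  path_measure kernel_measurable.

Let kernel_uub : measure_fam_uub path_measure.
Proof. by exists M => x; rewrite stieltjes_setT// lte_fin W_bd. Qed.

HB.instance Definition _ := Kernel_isFinite.Build _ _ X (measurableTypeR R) R
  path_measure kernel_uub.

Definition path_kernel : R.-fker X ~> (measurableTypeR R) := path_measure.

Variable P : probability X R.

(* The image of [path_measure z.2] under [pair z.2]. *)
Definition fiber_measure (z : unit * X) :
    {measure set (X * measurableTypeR R)%type -> \bar R} :=
  measure_function_pushforward__canonical__measure_function_Measure
    (path_measure z.2) (pair1_measurable z.2).

Let fiber_kernel_measurable U : measurable U ->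
  measurable_fun setT (fiber_measure ^~ U).
Proof.
move=> mU; rewrite (_ : fiber_measure ^~ U =
    (fun x => path_measure x (xsection U x)) \o snd); last first.
  by apply/funext => z /=; rewrite /pushforward xsectionE.
apply: measurableT_comp => //.
by apply: (measurable_fun_xsection_finite_kernel path_kernel); rewrite inE.
Qed.

HB.instance Definition _ := isKernel.Build _ _ _ _ R fiber_measure fiber_kernel_measurable.

Let fiber_uub : measure_fam_uub fiber_measure.
Proof.
exists M => z; rewrite /fiber_measure/= /pushforward preimage_setT.
by rewrite stieltjes_setT// lte_fin W_bd.
Qed.

HB.instance Definition _ := Kernel_isFinite.Build _ _ _ _ R fiber_measure fiber_uub.

(** The probability becomes a kernel on the one-point space, so that composing it with
    [fiber_measure] produces a single measure on the product. *)
Let cst_kernel : R.-pker unit ~> X :=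
  @kprobability _ _ unit X R (cst (P : pprobability X R)) (measurable_cst _).

Let product_mu : {measure set (X * measurableTypeR R)%type -> \bar R} :=
  kcomp cst_kernel fiber_measure tt.

Let mu_fin : fin_num_fun product_mu.
Proof.
apply: lty_fin_num_fun.
apply: (@le_lt_trans _ _ (\int[P]_x (cst M%:E) x)%E).
  apply: ge0_le_integral => //=.
  - by move=> x _; rewrite /pushforward measure_ge0.
  - exact: (kernel_measurable measurableT).
  move=> x _; rewrite /pushforward preimage_setT.
  by rewrite stieltjes_setT// lee_fin ltW.
by rewrite integral_cst//= probability_setT mule1 ltry.
Qed.

Definition dolm : {finite_measure set (X * measurableTypeR R)%type -> \bar R} :=
  HB.pack (kcomp cst_kernel fiber_measure tt)
    (Measure_isFinite.Build _ _ _ product_mu mu_fin).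

(** Apart from finiteness, the later sections know the measure only through this formula and
    [measurable_integral_path]; there they are the hypotheses [mu_int] and [mu_meas]. *)
Lemma integral_dolm (f : X * measurableTypeR R -> \bar R) :
  (forall z, 0 <= f z)%E -> measurable_fun setT f ->
  (\int[dolm]_z f z = \int[P]_x \int[path_measure x]_t f (x, t))%E.
Proof.
move=> f0 mf; transitivity (\int[kcomp cst_kernel fiber_measure tt]_z f z)%E => //.
rewrite integral_kcomp//; apply: eq_integral => x _.
by rewrite ge0_integral_pushforward.
Qed.

Lemma measurable_integral_path (f : X * measurableTypeR R -> \bar R) :
  (forall z, 0 <= f z)%E -> measurable_fun setT f ->
  measurable_fun setT (fun x => \int[path_measure x]_t f (x, t))%E.
Proof.
by move=> f0 mf; exact: (measurable_fun_integral_finite_kernel f path_kernel f0 mf).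
Qed.

End stieltjes_kernel.

(** * Step processes *)

Lemma indic_setX {S S' : Type} {R : pzRingType} (A : set S) (B : set S') z :
  \1_(A `*` B) z = \1_A z.1 * \1_B z.2 :> R.
Proof. by rewrite !indicE in_setX -natrM mulnb. Qed.

Lemma predictable_rect_mono d (Omega : measurableType d) (R : realType) (T : R)
    (F H : R -> set (set Omega)) : 0 <= T ->
  (forall t, 0 <= t <= T -> H t `<=` F t) ->
  predictable_rect T H `<=` predictable_rect T F.
Proof.
move=> T0 HF A [[A' HA ->]|[s [t [A' [s0 st tT HA ->]]]]].
  by left; exists A' => //; apply: HF => //; rewrite lexx.
right; exists s, t, A'; split => //; apply: HF => //.
by rewrite s0 (le_trans (ltW st)).
Qed.

Section filtration.
Context d {Omega : measurableType d} {R : realType}.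
Variables (P : probability Omega R) (T : R) (F : R -> set (set Omega)).
Hypothesis T_gt0 : 0 < T.
Hypothesis F_usual : usual_filtration P T F.

Lemma filtration_sub t : 0 <= t <= T -> F t `<=` measurable.
Proof. by have [_ h _ _ _] := F_usual; exact: h. Qed.

Lemma filtration_sigma t : 0 <= t <= T -> <<s F t >> = F t.
Proof. by have [h _ _ _ _] := F_usual; move=> /h; exact: sigma_algebra_id. Qed.

Lemma filtration_mono s t : 0 <= s -> s <= t -> t <= T -> F s `<=` F t.
Proof. by have [_ _ h _ _] := F_usual; exact: h. Qed.

Lemma filtration_setT t : 0 <= t <= T -> F t setT.
Proof.
move=> tT; rewrite -filtration_sigma//.
exact: (@measurableT _ (g_sigma_algebraType (F t))).
Qed.

Lemma filtrationI t A B : 0 <= t <= T -> F t A -> F t B -> F t (A `&` B).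
Proof.
move=> tT; rewrite -filtration_sigma//.
exact: (@measurableI _ (g_sigma_algebraType (F t))).
Qed.

Lemma filtration_measurable s t (Y : Omega -> R) : 0 <= s -> s <= t -> t <= T ->
  G_measurable (F s) Y -> G_measurable (F t) Y.
Proof.
move=> s0 st tT; apply: sub_G_measurable => A FA.
by apply: sub_sigma_algebra; exact: filtration_mono FA.
Qed.

Lemma L2_filtration_mono s t : 0 <= s -> s <= t -> t <= T ->
  L2 P (F s) `<=` L2 P (F t).
Proof.
move=> s0 st tT Y [mY lY]; split => //.
exact: (filtration_measurable s0 st tT).
Qed.

Notation OR := (Omega * measurableTypeR R)%type.

Lemma setX_measurable A (s t : R) : measurable A ->
  measurable (A `*` `]s, t]%classic : set OR).
Proof. by move=> mA; apply: measurableX => //; exact: measurable_itv. Qed.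

Lemma predictable_rect_measurable :
  (predictable_rect T F : set (set OR)) `<=` measurable.
Proof.
move=> B [[A FA ->]|[s [t [A [s0 st tT FA ->]]]]].
  apply: measurableX; last exact: measurable_set1.
  by apply: (filtration_sub _ FA); rewrite lexx ltW.
apply: setX_measurable; apply: (filtration_sub _ FA).
by rewrite s0 (le_trans (ltW st)).
Qed.

Lemma predictable_rect_setI :
  setI_closed (predictable_rect T F : set (set OR)).
Proof.
have F00 : F 0 set0.
  rewrite -filtration_sigma ?lexx ?ltW//.
  exact: (@measurable0 _ (g_sigma_algebraType (F 0))).
have E0 (B : set OR) : B = set0 -> predictable_rect T F B.
  by move=> ->; left; exists set0 => //; rewrite set0X.
have Z0 A A' (s t : R) : 0 <= s ->
    (A `*` [set 0]) `&` (A' `*` `]s, t]) = set0 :> set OR.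
  move=> s0; rewrite -subset0 => -[w r] /= [[_ ->] [_]].
  by rewrite in_itv/= ltNge s0.
move=> B B' [[A FA ->]|[s [t [A [s0 st tT FA ->]]]]]
  [[A' FA' ->]|[s' [t' [A' [s0' st' tT' FA' ->]]]]].
- left; exists (A `&` A'); first by apply: filtrationI => //; rewrite lexx ltW.
  by rewrite -setXI setIid.
- by apply: E0; exact: Z0.
- by apply: E0; rewrite setIC; exact: Z0.
- rewrite -setXI; have [ab|ba] := ltP (Num.max s s') (Num.min t t').
    right; exists (Num.max s s'), (Num.min t t'), (A `&` A'); split => //.
    + by rewrite le_max s0.
    + by rewrite ge_min tT.
    + have [h1 h2] : Num.max s s' <= T /\ True.
        by split => //; apply: (le_trans (ltW ab)); rewrite ge_min tT.
      by apply: filtrationI;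
        [rewrite le_max s0|
         apply: (filtration_mono s0 _ h1 FA); rewrite le_max lexx|
         apply: (filtration_mono s0' _ h1 FA'); rewrite le_max lexx orbT].
    + by congr (_ `*` _); apply/seteqP; split => x /=;
         rewrite !in_itv/= gt_max le_min;
         [move=> [/andP[-> ->] /andP[-> ->]]|move=> /andP[/andP[-> ->] /andP[-> ->]]].
  apply: E0; rewrite -subset0 => -[w r] /= [_].
  rewrite !in_itv/= => -[/andP[h1 h2] /andP[h3 h4]].
  move: ba; rewrite leNgt => /negP; apply.
  by apply: (@lt_le_trans _ _ r); rewrite ?gt_max ?h1 ?h3// le_min h2 h4.
Qed.

Definition uncurry (phi : R -> Omega -> R) : OR -> R^o := fun z => phi z.2 z.1.

(* Coefficients proportional to indicators suffice for density, and for them the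
   isometry only involves integrals over events. *)
Definition is_step (L : @simple_integrand _ Omega R) := forall x, x \in L ->
  exists c A, [/\ 0 <= x.1.1, x.1.1 <= x.1.2, x.1.2 <= T, F x.1.1 A &
                 forall w, x.2 w = c * \1_A w].

Lemma is_step_simple L : is_step L -> is_simple T F L.
Proof.
move=> sL s t h /sL[c [A /= [s0 st tT FA hE]]]; split => //.
  have -> : h = (c : R^o) *: (\1_A : Omega -> R^o) by apply/funext => w; exact: hE.
  apply: (@measurable_funM _ (g_sigma_algebraType (F s))) => //.
  apply: (@measurable_indic _ (g_sigma_algebraType (F s))).
  exact: sub_sigma_algebra.
exists `|c| => w; rewrite hE normrM indicE.
by case: (_ \in _); rewrite ?normr1 ?mulr1// normr0 mulr0.
Qed.

Lemma is_step_cons x L : is_step (x :: L) -> is_step [:: x] /\ is_step L.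
Proof.
move=> sL; split=> y yL; apply: sL; last by rewrite inE yL orbT.
by move: yL; rewrite mem_seq1 => /eqP ->; rewrite mem_head.
Qed.

Lemma is_step_cat L L' : is_step L -> is_step L' -> is_step (L ++ L').
Proof. by move=> sL sL' x; rewrite mem_cat => /orP[/sL|/sL']. Qed.

Definition scale_step (a : R) (L : @simple_integrand _ Omega R) : simple_integrand :=
  [seq (x.1, fun w => a * x.2 w) | x <- L].

Lemma is_step_scale a L : is_step L -> is_step (scale_step a L).
Proof.
move=> sL _ /mapP[x /sL[c [A [s0 st tT FA hE]]] ->].
by exists (a * c), A; split => //= w; rewrite hE mulrA.
Qed.

Definition step_process L : OR -> R^o := uncurry (simple_process L).

Lemma step_process_cat L L' :
  step_process (L ++ L') = step_process L + step_process L'.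
Proof. by apply/funext => z; rewrite /step_process/uncurry/simple_process big_cat. Qed.

Lemma step_process_scale a L : step_process (scale_step a L) = a *: step_process L.
Proof.
apply/funext => z; rewrite /step_process/uncurry/simple_process big_map.
rewrite [RHS](_ : _ = a * \sum_(x <- L) x.2 z.1 * \1_(`]x.1.1, x.1.2]%classic) z.2)//.
by rewrite mulr_sumr; apply: eq_bigr => x _; rewrite mulrA.
Qed.

Lemma step_process_nil : step_process [::] = 0.
Proof. by apply/funext => z; rewrite /step_process/uncurry/simple_process big_nil. Qed.

Lemma step_process1 s t (c : R) A : step_process [:: ((s, t), fun w => c * \1_A w)] =
  c *: (\1_(A `*` `]s, t]%classic) : OR -> R^o).
Proof.
apply/funext => z; rewrite /step_process/uncurry/simple_process big_seq1/=.
by rewrite -mulrA -indic_setX.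
Qed.

Lemma step_process_singleton x : is_step [:: x] -> exists c A,
  [/\ 0 <= x.1.1 <= x.1.2, x.1.2 <= T, F x.1.1 A,
    (forall w, x.2 w = c * \1_A w) &
    step_process [:: x] = c *: (\1_(A `*` `]x.1.1, x.1.2]%classic) : OR -> R^o)].
Proof.
move=> /(_ x); rewrite mem_seq1 eqxx => /(_ erefl)[c [A [s0 st tT FA hE]]].
exists c, A; split => //; first by rewrite s0.
rewrite -step_process1.
by congr step_process; case: x hE {s0 st tT FA} => -[s t] h /= hE; congr [:: (_, _)];
  apply/funext.
Qed.

Lemma g_sigma_rect A (s t : R) : 0 <= s -> t <= T -> F s A ->
  <<s (predictable_rect T F : set (set OR)) >> (A `*` `]s, t]%classic).
Proof.
move=> s0 tT FA; have [st|ts] := ltP s t.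
  by apply: sub_sigma_algebra; right; exists s, t, A.
rewrite set_itv_ge ?bnd_simp -?leNgt// setX0.
exact: (@measurable0 _ (g_sigma_algebraType _)).
Qed.

Section product_measure.
Variables (W : R -> Omega -> R) (mu : {finite_measure set OR -> \bar R}).
Hypothesis W_inc : forall w, increasing_path T (W ^~ w).
Hypothesis mu_int : forall f : OR -> \bar R, (forall z, 0 <= f z)%E ->
  measurable_fun setT f ->
  (\int[mu]_z f z = \int[P]_w \int[path_measure T W w]_t f (w, t))%E.

Let GM := predictable_rect_measurable.
Let sG := L2_semi_inner mu GM.
Let sM := L2_semi_inner mu (@subset_refl _ (@measurable _ OR)).

Lemma mu_rect A (s t : R) : measurable A -> 0 <= s -> s <= t -> t <= T ->
  (mu (A `*` `]s, t]%classic) = \int[P]_(w in A) (W t w - W s w)%:E)%E.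
Proof.
move=> mA s0 st tT; have mB := setX_measurable s t mA.
have := integral_indic mu measurableT mB; rewrite setIT => <-.
rewrite mu_int//; last first.
  by apply/measurable_EFinP; exact: measurable_indic.
rewrite [RHS]integral_mkcond; apply: eq_integral => w _.
rewrite patchE; under eq_integral do rewrite indic_setX EFinM/=.
rewrite indicE; case: ifPn => wA.
  under eq_integral do rewrite mul1e.
  by rewrite integral_indic// setIT; exact: stieltjes_itv.
by under eq_integral do rewrite mul0e; rewrite integral0.
Qed.

Lemma mu_support : mu (~` (setT `*` `]0, T]%classic)) = 0%E.
Proof.
have mB : measurable (setT `*` `]0, T]%classic : set OR) by exact: setX_measurable.
have := integral_indic mu measurableT (measurableC mB); rewrite setIT => <-.
rewrite mu_int//; last first.
  by apply/measurable_EFinP; apply: measurable_indic; exact: measurableC.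
apply: integral0_eq => w _ /=.
rewrite (eq_integral (fun t : measurableTypeR R => (\1_(~` `]0, T]%classic) t)%:E)).
  rewrite integral_indic ?setIT//; last by apply: measurableC; exact: measurable_itv.
  by apply: stieltjes_support => //; exact: ltW.
move=> t _ /=; rewrite !indicE; congr (_%:E); congr ((nat_of_bool _)%:R).
by apply/idP/idP => /set_mem h; apply/mem_set; [move=> h'; exact: h|move=> [_ h']; exact: h].
Qed.

Lemma seminorm_null (f : OR -> R^o) : L2 mu measurable f ->
  (forall z, 0 < z.2 <= T -> f z = 0) -> seminorm (ip mu) f = 0.
Proof.
move=> lf f0; rewrite /seminorm.
have -> : ip mu f f = 0; last exact: sqrtr0.
have /L2mP[mf _] := lf.
have mB : measurable (setT `*` `]0, T]%classic : set OR) by exact: setX_measurable.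
have : (ip mu f f)%:E = 0%E; last by case.
rewrite EFin_ip_sqr// (ge0_negligible_integral (measurableC mB))//.
- rewrite setTD setCK; apply: integral0_eq => -[w t] /= [_].
  by rewrite in_itv/= => h; rewrite f0// expr0n.
- by apply/measurable_EFinP/measurable_funX.
- by move=> z _; rewrite lee_fin sqr_ge0.
- exact: mu_support.
Qed.

Lemma step_process_L2 L : is_step L -> L2 mu (predictable_rect T F) (step_process L).
Proof.
elim: L => [_|x L IH /is_step_cons[sx sL]].
  by rewrite step_process_nil; exact: (si_sub sG).1.
rewrite -cat1s step_process_cat; apply: (subspaceD (si_sub sG)); last exact: IH.
have [c [A [/andP[s0 st] tT FA hE ->]]] := step_process_singleton sx.
by apply: (subspaceZ (si_sub sG)); apply: L2_indic => //; exact: g_sigma_rect.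
Qed.

(* Steps see neither time 0 nor times after T, but [mu] does not charge them. *)
Lemma step_process_dense f : L2 mu (predictable_rect T F) f -> forall e, 0 < e ->
  exists2 L, is_step L & seminorm (ip mu) (f - step_process L) <= e.
Proof.
pose U : set (OR -> R^o) := [set f | L2 mu (predictable_rect T F) f /\ forall e, 0 < e ->
  exists2 L, is_step L & seminorm (ip mu) (f - step_process L) <= e].
suff : L2 mu (predictable_rect T F) `<=` U by move=> + lf => /(_ _ lf)[].
have is_step0 : is_step [::] by [].
have Unull B : <<s (predictable_rect T F : set (set OR)) >> B ->
    B `<=` setT `*` [set 0] -> U (\1_B).
  move=> GB B0; have lB : L2 mu (predictable_rect T F) (\1_B) by exact: L2_indic.
  split => // e e0; exists [::] => //.
  rewrite step_process_nil subr0 seminorm_null ?ltW//; first exact: L2_L2m lB.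
  move=> z /andP[z0 _]; rewrite indicE memNset// => /B0[_ z2].
  by move: z0; rewrite z2 ltxx.
apply: L2_ind_setI => //.
- exact: predictable_rect_setI.
- split.
    split; first exact: (si_sub sG).1.
    move=> e e0; exists [::] => //; rewrite step_process_nil subr0.
    by rewrite seminorm_null ?ltW//; exact: (si_sub sM).1.
  move=> a f1 f2 [l1 h1] [l2 h2]; split; first exact: (si_sub sG).2.
  (* Dividing the tolerance by [|a| + 1] instead of [|a|] covers [a = 0]. *)
  move=> e e0; have a1 : 0 < `|a| + 1 by rewrite ltr_pwDr.
  have [L1 sL1 hL1] := h1 (e / 2 / (`|a| + 1)) (divr_gt0 (divr_gt0 e0 (ltr0n _ 2)) a1).
  have [L2 sL2 hL2] := h2 (e / 2) (divr_gt0 e0 (ltr0n _ 2)).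
  exists (scale_step a L1 ++ L2).
    by apply: is_step_cat => //; exact: is_step_scale.
  rewrite step_process_cat step_process_scale.
  have d1 := subspaceB (si_sub sG) l1 (step_process_L2 sL1).
  have d2 := subspaceB (si_sub sG) l2 (step_process_L2 sL2).
  rewrite (_ : _ - _ = a *: (f1 - step_process L1) + (f2 - step_process L2)); last first.
    by rewrite scalerBr opprD addrACA.
  apply: le_trans (seminormD sG (subspaceZ (si_sub sG) a d1) d2) _.
  rewrite [leRHS](splitr e); apply: lerD => //.
  rewrite (seminormZ sG)//.
  apply: (@le_trans _ _ ((`|a| + 1) * (e / 2 / (`|a| + 1)))).
    by apply: ler_pM; rewrite ?seminorm_ge0// lerDl.
  by rewrite mulrC divfK// gt_eqF.
- move=> g lg hg; split => // e e0.
  have [h [[lh hh] _ gh]] := hg _ (divr_gt0 e0 (ltr0n _ 2)).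
  have [L sL hL] := hh _ (divr_gt0 e0 (ltr0n _ 2)); exists L => //.
  apply: le_trans (seminorm_dist sG lg lh (step_process_L2 sL)) _.
  by rewrite [leRHS](splitr e) lerD.
- have lT : L2 mu (predictable_rect T F) (\1_setT).
    by apply: L2_indic => //; exact: (@measurableT _ (g_sigma_algebraType _)).
  have sL : is_step [:: ((0, T), fun w : Omega => (1 : R) * \1_setT w)].
    move=> x; rewrite mem_seq1 => /eqP -> /=; exists 1, setT.
    split => //; first exact: ltW.
    by apply: filtration_setT; rewrite lexx ltW.
  split => // e e0; exists [:: ((0, T), fun w : Omega => (1 : R) * \1_setT w)] => //.
  rewrite seminorm_null ?ltW//.
    exact: (subspaceB (si_sub sM) (L2_L2m GM lT) (L2_L2m GM (step_process_L2 sL))).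
  move=> -[w t] /= h; rewrite step_process1 scale1r.
  rewrite [LHS](_ : _ = \1_setT (w, t) - \1_(setT `*` `]0, T]%classic) (w, t))//.
  by rewrite !indicE !mem_set ?subrr//=; split => //=; rewrite in_itv.
- move=> B [[A FA ->]|[s [t [A [s0 st tT FA ->]]]]].
    apply: Unull; last by move=> z /= [].
    by apply: sub_sigma_algebra; left; exists A.
  have sL : is_step [:: ((s, t), fun w : Omega => (1 : R) * \1_A w)].
    by move=> x; rewrite mem_seq1 => /eqP -> /=; exists 1, A; split => //; exact: ltW.
  have lL := step_process_L2 sL.
  split; first by move: lL; rewrite step_process1 scale1r.
  move=> e e0; exists [:: ((s, t), fun w : Omega => (1 : R) * \1_A w)] => //.
  rewrite step_process1 scale1r subrr seminorm_null ?ltW//; exact: (si_sub sM).1.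
Qed.

End product_measure.
End filtration.

(** * Stochastic integration *)

Section ip_indic.
Context d {X : measurableType d} {R : realType}.
Variable mu : {finite_measure set X -> \bar R}.

Lemma L2m_integrable (f : X -> R^o) : L2m mu f -> mu.-integrable setT (EFin \o f).
Proof.
move=> lf; have l1 : L2m mu (\1_setT : X -> R^o).
  by apply: L2_indic => //; exact: sub_sigma_algebra.
apply: eq_integrable (L2m_mul lf l1) => // x _ /=.
by rewrite indicE mem_set// mulr1.
Qed.

Lemma integral_indic_mul (f : X -> R) (B : set X) :
  (\int[mu]_x (\1_B x * f x)%:E = \int[mu]_(x in B) (f x)%:E)%E.
Proof.
rewrite [RHS]integral_mkcond; apply: eq_integral => x _.
by rewrite patchE indicE; case: ifPn => _; rewrite ?mul1r// mul0r.
Qed.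

Lemma ip_indic (f : X -> R^o) (B : set X) :
  ip mu (\1_B) f = \int[mu]_(x in B) f x.
Proof. by rewrite /ip /Rintegral integral_indic_mul. Qed.

Lemma L2_indic_mul (G : set (set X)) (f : X -> R^o) B : G `<=` measurable ->
  <<s G >> B -> L2 mu G f -> L2 mu G (fun x => \1_B x * f x).
Proof.
move=> GM GB lf; apply: (L2_bounded GM _ (L2_L2m GM lf)).
  apply: (@measurable_funM _ (g_sigma_algebraType G)); last exact: lf.1.
  exact: (@measurable_indic _ (g_sigma_algebraType G)).
move=> x; rewrite indicE normrM; case: (_ \in _); rewrite ?normr1 ?mul1r//.
by rewrite normr0 mul0r.
Qed.
End ip_indic.

Section ito.
Context d {Omega : measurableType d} {R : realType}.
Variables (P : probability Omega R) (T : R) (F : R -> set (set Omega)).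
Hypothesis T_gt0 : 0 < T.
Hypothesis F_usual : usual_filtration P T F.
Notation OR := (Omega * measurableTypeR R)%type.
Variables (M W : R -> Omega -> R) (mu : {finite_measure set OR -> \bar R}).
Hypothesis M_mart : square_integrable_martingale P T F M.
Hypothesis W_inc : forall w, increasing_path T (W ^~ w).
Hypothesis mu_int : forall f : OR -> \bar R, (forall z, 0 <= f z)%E ->
  measurable_fun setT f ->
  (\int[mu]_z f z = \int[P]_w \int[path_measure T W w]_t f (w, t))%E.
Hypothesis MW_mart : martingale P T F (fun t w => M t w ^+ 2 - W t w).

Notation GF := (predictable_rect T F : set (set OR)).
Let GM := predictable_rect_measurable T_gt0 F_usual.
Let sG := L2_semi_inner mu GM.
Let sM := L2_semi_inner mu (@subset_refl _ (@measurable _ OR)).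
Let sP := L2_semi_inner P (@subset_refl _ (@measurable _ Omega)).
Let FM t (h : 0 <= t <= T) := filtration_sub F_usual h.

Lemma martingale_L2 t : 0 <= t <= T -> L2 P (F t) (M t).
Proof.
move=> tT; have [[adM _ _] sqM] := M_mart; split; first exact: adM.
by have := sqM _ tT; rewrite /square_integrable unlock.
Qed.

Lemma increment_L2 s t : 0 <= s -> s <= t -> t <= T ->
  L2 P (F t) (M t - M s : Omega -> R^o).
Proof.
move=> s0 st tT; have t0 : 0 <= t <= T by rewrite (le_trans s0).
apply: (subspaceB (L2_subspace P (FM t0))); first exact: martingale_L2.
apply: (L2_filtration_mono F_usual s0 st tT); apply: martingale_L2.
by rewrite s0 (le_trans st).
Qed.

(** The martingale property is the case where [Y] is the indicator of an event of [F s];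
    Cauchy-Schwarz makes the property closed in L2, and [L2_ind] extends it. *)
Lemma martingale_orthogonal s t (Y : Omega -> R^o) : 0 <= s -> s <= t -> t <= T ->
  L2 P (F s) Y -> ip P Y (M t - M s) = 0.
Proof.
move=> s0 st tT; have t0 : 0 <= t <= T by rewrite (le_trans s0).
have sT : 0 <= s <= T by rewrite s0 (le_trans st).
have lD := L2_L2m (FM t0) (increment_L2 s0 st tT).
pose U : set (Omega -> R^o) := [set Y | L2 P (F s) Y /\ ip P Y (M t - M s) = 0].
suff : L2 P (F s) `<=` U by move=> + lY => /(_ _ lY)[].
have sF := L2_semi_inner P (FM sT).
apply: (L2_ind (FM sT)).
- split.
    split; first exact: (si_sub sF).1.
    by rewrite (linear_on0 (si_sub sP) (si_lin sP lD)).
  move=> a f g [lf hf] [lg hg]; split; first exact: (si_sub sF).2.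
  rewrite (si_lin sP lD) ?hf ?hg ?mulr0 ?addr0//; exact: (L2_L2m (FM sT)).
- move=> f lf hf; split => //; apply/eqP; rewrite -normr_le0; apply: le_small => e e0.
  have k0 : 0 < seminorm (ip P) (M t - M s) + 1 by rewrite ltr_pwDr// seminorm_ge0.
  have [g [[lg hg] _ hfg]] := hf _ (divr_gt0 e0 k0).
  have lfm := L2_L2m (FM sT) lf; have lgm := L2_L2m (FM sT) lg.
  rewrite -[ip P f _]subr0 -hg -(linear_onB (si_sub sP) (si_lin sP lD) lfm lgm).
  apply: (le_trans (cauchy_schwarz sP (subspaceB (si_sub sP) lfm lgm) lD)).
  apply: (@le_trans _ _ (e / (seminorm (ip P) (M t - M s) + 1) * (seminorm (ip P) (M t - M s) + 1))).
    by apply: ler_pM; rewrite ?seminorm_ge0// lerDl.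
  by rewrite divfK// gt_eqF.
- rewrite (filtration_sigma F_usual sT) => B FB.
  split; first by apply: L2_indic => //; [exact: FM|exact: sub_sigma_algebra].
  have [[_ iM mM] _] := M_mart; have [_ _ /(_ B FB) h] := mM s t s0 st tT.
  have mB := FM sT FB.
  rewrite ip_indic [LHS](_ : _ = \int[P]_(w in B) (M t w - M s w))//.
  rewrite RintegralB//.
  - by rewrite /Rintegral h subrr.
  - by apply: (integrableS measurableT) => //; exact: iM.
  - by apply: (integrableS measurableT) => //; exact: iM.
Qed.

(** The squared increment is [W t - W s], plus the increment of the martingale [M^2 - W], minus
    [2 M_s (M_t - M_s)]; the last two have integral zero over an event of [F s]. *)
Lemma quadratic_increment s t A : 0 <= s -> s <= t -> t <= T -> F s A ->
  \int[P]_(w in A) ((M t w - M s w) ^+ 2) = fine (mu (A `*` `]s, t]%classic)).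
Proof.
move=> s0 st tT FA; have t0 : 0 <= t <= T by rewrite (le_trans s0).
have sT : 0 <= s <= T by rewrite s0 (le_trans st).
have mA := FM sT FA.
have lt : L2m P (M t) := L2_L2m (FM t0) (martingale_L2 t0).
have ls : L2m P (M s) := L2_L2m (FM sT) (martingale_L2 sT).
have [_ iMW mMW] := MW_mart.
have onA (f : Omega -> R) : P.-integrable setT (EFin \o f) -> P.-integrable A (EFin \o f).
  by move=> fi; apply: (integrableS measurableT).
have it : P.-integrable A (EFin \o (fun w => M t w ^+ 2)).
  by apply: onA; have /L2mP[] := lt.
have is_ : P.-integrable A (EFin \o (fun w => M s w ^+ 2)).
  by apply: onA; have /L2mP[] := ls.
have iWt : P.-integrable A (EFin \o (fun w => M t w ^+ 2 - W t w)) by apply/onA/iMW.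
have iWs : P.-integrable A (EFin \o (fun w => M s w ^+ 2 - W s w)) by apply/onA/iMW.
rewrite (mu_rect W_inc mu_int)//.
rewrite -/(Rintegral P A (fun w => W t w - W s w)).
have orth : \int[P]_(w in A) (M s w * (M t w - M s w)) = 0.
  rewrite -ip_indic; rewrite -[RHS](martingale_orthogonal s0 st tT (Y := fun w => \1_A w * M s w)).
    by apply: eq_Rintegral => w _; rewrite mulrA.
  apply: L2_indic_mul => //; [exact: FM|exact: sub_sigma_algebra|exact: martingale_L2].
have eqMW : \int[P]_(w in A) (M s w ^+ 2 - W s w) = \int[P]_(w in A) (M t w ^+ 2 - W t w).
  by have [_ _ /(_ A FA) h] := mMW s t s0 st tT; rewrite /Rintegral h.
have iorth : P.-integrable A (EFin \o (fun w => M s w * (M t w - M s w))).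
  by apply: onA; apply: L2m_mul => //; exact: (subspaceB (si_sub sP)).
(* Integrability of the increment of [W] is recovered from that of [M^2] and [M^2 - W]. *)
have iW : P.-integrable A (EFin \o (fun w => W t w - W s w)).
  have := integrableB mA (integrableB mA it is_) (integrableB mA iWt iWs).
  by apply: eq_integrable => // w _ /=; congr EFin; ring.
rewrite (_ : (fun w => (M t w - M s w) ^+ 2) =
  (fun w => (W t w - W s w) + ((M t w ^+ 2 - W t w) - (M s w ^+ 2 - W s w))
     - 2 * (M s w * (M t w - M s w)))); last by apply/funext => w; ring.
have iD : P.-integrable A (EFin \o (fun w => (M t w ^+ 2 - W t w) - (M s w ^+ 2 - W s w))).
  exact: (integrableB mA iWt iWs).
rewrite RintegralB// ?RintegralZl// ?orth ?mulr0 ?subr0.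
- by rewrite RintegralD// [X in _ + X]RintegralB// eqMW subrr addr0.
- exact: (integrableD mA iW iD).
- exact: (integrableZl mA 2 iorth).
Qed.

Definition elem_integral A s t : Omega -> R^o := fun w => \1_A w * (M t w - M s w).

Lemma elem_integral_L2 s t A : 0 <= s -> s <= t -> t <= T -> F s A ->
  L2 P (F t) (elem_integral A s t).
Proof.
move=> s0 st tT FA; apply: L2_indic_mul; first by apply: FM; rewrite (le_trans s0).
  by apply: sub_sigma_algebra; exact: (filtration_mono F_usual s0 st tT).
exact: increment_L2.
Qed.

Lemma elem_integral_L2m s t A : 0 <= s -> s <= t -> t <= T -> F s A ->
  L2m P (elem_integral A s t).
Proof.
move=> s0 st tT FA; apply: (L2_L2m _ (elem_integral_L2 s0 st tT FA)).
by apply: FM; rewrite (le_trans s0).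
Qed.

Lemma elem_integral_future s t A (Y : Omega -> R^o) : 0 <= s -> s <= t -> t <= T ->
  F s A -> L2 P (F s) Y -> ip P Y (elem_integral A s t) = 0.
Proof.
move=> s0 st tT FA lY; have sT : 0 <= s <= T by rewrite s0 (le_trans st).
rewrite -[RHS](martingale_orthogonal s0 st tT (Y := fun w => \1_A w * Y w)).
  by apply: eq_Rintegral => w _; rewrite /elem_integral mulrCA mulrA.
by apply: L2_indic_mul => //; [exact: FM|exact: sub_sigma_algebra].
Qed.

Lemma elem_integral_split A s u t :
  elem_integral A s t = elem_integral A s u + elem_integral A u t.
Proof.
apply/funext => w; rewrite [RHS](_ : _ = elem_integral A s u w + elem_integral A u t w)//.
by rewrite /elem_integral; ring.
Qed.

Notation rect A s t := (\1_(A `*` `]s, t]%classic) : OR -> R^o).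

Lemma ip_rect A s t A' s' t' : measurable A -> measurable A' ->
  ip mu (rect A s t) (rect A' s' t') =
  fine (mu ((A `&` A') `*` (`]s, t]%classic `&` `]s', t']%classic))).
Proof.
move=> mA mA'; have mB := setX_measurable s t mA; have mB' := setX_measurable s' t' mA'.
rewrite setXI -[in RHS](setIT (_ `&` _)) -integral_indic//; last exact: measurableI.
rewrite /ip /Rintegral; congr fine; apply: eq_integral => z _.
by rewrite !indicE -natrM mulnb -in_setI.
Qed.

Lemma elem_orthogonal A s t A' s' t' : 0 <= s -> s <= t -> t <= s' -> s' <= t' ->
  t' <= T -> F s A -> F s' A' ->
  ip P (elem_integral A s t) (elem_integral A' s' t') = 0.
Proof.
move=> s0 st ts' st' tT FA FA'; have tT' : t <= T by rewrite (le_trans ts')// (le_trans st').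
have s0' : 0 <= s' by rewrite (le_trans _ ts')// (le_trans s0).
apply: elem_integral_future => //.
apply: (L2_filtration_mono F_usual _ ts') => //; first by rewrite (le_trans s0).
  by rewrite (le_trans st').
exact: elem_integral_L2.
Qed.

(** Cutting the interval that starts earlier at the start of the other, then the longer remainder at
    the end of the shorter, leaves a common interval, where [quadratic_increment] applies to the
    event [A] intersected with [A']. All other pairs of pieces lie over successive intervals and are
    orthogonal on both sides. *)
Lemma elem_isometry A s t A' s' t' : 0 <= s -> s <= t -> t <= T -> F s A ->
  0 <= s' -> s' <= t' -> t' <= T -> F s' A' ->
  ip P (elem_integral A s t) (elem_integral A' s' t') =
  ip mu (rect A s t) (rect A' s' t').
Proof.
have symP f g : ip P f g = ip P g f by apply: eq_Rintegral => x _; rewrite mulrC.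
have symM f g : ip mu f g = ip mu g f by apply: eq_Rintegral => x _; rewrite mulrC.
wlog ss' : A s t A' s' t' / s <= s'.
  move=> wl s0 st tT FA s0' st' tT' FA'; have [h|/ltW h] := leP s s'; first exact: wl.
  by rewrite symP symM; exact: wl.
move=> s0 st tT FA s0' st' tT' FA'.
have sT' : 0 <= s' <= T by rewrite s0' (le_trans st').
have mA : measurable A by apply: (FM _ FA); rewrite s0 (le_trans st).
have mA' := FM sT' FA'.
have [ts'|/ltW s't] := leP t s'.
  rewrite elem_orthogonal// ip_rect// (_ : _ `&` `]s', t'] = set0) ?setX0 ?measure0//.
  rewrite -subset0 => x [] /=; rewrite !in_itv/= => /andP[_ h1] /andP[h2 _].
  by move: (lt_le_trans h2 (le_trans h1 ts')); rewrite ltxx.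
have FA1 : F s' A by exact: (filtration_mono F_usual s0 ss' (le_trans s't tT)).
rewrite (elem_integral_split A s s' t).
rewrite (linear_onD (si_lin sP _)); last 3 first.
- exact: elem_integral_L2m.
- by apply: elem_integral_L2m => //; rewrite (le_trans s't).
- exact: elem_integral_L2m.
rewrite elem_orthogonal// add0r.
have -> : ip mu (rect A s t) (rect A' s' t') = ip mu (rect A s' t) (rect A' s' t').
  rewrite !ip_rect//; congr (fine (mu (_ `*` _))); apply/seteqP; split=> x [] /=;
    rewrite !in_itv/= => /andP[h1 h2] /andP[h3 h4]; rewrite h2 h3 h4//.
  by rewrite (le_lt_trans ss' h3).
(* Both intervals now start at [s']; forgetting [s] makes the situation symmetric again for the
   second reduction. *)
clear s st s0 FA ss'.
wlog tt' : A t A' t' tT FA1 mA s't tT' st' FA' mA' / t <= t'.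
  move=> wl; have [h|/ltW h] := leP t t'; first exact: wl.
  by rewrite symP symM; exact: wl.
have t0 : 0 <= t <= T by rewrite (le_trans s0').
rewrite (elem_integral_split A' s' t t').
have FtA' : F t A' by exact: (filtration_mono F_usual s0' s't tT).
rewrite (linear_onD (si_linr sP _)); last 3 first.
- exact: elem_integral_L2m.
- exact: elem_integral_L2m.
- by apply: elem_integral_L2m => //; rewrite (le_trans s0').
rewrite [X in _ + X]elem_orthogonal// addr0 ip_rect//.
have -> : `]s', t]%classic `&` `]s', t']%classic = `]s', t]%classic.
  apply/seteqP; split=> [x []//|x]; rewrite /= !in_itv/= => /andP[h1 h2].
  by rewrite h1 h2 (le_trans h2).
rewrite -quadratic_increment//; last exact: (filtrationI F_usual).
rewrite /Rintegral -integral_indic_mul; congr fine; apply: eq_integral => w _.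
by congr EFin; rewrite /elem_integral !indicE in_setI -mulnb natrM; ring.
Qed.

Lemma simple_integral_cat L L' :
  simple_integral M (L ++ L') = simple_integral M L + simple_integral M L' :> (Omega -> R^o).
Proof. by apply/funext => z; rewrite /simple_integral big_cat. Qed.

Lemma simple_integral_scale a L :
  simple_integral M (scale_step a L) = a *: (simple_integral M L : Omega -> R^o).
Proof.
apply/funext => w; rewrite /simple_integral big_map.
rewrite [RHS](_ : _ = a * \sum_(x <- L) x.2 w * (M x.1.2 w - M x.1.1 w))//.
by rewrite mulr_sumr; apply: eq_bigr => x _; rewrite mulrA.
Qed.

Lemma simple_integral_nil : simple_integral M [::] = 0 :> (Omega -> R^o).
Proof. by apply/funext => z; rewrite /simple_integral big_nil. Qed.

Lemma step_singleton x : is_step T F [:: x] -> exists c A,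
  [/\ 0 <= x.1.1 <= x.1.2, x.1.2 <= T, F x.1.1 A,
    simple_integral M [:: x] = (c : R^o) *: elem_integral A x.1.1 x.1.2 &
    step_process [:: x] = (c : R^o) *: rect A x.1.1 x.1.2].
Proof.
move=> /step_process_singleton[c [A [h1 h2 h3 h4 h5]]]; exists c, A; split => //.
apply/funext => w; rewrite /simple_integral big_seq1 h4.
rewrite [RHS](_ : _ = c * (\1_A w * (M x.1.2 w - M x.1.1 w)))//.
by rewrite mulrA.
Qed.

Lemma simple_integral_L2 L : is_step T F L -> L2 P (F T) (simple_integral M L).
Proof.
have TT : 0 <= T <= T by rewrite ltW//=.
elim: L => [_|x L IH /is_step_cons[sx sL]].
  by rewrite simple_integral_nil; exact: (L2_subspace P (FM TT)).1.
rewrite -cat1s simple_integral_cat; apply: (subspaceD (L2_subspace P (FM TT))); last exact: IH.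
have [c [A [/andP[s0 st] tT FA -> _]]] := step_singleton sx.
apply: (subspaceZ (L2_subspace P (FM TT))).
apply: (L2_filtration_mono F_usual (le_trans s0 st) tT) => //.
exact: elem_integral_L2.
Qed.

Lemma simple_integral_L2m L : is_step T F L -> L2m P (simple_integral M L).
Proof.
by move=> sL; apply: (L2_L2m _ (simple_integral_L2 sL)); apply: FM; rewrite ltW//=.
Qed.

Lemma step_process_L2m L : is_step T F L -> L2m mu (step_process L).
Proof. by move=> sL; exact: (L2_L2m GM (step_process_L2 T_gt0 F_usual mu sL)). Qed.

Lemma simple_isometry L L' : is_step T F L -> is_step T F L' ->
  ip P (simple_integral M L) (simple_integral M L') =
  ip mu (step_process L) (step_process L').
Proof.
elim: L L' => [L' _ sL'|x L IH L' /is_step_cons[sx sL]].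
  rewrite simple_integral_nil step_process_nil.
  rewrite (linear_on0 (si_sub sP) (si_lin sP (simple_integral_L2m sL'))).
  by rewrite (linear_on0 (si_sub sM) (si_lin sM (step_process_L2m sL'))).
move=> sL'; rewrite -cat1s simple_integral_cat step_process_cat.
rewrite (linear_onD (si_lin sP (simple_integral_L2m sL'))
  (simple_integral_L2m sx) (simple_integral_L2m sL)).
rewrite (linear_onD (si_lin sM (step_process_L2m sL'))
  (step_process_L2m sx) (step_process_L2m sL)) (IH _ sL sL'); congr (_ + _).
have [c [A [/andP[s0 st] tT FA hI hp]]] := step_singleton sx.
have lI := elem_integral_L2m s0 st tT FA.
have lr : L2m mu (rect A x.1.1 x.1.2).
  apply: (L2_L2m GM); apply: L2_indic => //.
  exact: g_sigma_rect.
rewrite hI hp (linear_onZ (si_sub sP) (si_lin sP (simple_integral_L2m sL')) _ lI).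
rewrite (linear_onZ (si_sub sM) (si_lin sM (step_process_L2m sL')) _ lr).
congr (_ * _); elim: L' sL' {IH sx sL hI hp} => [_|y L' IH /is_step_cons[sy sL']].
  rewrite simple_integral_nil step_process_nil.
  by rewrite (linear_on0 (si_sub sP) (si_linr sP lI)) (linear_on0 (si_sub sM) (si_linr sM lr)).
rewrite -cat1s simple_integral_cat step_process_cat.
rewrite (linear_onD (si_linr sP lI)
  (simple_integral_L2m sy) (simple_integral_L2m sL')).
rewrite (linear_onD (si_linr sM lr)
  (step_process_L2m sy) (step_process_L2m sL')) (IH sL'); congr (_ + _).
have [c' [A' [/andP[s0' st'] tT' FA' hI hp]]] := step_singleton sy.
have lI' := elem_integral_L2m s0' st' tT' FA'.
have lr' : L2m mu (rect A' y.1.1 y.1.2).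
  apply: (L2_L2m GM); apply: L2_indic => //.
  exact: g_sigma_rect.
rewrite hI hp (linear_onZ (si_sub sP) (si_linr sP lI) _ lI').
rewrite (linear_onZ (si_sub sM) (si_linr sM lr) _ lr').
by congr (_ * _); exact: elem_isometry.
Qed.

End ito.

(** An explicit modulus of continuity, by which the isometry passes from steps to their limits with
    a single tolerance for both forms. *)
Lemma si_continuous {R : realType} {X : lmodType R} (b : X -> X -> R) (D : set X)
    (hD : semi_inner b D) x y x' y' e : D x -> D y -> D x' -> D y' -> 0 <= e ->
  seminorm b (x - x') <= e -> seminorm b (y - y') <= e ->
  `|b x y - b x' y'| <= e * (seminorm b x + seminorm b y + e).
Proof.
move=> dx dy dx' dy' e0 hx hy.
have dxx := subspaceB (si_sub hD) dx dx'; have dyy := subspaceB (si_sub hD) dy dy'.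
rewrite (_ : b x y - b x' y' = b (x - x') y' + b x (y - y')); last first.
  rewrite (linear_onB (si_sub hD) (si_lin hD dy'))//.
  by rewrite (linear_onB (si_sub hD) (si_linr hD dx))//; ring.
have hy' : seminorm b y' <= seminorm b y + e.
  rewrite -[y' in leLHS](subrK y) addrC.
  apply: le_trans (seminormD hD dy (subspaceB (si_sub hD) dy' dy)) _.
  by rewrite lerD2l (seminorm_distC hD).
apply: (le_trans (ler_normD _ _)).
apply: (le_trans (lerD (cauchy_schwarz hD dxx dy') (cauchy_schwarz hD dx dyy))).
have := seminorm_ge0 b x; have := seminorm_ge0 b y'.
have := seminorm_ge0 b (x - x'); have := seminorm_ge0 b (y - y').
move: hx hy hy'; set p := seminorm b (x - x'); set q := seminorm b (y - y').
set r := seminorm b y'; set s := seminorm b x; set t := seminorm b y => *.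
have : p * r <= e * (t + e) by apply: ler_pM.
have : s * q <= s * e by apply: ler_wpM2l.
by lra.
Qed.

(** * The Ito integral as an L2 limit, and its isometry *)

Section ito_integral.
Context d {Omega : measurableType d} {R : realType}.
Variables (P : probability Omega R) (T : R) (F : R -> set (set Omega)).
Hypothesis T_gt0 : 0 < T.
Hypothesis F_usual : usual_filtration P T F.
Notation OR := (Omega * measurableTypeR R)%type.
Variables (M W : R -> Omega -> R) (mu : {finite_measure set OR -> \bar R}).
Hypothesis M_mart : square_integrable_martingale P T F M.
Hypothesis W_inc : forall w, increasing_path T (W ^~ w).
Hypothesis mu_int : forall f : OR -> \bar R, (forall z, 0 <= f z)%E ->
  measurable_fun setT f ->
  (\int[mu]_z f z = \int[P]_w \int[path_measure T W w]_t f (w, t))%E.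
Hypothesis MW_mart : martingale P T F (fun t w => M t w ^+ 2 - W t w).

Notation GF := (predictable_rect T F : set (set OR)).
Let GM := predictable_rect_measurable T_gt0 F_usual.
Let sG := L2_semi_inner mu GM.
Let sM := L2_semi_inner mu (@subset_refl _ (@measurable _ OR)).
Let sP := L2_semi_inner P (@subset_refl _ (@measurable _ Omega)).
Let FM t (h : 0 <= t <= T) := filtration_sub F_usual h.
Let TT : 0 <= T <= T. Proof. by rewrite ltW/=. Qed.

Notation sI L := (simple_integral M L : Omega -> R^o).
Let sI_L2m L : is_step T F L -> L2m P (sI L).
Proof. exact: (simple_integral_L2m T_gt0 F_usual M_mart). Qed.
Let sp_L2 L : is_step T F L -> L2 mu GF (step_process L).
Proof. exact: (step_process_L2 T_gt0 F_usual mu). Qed.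
Let sI_sub L L' : sI (L ++ scale_step (-1) L') = sI L - sI L'.
Proof. by rewrite simple_integral_cat simple_integral_scale scaleN1r. Qed.
Let sp_sub (L L' : simple_integrand) :
  step_process (L ++ scale_step (-1) L') = step_process L - step_process L' :> (OR -> R^o).
Proof. by rewrite step_process_cat step_process_scale scaleN1r. Qed.

Lemma simple_isometry_dist L L' : is_step T F L -> is_step T F L' ->
  seminorm (ip P) (sI L - sI L') = seminorm (ip mu) (step_process L - step_process L').
Proof.
move=> sL sL'; rewrite -sI_sub -sp_sub /seminorm.
have s := is_step_cat sL (is_step_scale (a := -1) sL').
by rewrite (simple_isometry T_gt0 F_usual M_mart W_inc mu_int MW_mart s s).
Qed.

(* [I] is the Ito integral of [phi]: this determines [I] up to null sets, steps being dense. *)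
Definition ito_spec (phi : OR -> R^o) (I : Omega -> R^o) := L2 P (F T) I /\
  forall L, is_step T F L ->
    seminorm (ip P) (I - sI L) = seminorm (ip mu) (phi - step_process L).

Lemma ito_exists phi : L2 mu GF phi -> exists I, ito_spec phi I.
Proof.
move=> lphi.
have /choice[L hL] n : exists L, is_step T F L /\
    seminorm (ip mu) (phi - step_process L) <= 2^-1 ^+ n.
  have [L sL h] := step_process_dense T_gt0 F_usual W_inc mu_int lphi (@geo2_gt0 R n).
  by exists L.
have sL n : is_step T F (L n) := (hL n).1.
(* The triangle inequality through [phi] bounds the increments by [2^-n + 2^-(n+1)], which is below
   [2 * 2^-n]. *)
have [||I lI hI] := L2_complete (mu := P) (FM TT) (u := fun n => sI (L n)) (ler0n R 2).
- by move=> n; exact: (simple_integral_L2 T_gt0 F_usual M_mart).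
- move=> n; rewrite simple_isometry_dist//.
  apply: (le_trans (seminorm_dist sG (sp_L2 (sL n.+1)) lphi (sp_L2 (sL n)))).
  rewrite (seminorm_distC sG)//; last exact: sp_L2.
  apply: (le_trans (lerD (hL n.+1).2 (hL n).2)); rewrite exprS.
  by have := @geo2_gt0 R n; lra.
exists I; split => // L' sL'; apply/eqP; rewrite -subr_eq0 -normr_le0.
have lIm := L2_L2m (FM TT) lI.
(* The limit is within [4 * 2^-n] of the integral of [L n], and [phi] within [2^-n] of its step
   process: together 5. *)
apply: (@geo2_le0 _ 5) => n.
have hd := simple_isometry_dist (sL n) sL'.
have h1 := seminorm_dist sP lIm (sI_L2m (sL n)) (sI_L2m sL').
have h2 := seminorm_dist sP (sI_L2m (sL n)) lIm (sI_L2m sL').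
have h3 := seminorm_dist sG lphi (sp_L2 (sL n)) (sp_L2 sL').
have h4 := seminorm_dist sG (sp_L2 (sL n)) lphi (sp_L2 sL').
move: h1 h2 h3 h4; rewrite hd.
rewrite [seminorm (ip P) (I - sI (L n))](seminorm_distC sP)//; last exact: sI_L2m.
rewrite [seminorm (ip mu) (step_process (L n) - phi)](seminorm_distC sG)//; last exact: sp_L2.
have := hI n; have := (hL n).2.
set e := 2^-1 ^+ n => *.
by rewrite ler_norml; apply/andP; split; lra.
Qed.

Definition ito (phi : OR -> R^o) : Omega -> R^o :=
  match pselect (exists I, ito_spec phi I) with
  | left h => sval (cid h)
  | right _ => 0
  end.

Lemma itoP phi : L2 mu GF phi -> ito_spec phi (ito phi).
Proof.
move=> /ito_exists h; rewrite /ito; case: pselect => // h'.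
by case: cid.
Qed.

Lemma ito_L2 phi : L2 mu GF phi -> L2 P (F T) (ito phi).
Proof. by move=> /itoP[]. Qed.

Lemma ito_L2m phi : L2 mu GF phi -> L2m P (ito phi).
Proof. by move=> /ito_L2; apply: L2_L2m; exact: FM. Qed.

Lemma ito_spec_isometry phi psi I J : L2 mu GF phi -> L2 mu GF psi ->
  ito_spec phi I -> ito_spec psi J -> ip P I J = ip mu phi psi.
Proof.
move=> lphi lpsi [lI hI] [lJ hJ].
have lIm := L2_L2m (FM TT) lI; have lJm := L2_L2m (FM TT) lJ.
apply/eqP; rewrite -subr_eq0 -normr_le0.
apply: (@geo2_le0 _ (seminorm (ip P) I + seminorm (ip P) J + 1 +
  (seminorm (ip mu) phi + seminorm (ip mu) psi + 1))) => n.
have e0 := @geo2_gt0 R n.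
have e1 : 2^-1 ^+ n <= 1 :> R by apply: exprn_ile1; rewrite ?invr_ge0// invf_le1// ler1n.
have [L sL h] := step_process_dense T_gt0 F_usual W_inc mu_int lphi e0.
have [L' sL' h'] := step_process_dense T_gt0 F_usual W_inc mu_int lpsi e0.
have hP := si_continuous sP lIm lJm (sI_L2m sL) (sI_L2m sL') (ltW e0).
have hM := si_continuous sG lphi lpsi (sp_L2 sL) (sp_L2 sL') (ltW e0) h h'.
move: hP; rewrite hI// hJ// => /(_ h h').
rewrite (simple_isometry T_gt0 F_usual M_mart W_inc mu_int MW_mart sL sL').
move: hM; have := seminorm_ge0 (ip P) I; have := seminorm_ge0 (ip P) J.
have := seminorm_ge0 (ip mu) phi; have := seminorm_ge0 (ip mu) psi.
move: e0 e1; set e := 2^-1 ^+ n; set x := ip mu (step_process L) _.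
set p := seminorm (ip P) I; set q := seminorm (ip P) J.
set r := seminorm (ip mu) phi; set s := seminorm (ip mu) psi => e0 e1 s0 r0 q0 p0 hM hP.
rewrite (_ : _ - _ = (ip P I J - x) - (ip mu phi psi - x)); last by ring.
apply: (le_trans (ler_normB _ _)); apply: (le_trans (lerD hP hM)).
by rewrite mulrDl [_ * e]mulrC [(_ + 1) * e]mulrC; apply: lerD;
   rewrite ler_pM2l// lerD2l.
Qed.

Lemma ito_isometry phi psi : L2 mu GF phi -> L2 mu GF psi ->
  ip P (ito phi) (ito psi) = ip mu phi psi.
Proof. by move=> lphi lpsi; apply: ito_spec_isometry => //; exact: itoP. Qed.

Lemma seminorm0_ip (x y : Omega -> R^o) : L2m P x -> L2m P y ->
  seminorm (ip P) y = 0 -> ip P x y = 0.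
Proof.
move=> lx ly y0; apply/eqP; rewrite -normr_le0.
by apply: le_trans (cauchy_schwarz sP lx ly) _; rewrite y0 mulr0.
Qed.

(** As [ito] picks an arbitrary version, it is linear only up to null sets, and pairing with [Y]
    hides these. By the isometry the linearity defect [D] is orthogonal to every integral; being a
    combination of integrals, it is orthogonal to itself. *)
Lemma ito_linear Y : L2m P Y -> linear_on (L2 mu GF) (fun phi => ip P Y (ito phi)).
Proof.
move=> lY a f g lf lg; have lfg := (si_sub sG).2 a f g lf lg.
have lF := ito_L2m lf; have lG := ito_L2m lg; have lFG := ito_L2m lfg.
have laF := (si_sub sP).2 a _ _ lF lG.
pose D := ito (a *: f + g) - (a *: ito f + ito g).
have lD : L2m P D by exact: (subspaceB (si_sub sP)).
suff D0 : seminorm (ip P) D = 0.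
  have := seminorm0_ip lY lD D0.
  rewrite (linear_onB (si_sub sP) (si_linr sP lY))// => /eqP.
  by rewrite subr_eq0 (si_linr sP lY) ?lF// => /eqP.
have orth h : L2 mu GF h -> ip P D (ito h) = 0.
  move=> lh; have lH := ito_L2m lh.
  rewrite (linear_onB (si_sub sP) (si_lin sP lH))// (si_lin sP lH)//.
  by rewrite !ito_isometry// (si_lin sG lh)// subrr.
rewrite /seminorm {2}/D.
rewrite (linear_onB (si_sub sP) (si_linr sP lD))// (si_linr sP lD)//.
by rewrite !orth// mulr0 addr0 subrr sqrtr0.
Qed.

(** Left ends only move to the right, so the coefficients remain measurable at their starting times;
    an interval ending before [s] collapses to the empty []s, s]]. *)
Definition after s (L : @simple_integrand _ Omega R) : simple_integrand :=
  [seq ((Num.max x.1.1 s, Num.max x.1.2 s), x.2) | x <- L].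

(** The outer [Num.max] keeps the ends ordered: an interval starting after [s] becomes empty instead
    of reversed. *)
Definition before s (L : @simple_integrand _ Omega R) : simple_integrand :=
  [seq ((x.1.1, Num.max x.1.1 (Num.min x.1.2 s)), x.2) | x <- L].

Lemma is_step_after s L : s <= T -> is_step T F L -> is_step T F (after s L).
Proof.
move=> sT sL _ /mapP[x /sL[c [A [s0 st tT FA hE]]] ->].
exists c, A; split => //=.
- by rewrite le_max s0.
- by rewrite ge_max !le_max st lexx orbT.
- by rewrite ge_max tT.
- apply: (filtration_mono F_usual s0 _ _ FA); first by rewrite le_max lexx.
  by rewrite ge_max sT (le_trans st).
Qed.

Lemma is_step_before s L : is_step T F L -> is_step T F (before s L).
Proof.
move=> sL _ /mapP[x /sL[c [A [s0 st tT FA hE]]] ->].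
exists c, A; split => //=; first by rewrite le_max lexx.
by rewrite ge_max (le_trans st tT) ge_min tT.
Qed.

Lemma step_process_after s L z : step_process (after s L) z =
  step_process L z * \1_(`]s, +oo[%classic) z.2.
Proof.
rewrite /step_process/uncurry/simple_process big_map mulr_suml.
apply: eq_bigr => x _ /=; rewrite -mulrA; congr (_ * _).
rewrite !indicE -natrM mulnb !mem_setE !in_itv/= gt_max le_max.
by case: (ltP s z.2); rewrite ?andbT ?andbF ?orbF.
Qed.

Lemma step_process_before s L z : step_process (before s L) z =
  step_process L z * \1_(`]-oo, s]%classic) z.2.
Proof.
rewrite /step_process/uncurry/simple_process big_map mulr_suml.
apply: eq_bigr => x _ /=; rewrite -mulrA; congr (_ * _).
rewrite !indicE -natrM mulnb !mem_setE !in_itv/= le_max le_min.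
by case: (ltP x.1.1 z.2).
Qed.

(** Steps starting after [s] have integrals orthogonal to [F s] by the martingale property, and
    [phi] is approximated by such steps. *)
Lemma ito_future s Y phi : 0 <= s -> s <= T -> L2 P (F s) Y -> L2 mu GF phi ->
  (forall z, z.2 <= s -> phi z = 0) -> ip P Y (ito phi) = 0.
Proof.
move=> s0 sT lY lphi phi0.
have ss : 0 <= s <= T by rewrite s0.
have lYm := L2_L2m (FM ss) lY; have lI := ito_L2m lphi.
have orth L : is_step T F L -> ip P Y (sI (after s L)) = 0.
  elim: L => [_|x L IH /is_step_cons[sx sL]].
    by rewrite simple_integral_nil (linear_on0 (si_sub sP) (si_linr sP lYm)).
  have -> : after s (x :: L) = after s [:: x] ++ after s L by [].
  have sx' := is_step_after sT sx; have sL' := is_step_after sT sL.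
  rewrite simple_integral_cat (linear_onD (si_linr sP lYm)) ?IH ?addr0//; try exact: sI_L2m.
  have [c [A [/andP[h0 hst] htT FA -> _]]] := step_singleton M sx'.
  have lE := elem_integral_L2m F_usual M_mart h0 hst htT FA.
  rewrite (linear_onZ (si_sub sP) (si_linr sP lYm))//.
  rewrite (elem_integral_future F_usual M_mart)// ?mulr0//.
  apply: (L2_filtration_mono F_usual s0) lY; first by rewrite /= le_max lexx orbT.
  exact: le_trans htT.
apply/eqP; rewrite -normr_le0; apply: le_small => e e0.
have k0 : 0 < seminorm (ip P) Y + 1 by rewrite ltr_pwDr// seminorm_ge0.
have [L sL hL] := step_process_dense T_gt0 F_usual W_inc mu_int lphi (divr_gt0 e0 k0).
have sL' := is_step_after sT sL.
rewrite -[ip _ _ _]subr0 -(orth _ sL).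
rewrite -(linear_onB (si_sub sP) (si_linr sP lYm) lI (sI_L2m sL')).
apply: (le_trans (cauchy_schwarz sP lYm (subspaceB (si_sub sP) lI (sI_L2m sL')))).
rewrite (itoP lphi).2//.
(* Killing a step process up to time [s] cannot take it farther from [phi], which vanishes there. *)
have hle : seminorm (ip mu) (phi - step_process (after s L)) <= e / (seminorm (ip P) Y + 1).
  apply: le_trans hL; apply: ler_wsqrtr; apply: le_Rintegral => //.
  - by apply: L2m_mul; apply: (L2_L2m GM); apply: (subspaceB (si_sub sG)) => //; exact: sp_L2.
  - by apply: L2m_mul; apply: (L2_L2m GM); apply: (subspaceB (si_sub sG)) => //; exact: sp_L2.
  - move=> z _.
    rewrite [(phi - step_process (after s L)) z](_ : _ = phi z - step_process (after s L) z)//.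
    rewrite [(phi - step_process L) z](_ : _ = phi z - step_process L z)//.
    rewrite step_process_after -!expr2 indicE mem_setE in_itv/= andbT.
    case: (ltP s z.2) => h; first by rewrite mulr1.
    by rewrite mulr0 phi0// subrr expr0n/= sqr_ge0.
apply: (@le_trans _ _ ((seminorm (ip P) Y + 1) * (e / (seminorm (ip P) Y + 1)))).
  by apply: ler_pM; rewrite ?seminorm_ge0// lerDl.
by rewrite mulrC divfK// gt_eqF.
Qed.

End ito_integral.

(** * Integration against the quadratic variation *)

Lemma integrable_indic_lty d (X : measurableType d) (R : realType)
    (mu : {measure set X -> \bar R}) (A : set X) :
  measurable A -> (mu setT < +oo)%E -> mu.-integrable setT (EFin \o \1_A).
Proof.
move=> mA fin; apply/integrableP; split.
  by apply/measurable_EFinP; exact: measurable_indic.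
under eq_integral do rewrite gee0_abs ?lee_fin//.
rewrite integral_indic// setIT; apply: le_lt_trans fin.
by apply: le_measure; rewrite ?inE.
Qed.

Definition supported {S : Type} {R : realType} (f : S * R -> R) (s t : R) :=
  forall z, ~~ (s < z.2 <= t) -> f z = 0.

Lemma supported_subspace d (Omega : measurableType d) (R : realType)
    (mu : {measure set (Omega * measurableTypeR R)%type -> \bar R}) G (s t : R) :
  G `<=` measurable -> linear_subspace [set f | L2 mu G f /\ supported f s t].
Proof.
move=> GM; have [L0 Llin] := L2_subspace mu GM; split; first by split.
move=> a f g [lf sf] [lg sg]; split; first exact: Llin.
move=> z hz; rewrite [(_ + _) z](_ : _ = a * f z + g z)// sf// sg//.
by rewrite mulr0 addr0.
Qed.

Section path_integral.
Context d {Omega : measurableType d} {R : realType}.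
Variables (P : probability Omega R) (T : R).
Hypothesis T_gt0 : 0 < T.
Notation OR := (Omega * measurableTypeR R)%type.
Variables (W : R -> Omega -> R) (mu : {finite_measure set OR -> \bar R}).
Hypothesis W_inc : forall w, increasing_path T (W ^~ w).
Hypothesis mu_int : forall f : OR -> \bar R, (forall z, 0 <= f z)%E ->
  measurable_fun setT f ->
  (\int[mu]_z f z = \int[P]_w \int[path_measure T W w]_t f (w, t))%E.
Hypothesis mu_meas : forall f : OR -> \bar R, (forall z, 0 <= f z)%E ->
  measurable_fun setT f ->
  measurable_fun setT (fun w => \int[path_measure T W w]_t f (w, t))%E.

Let sM := L2_semi_inner mu (@subset_refl _ (@measurable _ OR)).
Let sP := L2_semi_inner P (@subset_refl _ (@measurable _ Omega)).
Notation kappa w := (path_measure T W w).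
Let sK w := L2_semi_inner (kappa w) (@subset_refl _ (@measurable _ (measurableTypeR R))).

Definition path_integral (f : OR -> R) : Omega -> R^o :=
  fun w => \int[kappa w]_t f (w, t).

Lemma section_L2 (f : OR -> R^o) : L2m mu f ->
  {ae P, forall w, L2m (kappa w) (fun t => f (w, t))}.
Proof.
move=> /L2mP[mf lf].
have mf2 : measurable_fun setT (fun z => (f z ^+ 2)%:E).
  by apply/measurable_EFinP/measurable_funX.
have f20 z : (0 <= (f z ^+ 2)%:E)%E by rewrite lee_fin sqr_ge0.
have := integrable_lty measurableT lf; rewrite mu_int// => h.
have /(integrable_ae measurableT) : P.-integrable setT
    (fun w => \int[kappa w]_t (f (w, t) ^+ 2)%:E)%E.
  apply/integrableP; split; first exact: (mu_meas f20 mf2).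
  by under eq_integral do rewrite gee0_abs ?integral_ge0//.
apply: filterS => w /(_ I) fin.
have ms : measurable_fun setT (fun t : measurableTypeR R => f (w, t)).
  by apply: measurableT_comp => //; exact: pair1_measurable.
by split; [move=> _ Y mY; apply: sub_sigma_algebra; exact: ms|rewrite ltey_eq fin].
Qed.

Lemma path_integral_measurable (f : OR -> R) : measurable_fun setT f ->
  measurable_fun setT (path_integral f).
Proof.
move=> mf; have mfe : measurable_fun setT (EFin \o f) by exact/measurable_EFinP.
rewrite (_ : path_integral f = (fine \o (fun w =>
    \int[kappa w]_t (EFin \o f)^\+ (w, t) - \int[kappa w]_t (EFin \o f)^\- (w, t))%E)).
  apply: measurableT_comp => //; apply: emeasurable_funB.
    by apply: (@mu_meas ((EFin \o f)^\+)%E) => //; exact: measurable_funepos.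
  by apply: (@mu_meas ((EFin \o f)^\-)%E) => //; exact: measurable_funeneg.
by apply/funext => w; rewrite /path_integral /Rintegral [in LHS]integralE !funepos.unlock !funeneg.unlock.
Qed.

Lemma path_integral_sqr (f : OR -> R^o) s t (B : R) w : L2m (kappa w) (fun t => f (w, t)) ->
  0 <= s -> s <= t -> t <= T -> W t w - W s w <= B -> supported f s t ->
  ((path_integral f w ^+ 2)%:E <= B%:E * \int[kappa w]_t (f (w, t) ^+ 2)%:E)%E.
Proof.
move=> lf s0 st tT hB sf.
have kst : kappa w (`]s, t]%classic) = (W t w - W s w)%:E by exact: stieltjes_itv.
have fin : (kappa w setT < +oo)%E by rewrite /path_measure stieltjes_setT ?ltry// ltW.
have mI : measurable (`]s, t]%classic : set (measurableTypeR R)) by exact: measurable_itv.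
have l1 : L2m (kappa w) (\1_(`]s, t]%classic) : measurableTypeR R -> R^o).
  apply/L2mP; split; first exact: measurable_indic.
  have i1 : (kappa w).-integrable setT (EFin \o \1_(`]s, t]%classic)).
    exact: integrable_indic_lty.
  apply: eq_integrable i1 => // x _ /=.
  by rewrite indicE; case: (_ \in _); rewrite ?expr1n ?expr0n.
rewrite -EFin_ip_sqr// -EFinM lee_fin.
(* Pairing with the indicator of the support, not with the constant 1, makes the bound depend on the
   increment of [W] over []s, t]] alone. *)
rewrite (_ : path_integral f w = ip (kappa w) (fun t => f (w, t)) (\1_(`]s, t]%classic))); last first.
  apply: eq_Rintegral => x _; rewrite indicE mem_setE in_itv/=.
  by have [|h] := boolP (s < x <= t); rewrite ?mulr1// mulr0 sf.
apply: (le_trans (cauchy_schwarz_sqr (sK w) lf l1)).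
rewrite mulrC ler_wpM2r ?(si_ge0 (sK w))//.
apply: le_trans hB; rewrite -lee_fin EFin_ip//.
rewrite [leLHS](_ : _ = \int[kappa w]_x (\1_(`]s, t]%classic) x)%:E)%E; last first.
  apply: eq_integral => x _ /=.
  by rewrite indicE; case: (_ \in _); rewrite ?mulr1 ?mulr0.
by rewrite integral_indic// setIT kst.
Qed.

Lemma path_integral_bound (f : OR -> R^o) s t (B : R) : L2m mu f -> 0 <= B ->
  0 <= s -> s <= t -> t <= T -> (forall w, W t w - W s w <= B) -> supported f s t ->
  L2m P (path_integral f) /\
  seminorm (ip P) (path_integral f) <= Num.sqrt B * seminorm (ip mu) f.
Proof.
move=> lf B0 s0 st tT hB sf; have /L2mP[mf if_] := lf.
have mC := path_integral_measurable mf.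
have mf2 : measurable_fun setT (fun z => (f z ^+ 2)%:E).
  by apply/measurable_EFinP/measurable_funX.
have f20 z : (0 <= (f z ^+ 2)%:E)%E by rewrite lee_fin sqr_ge0.
have key : (\int[P]_w (path_integral f w ^+ 2)%:E <= (B * ip mu f f)%:E)%E.
  rewrite EFinM EFin_ip_sqr// mu_int// -ge0_integralZl//; last 2 first.
  - exact: (mu_meas f20 mf2).
  - by move=> w _; exact: integral_ge0.
  apply: ae_ge0_le_integral => //.
  - by move=> w _; rewrite lee_fin sqr_ge0.
  - by apply/measurable_EFinP/measurable_funX.
  - by move=> w _; apply: mule_ge0; rewrite ?lee_fin ?integral_ge0.
  - by apply: measurable_funeM; exact: (mu_meas f20 mf2).
  - by apply: filterS (section_L2 lf) => w lw _; exact: (path_integral_sqr lw s0 st tT (hB w) sf).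
have lC : L2m P (path_integral f).
  split; last exact: le_lt_trans key (ltry _).
  by move=> _ Y mY; apply: sub_sigma_algebra; exact: mC.
split => //; rewrite /seminorm -sqrtrM//; apply: ler_wsqrtr.
by rewrite -lee_fin EFin_ip_sqr.
Qed.

(** Linearity holds on the paths along which both sections are square-integrable, which by
    [section_L2] are almost all. *)
Lemma path_integral_ae_linear (a : R) (f g : OR -> R^o) : L2m mu f -> L2m mu g ->
  {ae P, forall w, path_integral (a *: f + g) w = a * path_integral f w + path_integral g w}.
Proof.
move=> lf lg.
have fin w : (kappa w setT < +oo)%E by rewrite /path_measure stieltjes_setT ?ltry// ltW.
apply: filterS2 (section_L2 lf) (section_L2 lg) => w hf hg.
have l1 : L2m (kappa w) (\1_setT : measurableTypeR R -> R^o).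
  apply/L2mP; split; first exact: measurable_indic.
  have i1 : (kappa w).-integrable setT (EFin \o \1_setT) by exact: integrable_indic_lty.
  apply: eq_integrable i1 => // x _ /=.
  by rewrite indicE; case: (_ \in _); rewrite ?expr1n ?expr0n.
have toip (h : OR -> R) : path_integral h w = ip (kappa w) (fun t => h (w, t)) (\1_setT).
  by apply: eq_Rintegral => x _; rewrite indicE mem_set// mulr1.
rewrite !toip -(si_lin (sK w) l1 a hf hg); exact: eq_Rintegral.
Qed.

Lemma ip_ae (f g Y : Omega -> R^o) : measurable_fun setT f -> measurable_fun setT g ->
  measurable_fun setT Y -> {ae P, forall w, f w = g w} -> ip P f Y = ip P g Y.
Proof.
move=> mf mg mY fg; rewrite /ip /Rintegral; congr fine.
apply: ae_eq_integral => //.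
- by apply/measurable_EFinP; exact: measurable_funM.
- by apply/measurable_EFinP; exact: measurable_funM.
- by apply: filterS fg => w -> _.
Qed.

Lemma path_integral_linear (D : set (OR -> R^o)) (Y : Omega -> R^o) :
  linear_subspace D -> D `<=` L2m mu ->
  (forall f, D f -> L2m P (path_integral f)) -> L2m P Y ->
  linear_on D (fun f => ip P (path_integral f) Y).
Proof.
move=> sD DL CL lY a f g df dg.
have lC := CL _ df; have lC' := CL _ dg.
rewrite -(si_lin sP lY a lC lC').
have /L2mP[m1 _] := CL _ (sD.2 a _ _ df dg).
have /L2mP[m2 _] := (si_sub sP).2 a _ _ lC lC'.
have /L2mP[m3 _] := lY.
apply: ip_ae => //; exact: (path_integral_ae_linear a (DL _ df) (DL _ dg)).
Qed.

End path_integral.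

(** * Past drift against future stochastic integrals *)

Section past_future.
Context d {Omega : measurableType d} {R : realType}.
Variables (P : probability Omega R) (T : R) (F : R -> set (set Omega)).
Hypothesis T_gt0 : 0 < T.
Hypothesis F_usual : usual_filtration P T F.
Notation OR := (Omega * measurableTypeR R)%type.
Variables (M W : R -> Omega -> R) (mu : {finite_measure set OR -> \bar R}).
Hypothesis M_mart : square_integrable_martingale P T F M.
Hypothesis W_inc : forall w, increasing_path T (W ^~ w).
Hypothesis W_adapted : adapted T F W.
Variable B : R.
Hypothesis W_bounded : forall w s t, 0 <= s -> s <= t -> t <= T -> W t w - W s w <= B.
Hypothesis mu_int : forall f : OR -> \bar R, (forall z, 0 <= f z)%E ->
  measurable_fun setT f ->
  (\int[mu]_z f z = \int[P]_w \int[path_measure T W w]_t f (w, t))%E.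
Hypothesis mu_meas : forall f : OR -> \bar R, (forall z, 0 <= f z)%E ->
  measurable_fun setT f ->
  measurable_fun setT (fun w => \int[path_measure T W w]_t f (w, t))%E.
Hypothesis MW_mart : martingale P T F (fun t w => M t w ^+ 2 - W t w).

Notation GF := (predictable_rect T F : set (set OR)).
Let GM := predictable_rect_measurable T_gt0 F_usual.
Let sG := L2_semi_inner mu GM.
Let sM := L2_semi_inner mu (@subset_refl _ (@measurable _ OR)).
Let sP := L2_semi_inner P (@subset_refl _ (@measurable _ Omega)).
Let FM t (h : 0 <= t <= T) := filtration_sub F_usual h.
Notation kappa w := (path_measure T W w).

Let B_ge0 : 0 <= B.
Proof.
have := @W_bounded point 0 0; rewrite subrr; apply => //; exact: ltW.
Qed.

Lemma path_integral_step L w : is_step T F L ->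
  path_integral T W (step_process L) w = simple_integral W L w.
Proof.
have fin : (kappa w setT < +oo)%E by rewrite /path_measure stieltjes_setT ?ltry// ltW.
(* Integrability is carried through the induction because additivity of the real-valued integral
   requires it. *)
suff : is_step T F L -> (kappa w).-integrable setT (fun t => (step_process L (w, t))%:E) /\
    path_integral T W (step_process L) w = simple_integral W L w by move=> h /h[].
elim: L => [_|x L IH /is_step_cons[sx sL]].
  rewrite simple_integral_nil step_process_nil; split; first exact: integrable0.
  by rewrite /path_integral/Rintegral integral0.
have [ihi ihE] := IH sL; rewrite -cat1s step_process_cat simple_integral_cat.
have [c [A [/andP[s0 st] tT FA -> ->]]] := step_singleton W sx.
have mI : measurable (`]x.1.1, x.1.2]%classic : set (measurableTypeR R)) by exact: measurable_itv.
have i1 : (kappa w).-integrable setT (EFin \o (\1_(`]x.1.1, x.1.2]%classic))).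
  exact: integrable_indic_lty.
have hE t : ((c : R^o) *: (\1_(A `*` `]x.1.1, x.1.2]%classic) : OR -> R^o)) (w, t) =
    (c * \1_A w) * \1_(`]x.1.1, x.1.2]%classic) t.
  by rewrite -mulrA -(indic_setX A _ (w, t)).
have i2 : (kappa w).-integrable setT
    (fun t => (((c : R^o) *: (\1_(A `*` `]x.1.1, x.1.2]%classic) : OR -> R^o)) (w, t))%:E).
  have := integrableZl measurableT (c * \1_A w) i1.
  by apply: eq_integrable => // t _; rewrite hE.
split; first by have := integrableD measurableT i2 ihi; apply: eq_integrable.
rewrite [RHS](_ : _ = c * (\1_A w * (W x.1.2 w - W x.1.1 w)) + simple_integral W L w)//.
rewrite -ihE [LHS]RintegralD//; congr (_ + _).
under eq_Rintegral do rewrite hE.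
rewrite RintegralZl// -mulrA; congr (_ * (_ * _)).
rewrite /Rintegral integral_indic// setIT.
by have := stieltjes_itv (W_inc w) s0 st tT; rewrite /path_measure => ->.
Qed.

(** Only values of [W] up to time [s] enter, and [W] is adapted; the uniform bound on its increments
    gives square-integrability. *)
Lemma simple_integral_before s L : 0 <= s -> s <= T -> is_step T F L ->
  L2 P (F s) (simple_integral W (before s L) : Omega -> R^o).
Proof.
move=> s0 sT; have ss : 0 <= s <= T by rewrite s0.
have sF := L2_subspace P (FM ss).
elim: L => [_|x L IH /is_step_cons[sx sL]].
  by rewrite simple_integral_nil; exact: sF.1.
have -> : before s (x :: L) = before s [:: x] ++ before s L by [].
rewrite simple_integral_cat; apply: (subspaceD sF); last exact: IH.
have [c [A [/andP[/= h0 hst] htT FA -> _]]] := step_singleton W (is_step_before (s := s) sx).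
apply: (subspaceZ sF); rewrite /elem_integral.
(* When the interval starts at [s] or later its event need not be in [F s], but the interval has
   collapsed and the term is 0. *)
have [sx1|x1s] := leP s x.1.1.
  rewrite (_ : (fun _ => _) = 0); first exact: sF.1.
  apply/funext => w; rewrite (max_idPl _) ?subrr ?mulr0//.
  by rewrite ge_min sx1 orbT.
set t := Num.max _ _ in hst htT *.
have ts : t <= s by rewrite /t ge_max (ltW x1s) ge_min lexx orbT.
apply: L2_indic_mul; first exact: FM.
  by apply: sub_sigma_algebra; apply: (filtration_mono F_usual h0 (ltW x1s) sT).
have lB : L2m P (B *: (\1_setT : Omega -> R^o)).
  by apply: (subspaceZ (si_sub sP)); apply: L2_indic => //; exact: sub_sigma_algebra.
apply: (L2_bounded (FM ss) _ lB).
  apply: (@measurable_funB _ (g_sigma_algebraType (F s))).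
    apply: (filtration_measurable F_usual _ ts sT); first exact: le_trans hst.
    by apply: W_adapted; rewrite htT (le_trans h0).
  apply: (filtration_measurable F_usual h0 (ltW x1s) sT).
  by apply: W_adapted; rewrite h0 (le_trans (ltW x1s)).
move=> w; rewrite [(B *: _) w](_ : _ = B * \1_setT w)// indicE mem_set// mulr1.
have hinc : W x.1.1 w <= W t w by have [h _] := W_inc w; apply: h.
rewrite ger0_norm ?subr_ge0// ger0_norm//.
exact: W_bounded.
Qed.

Lemma L2_supported_bound (f : OR -> R^o) s t : L2m mu f -> 0 <= s -> s <= t -> t <= T ->
  supported f s t -> L2m P (path_integral T W f) /\
  seminorm (ip P) (path_integral T W f) <= Num.sqrt B * seminorm (ip mu) f.
Proof.
move=> lf s0 st tT sf.
apply: (path_integral_bound T_gt0 W_inc mu_int mu_meas lf _ s0 st tT _ sf) => //.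
by move=> w; exact: W_bounded.
Qed.

(* The drift part accumulated before [s] is [F s]-measurable, whereas the
   stochastic integral after [s] has zero conditional expectation given [F s]. *)
Lemma past_future_orthogonal s (f psi : OR -> R^o) : 0 <= s -> s <= T ->
  L2 mu GF f -> supported f 0 s ->
  L2 mu GF psi -> (forall z, z.2 <= s -> psi z = 0) ->
  ip P (path_integral T W f) (ito P T F M mu psi) = 0.
Proof.
move=> s0 sT lf sf lpsi spsi; have ss : 0 <= s <= T by rewrite s0.
pose D : set (OR -> R^o) := [set g | L2 mu GF g /\ supported g 0 s].
have sD : linear_subspace D by exact: supported_subspace.
have DL : D `<=` L2m mu by move=> g [lg _]; exact: L2_L2m lg.
have DC g : D g -> L2m P (path_integral T W g) /\
    seminorm (ip P) (path_integral T W g) <= Num.sqrt B * seminorm (ip mu) g.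
  by move=> [lg sg]; apply: (L2_supported_bound _ _ _ _ sg) => //; exact: L2_L2m lg.
have lI : L2m P (ito P T F M mu psi).
  exact: (ito_L2m T_gt0 F_usual M_mart W_inc mu_int MW_mart).
have lin := path_integral_linear T_gt0 W_inc mu_int mu_meas sD DL (fun g dg => (DC g dg).1) lI.
pose k := Num.sqrt B * seminorm (ip P) (ito P T F M mu psi).
have k0 : 0 <= k by rewrite mulr_ge0// ?sqrtr_ge0// seminorm_ge0.
apply/eqP; rewrite -normr_le0; apply: le_small => e e0.
have k1 : 0 < k + 1 by rewrite ltr_pwDr.
have [L sL hL] := step_process_dense T_gt0 F_usual W_inc mu_int lf (divr_gt0 e0 k1).
have sL' := is_step_before (s := s) sL.
have supL z : ~~ (0 < z.2 <= T) -> step_process L z = 0.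
  move=> hz; rewrite /step_process/uncurry/simple_process big_seq big1// => x /sL[c [A [h1 h2 h3 _ _]]].
  rewrite indicE mem_setE in_itv/=.
  have [/andP[h4 h5]|_] := boolP (x.1.1 < z.2 <= x.1.2); last by rewrite mulr0.
  case/negP: hz.
  by rewrite (le_lt_trans h1 h4) (le_trans h5).
have dL : D (step_process (before s L)).
  split; first exact: (step_process_L2 T_gt0 F_usual mu sL').
  move=> z hz; rewrite step_process_before indicE mem_setE in_itv/=.
  have [zs|] := leP z.2 s; last by rewrite mulr0.
  rewrite supL ?mul0r//; apply: contra hz => /andP[-> _] /=.
  exact: zs.
have df : D f by [].
(* For a step cut at [s] the path integral is a finite sum of increments of [W] before [s], and
   [ito_future] applies; the bound on path integrals carries the result to [f]. *)
have CL0 : ip P (path_integral T W (step_process (before s L))) (ito P T F M mu psi) = 0.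
  rewrite (_ : path_integral _ _ _ = simple_integral W (before s L)).
    apply: (ito_future T_gt0 F_usual M_mart W_inc mu_int MW_mart s0 sT) => //.
    exact: simple_integral_before.
  by apply/funext => w; exact: path_integral_step.
rewrite -[X in `|X|]subr0 -CL0 -(linear_onB sD lin df dL).
have dfL := subspaceB sD df dL.
have [lC bC] := DC _ dfL.
apply: (le_trans (cauchy_schwarz sP lC lI)).
(* Cutting the step at [s] cannot increase the distance to [f], which vanishes after [s]. *)
have hle : seminorm (ip mu) (f - step_process (before s L)) <= e / (k + 1).
  apply: le_trans hL; apply: ler_wsqrtr; apply: le_Rintegral => //.
  - by apply: L2m_mul; exact: DL.
  - apply: L2m_mul; apply: (L2_L2m GM); apply: (subspaceB (si_sub sG)) => //;
    exact: (step_process_L2 T_gt0 F_usual mu sL).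
  - move=> z _.
    rewrite [(f - step_process (before s L)) z](_ : _ = f z - step_process (before s L) z)//.
    rewrite [(f - step_process L) z](_ : _ = f z - step_process L z)//.
    rewrite step_process_before -!expr2 indicE mem_setE in_itv/=.
    case: (leP z.2 s) => h; first by rewrite mulr1.
    rewrite mulr0 sf; last by rewrite negb_and -[~~ (_ <= s)]ltNge h orbT.
    by rewrite subrr expr0n/= sqr_ge0.
apply: (@le_trans _ _ ((k + 1) * (e / (k + 1)))); last first.
  by rewrite mulrC divfK// gt_eqF.
apply: (@le_trans _ _ (k * (e / (k + 1)))); last first.
  by rewrite ler_wpM2r ?lerDl// ltW// divr_gt0.
rewrite /k mulrAC ler_wpM2r ?seminorm_ge0//.
by apply: (le_trans bC); rewrite ler_wpM2l ?sqrtr_ge0.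
Qed.

End past_future.

(** * Solving under partial information *)

(** The conditional expectation is the orthogonal projection onto L2 of [G], given by Riesz. The
    last clause tests it against square-integrable variables instead of events. *)
Lemma cond_exp_exists d (Omega : measurableType d) (R : realType)
    (P : probability Omega R) (G : set (set Omega)) (Y : Omega -> R^o) :
  sigma_algebra setT G -> G `<=` measurable -> L2m P Y ->
  exists Z, [/\ L2 P G Z, is_cond_exp P G Y Z &
    forall X, L2 P G X -> ip P Z X = ip P Y X].
Proof.
move=> sG GM lY; have sM := L2_semi_inner P (@subset_refl _ (@measurable _ Omega)).
have sI := L2_semi_inner P GM.
have [||Z lZ hZ] := riesz sI (L2_complete GM) (l := ip P Y) (c := seminorm (ip P) Y).
- move=> a f g lf lg; apply: (si_linr sM lY); exact: (L2_L2m GM).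
- by move=> f lf; apply: (cauchy_schwarz sM lY); exact: (L2_L2m GM).
exists Z; split => //.
have lZm := L2_L2m GM lZ.
split; [exact: lZ.1|exact: L2m_integrable|].
move=> B GB; have lB : L2 P G (\1_B).
  by apply: L2_indic => //; exact: sub_sigma_algebra.
rewrite -(integral_indic_mul P Z B) -(integral_indic_mul P Y B).
transitivity ((ip P Z (\1_B))%:E).
  by rewrite EFin_ip//; [apply: eq_integral => x _; rewrite mulrC|exact: L2_L2m lB].
rewrite hZ// EFin_ip//; last exact: L2_L2m lB.
by apply: eq_integral => x _; rewrite mulrC.
Qed.

Lemma ip_eq0_ae d (X : measurableType d) (R : realType)
    (mu : {measure set X -> \bar R}) (f : X -> R^o) :
  L2m mu f -> ip mu f f = 0 -> {ae mu, forall x, f x = 0}.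
Proof.
move=> lf f0; have /L2mP[mf _] := lf.
have mf2 : measurable_fun setT (fun x => (f x ^+ 2)%:E).
  by apply/measurable_EFinP/measurable_funX.
have : (\int[mu]_x `|(f x ^+ 2)%:E| = 0)%E.
  under eq_integral do rewrite gee0_abs ?lee_fin ?sqr_ge0//.
  by rewrite -EFin_ip_sqr// f0.
move=> /(ae_eq_integral_abs mu measurableT mf2); apply: filterS => x /(_ I) /= [] /eqP.
by rewrite sqrf_eq0 => /eqP.
Qed.

Lemma semi_inner_sub (R : realType) (X : lmodType R) (b : X -> X -> R) (D D' : set X) :
  semi_inner b D -> D' `<=` D -> linear_subspace D' -> semi_inner b D'.
Proof.
move=> sD DD sD'; split => //.
- by move=> x y /DD dx /DD dy; exact: (si_sym sD).
- by move=> z /DD dz a x y /DD dx /DD dy; exact: (si_lin sD).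
- by move=> x /DD; exact: (si_ge0 sD).
Qed.

Section partial_information.
Context d {Omega : measurableType d} {R : realType}.
Variables (P : probability Omega R) (T : R) (F H : R -> set (set Omega)).
Hypothesis T_gt0 : 0 < T.
Hypothesis F_usual : usual_filtration P T F.
Hypothesis F_T : F T = measurable.
Hypothesis H_usual : usual_filtration P T H.
Hypothesis H_sub_F : forall t, 0 <= t <= T -> H t `<=` F t.
Notation OR := (Omega * measurableTypeR R)%type.
Variables (M W : R -> Omega -> R) (mu : {finite_measure set OR -> \bar R}).
Hypothesis M_mart : square_integrable_martingale P T F M.
Hypothesis W_inc : forall w, increasing_path T (W ^~ w).
Hypothesis W_adapted : adapted T F W.
Variables (B b K delta : R).
Hypothesis W_bounded : forall w s t, 0 <= s -> s <= t -> t <= T -> W t w - W s w <= B.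
Hypothesis W_small : forall w s t, 0 <= s -> s <= t -> t <= T -> t - s <= delta ->
  W t w - W s w <= b.
Hypothesis delta_gt0 : 0 < delta.
Hypothesis K_ge0 : 0 <= K.
Hypothesis b_ge0 : 0 <= b.
Hypothesis Kb_small : Num.sqrt b * K <= 2^-1.
Hypothesis mu_int : forall f : OR -> \bar R, (forall z, 0 <= f z)%E ->
  measurable_fun setT f ->
  (\int[mu]_z f z = \int[P]_w \int[path_measure T W w]_t f (w, t))%E.
Hypothesis mu_meas : forall f : OR -> \bar R, (forall z, 0 <= f z)%E ->
  measurable_fun setT f ->
  measurable_fun setT (fun w => \int[path_measure T W w]_t f (w, t))%E.
Hypothesis MW_mart : martingale P T F (fun t w => M t w ^+ 2 - W t w).

Notation GF := (predictable_rect T F : set (set OR)).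
Notation GH := (predictable_rect T H : set (set OR)).
Variable alpha : OR -> R^o.
Hypothesis alpha_predictable : G_measurable GF alpha.
Hypothesis alpha_bounded : forall z, `|alpha z| <= K.

Let FM := predictable_rect_measurable T_gt0 F_usual.
Let HM := predictable_rect_measurable T_gt0 H_usual.
Let sF := L2_semi_inner mu FM.
Let sH := L2_semi_inner mu HM.
Let sM := L2_semi_inner mu (@subset_refl _ (@measurable _ OR)).
Let sP := L2_semi_inner P (@subset_refl _ (@measurable _ Omega)).
Let itophi phi := ito P T F M mu phi.

Let GHF : L2 mu GH `<=` L2 mu GF.
Proof.
move=> f; apply: L2_sub => A HA; apply: sub_sigma_algebra.
exact: (predictable_rect_mono (ltW T_gt0) H_sub_F).
Qed.

(** A deterministic time window preserves H-predictability, so test processes can be split over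
    consecutive intervals without leaving their space. *)
Definition restrict_time s t (f : OR -> R^o) : OR -> R^o :=
  fun z => \1_(setT `*` `]s, t]%classic) z * f z.

Lemma restrict_timeE s t f z :
  restrict_time s t f z = if s < z.2 <= t then f z else 0.
Proof.
rewrite /restrict_time indic_setX !indicE mem_set// mul1r mem_setE in_itv/=.
by case: ifPn; rewrite ?mul1r// mul0r.
Qed.

Lemma restrict_time_L2 s t f : 0 <= s -> s <= T -> t <= T -> L2 mu GH f ->
  L2 mu GH (restrict_time s t f).
Proof.
move=> s0 sT tT lf; apply: (L2_indic_mul HM) => //.
by apply: g_sigma_rect => //; apply: (filtration_setT H_usual); rewrite s0.
Qed.

Definition on_interval s t : set (OR -> R^o) :=
  [set f | L2 mu GH f /\ supported f s t].

Let on_H s t : on_interval s t `<=` L2 mu GH. Proof. by move=> f []. Qed.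
Let on_F s t : on_interval s t `<=` L2 mu GF. Proof. by move=> f /on_H/GHF. Qed.
Let on_M s t : on_interval s t `<=` L2m mu. Proof. by move=> f /on_H; exact: L2_L2m. Qed.

Lemma on_interval_subspace s t : linear_subspace (on_interval s t).
Proof. exact: supported_subspace. Qed.

Lemma on_interval_semi_inner s t : semi_inner (ip mu) (on_interval s t).
Proof. exact: (semi_inner_sub sH (@on_H s t) (on_interval_subspace s t)). Qed.

Lemma on_intervalW s t s' t' : s' <= s -> t <= t' -> on_interval s t `<=` on_interval s' t'.
Proof.
move=> ss' tt' f [lf sf]; split => // z hz; apply: sf; apply: contra hz => /andP[h1 h2].
by rewrite (le_lt_trans ss' h1) (le_trans h2).
Qed.

Lemma restrict_time_on s t f : 0 <= s -> s <= T -> t <= T -> L2 mu GH f ->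
  on_interval s t (restrict_time s t f).
Proof.
move=> s0 sT tT lf; split; first exact: restrict_time_L2.
by move=> z hz; rewrite restrict_timeE (negbTE hz).
Qed.

(** A limit in L2 may take nonzero values off the interval; restricting it brings it no farther from
    any [u n], as these vanish there. *)
Lemma on_interval_complete s t : 0 <= s -> s <= T -> t <= T ->
  geo_complete (ip mu) (on_interval s t).
Proof.
move=> s0 sT tT u C C0 du hu.
have [x lx hx] := L2_complete HM C0 (fun n => on_H (du n)) hu.
have dx := restrict_time_on s0 sT tT lx.
exists (restrict_time s t x) => // n; apply: le_trans (hx n).
have lun := on_M (du n).
apply: ler_wsqrtr; apply: le_Rintegral => //.
- by apply: L2m_mul; apply: (subspaceB (si_sub sM)) => //; exact: on_M dx.
- by apply: L2m_mul; apply: (subspaceB (si_sub sM)) => //; exact: L2_L2m lx.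
- move=> z _.
  rewrite [(u n - restrict_time s t x) z](_ : _ = u n z - restrict_time s t x z)//.
  rewrite [(u n - x) z](_ : _ = u n z - x z)// restrict_timeE -!expr2.
  by case: ifPn => // hz; rewrite (du n).2// subrr expr0n/= sqr_ge0.
Qed.

Definition drift (f : OR -> R^o) : Omega -> R^o := path_integral T W (fun z => f z * alpha z).

Lemma mul_alpha_L2 f : L2 mu GF f -> L2 mu GF (fun z => f z * alpha z).
Proof.
move=> lf; have lKf := subspaceZ (si_sub sM) K (L2_L2m FM lf).
apply: (L2_bounded FM _ lKf).
  by apply: (@measurable_funM _ (g_sigma_algebraType GF)) => //; exact: lf.1.
move=> z; rewrite [(K *: f) z](_ : _ = K * f z)// !normrM mulrC ler_wpM2r//.
by rewrite (ger0_norm K_ge0).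
Qed.

Lemma seminorm_mul_alpha f : L2 mu GF f ->
  seminorm (ip mu) (fun z => f z * alpha z) <= K * seminorm (ip mu) f.
Proof.
move=> lf; have lm := L2_L2m FM lf.
rewrite -[K in leRHS](ger0_norm K_ge0) -(seminormZ sM K lm).
have lK := subspaceZ (si_sub sM) K lm.
have la := L2_L2m FM (mul_alpha_L2 lf).
apply: ler_wsqrtr; apply: le_Rintegral => //; try exact: L2m_mul.
move=> z _; rewrite [(K *: f) z](_ : _ = K * f z)//.
rewrite -!expr2 !exprMn mulrC ler_wpM2r ?sqr_ge0//.
by rewrite -[alpha z ^+ 2]real_normK ?num_real// ler_sqr ?nnegrE.
Qed.

Let supported_mul f s t : supported f s t -> supported (fun z => f z * alpha z) s t.
Proof. by move=> sf z /sf ->; rewrite mul0r. Qed.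

Lemma drift_bound f s t (b' : R) : L2 mu GF f -> supported f s t -> 0 <= b' ->
  0 <= s -> s <= t -> t <= T -> (forall w, W t w - W s w <= b') ->
  L2m P (drift f) /\ seminorm (ip P) (drift f) <= Num.sqrt b' * K * seminorm (ip mu) f.
Proof.
move=> lf sf b'0 s0 st tT hb; have la := mul_alpha_L2 lf.
have [lC h] := path_integral_bound T_gt0 W_inc mu_int mu_meas (L2_L2m FM la)
  b'0 s0 st tT hb (supported_mul sf).
split => //; apply: (le_trans h); rewrite -mulrA ler_wpM2l ?sqrtr_ge0//.
exact: seminorm_mul_alpha.
Qed.

Let B_ge0 : 0 <= B.
Proof. by have := @W_bounded point 0 0; rewrite subrr; apply => //; exact: ltW. Qed.

Lemma drift_L2 f : L2 mu GF f -> supported f 0 T -> L2m P (drift f).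
Proof.
move=> lf sf; have [] := drift_bound lf sf B_ge0 (lexx 0) (ltW T_gt0) (lexx T) _ => //.
by move=> w; apply: W_bounded => //; exact: ltW.
Qed.

Let itoL f : L2 mu GF f -> L2m P (itophi f).
Proof. exact: (ito_L2m T_gt0 F_usual M_mart W_inc mu_int MW_mart). Qed.

Let on_drift s t f : 0 <= s -> t <= T -> on_interval s t f -> L2m P (drift f).
Proof.
move=> s0 tT df; apply: drift_L2; first exact: on_F df.
by have [] := on_intervalW s0 tT df.
Qed.

Lemma drift_linear s t Y : 0 <= s -> t <= T -> L2m P Y ->
  linear_on (on_interval s t) (fun f => ip P (drift f) Y).
Proof.
move=> s0 tT lY a f g df dg.
pose D : set (OR -> R^o) := [set h | L2 mu GF h /\ supported h 0 T].
have sD : linear_subspace D by exact: supported_subspace.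
have Dm h : on_interval s t h -> D (fun z => h z * alpha z).
  move=> dh; split; first by apply: mul_alpha_L2; exact: on_F dh.
  by apply: supported_mul; have [] := on_intervalW s0 tT dh.
have DL : D `<=` L2m mu by move=> h [lh _]; exact: L2_L2m lh.
have DC h : D h -> L2m P (path_integral T W h).
  move=> dh; have [] := path_integral_bound T_gt0 W_inc mu_int mu_meas (DL _ dh)
    B_ge0 (lexx 0) (ltW T_gt0) (lexx T) _ dh.2 => //.
  by move=> w; apply: W_bounded => //; exact: ltW.
have := path_integral_linear T_gt0 W_inc mu_int mu_meas sD DL DC lY a (Dm _ df) (Dm _ dg).
rewrite /drift => <-; congr (ip P (path_integral T W _) Y).
apply/funext => z; rewrite [(a *: f + g) z](_ : _ = a * f z + g z)//.
rewrite [RHS](_ : _ = a * (f z * alpha z) + g z * alpha z)//.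
by rewrite mulrDl mulrA.
Qed.

Let ito_lin s t Y : L2m P Y -> linear_on (on_interval s t) (fun f => ip P Y (itophi f)).
Proof.
move=> lY a f g /on_F lf /on_F lg.
exact: (ito_linear T_gt0 F_usual M_mart W_inc mu_int MW_mart lY).
Qed.

Definition solves s t (eta : Omega -> R^o) (beta : OR -> R^o) :=
  forall psi, on_interval s t psi ->
    ip mu beta psi + ip P (drift beta) (itophi psi) = ip P eta (itophi psi).

Let seminorm_ito f : L2 mu GF f -> seminorm (ip P) (itophi f) = seminorm (ip mu) f.
Proof.
by move=> lf; rewrite /seminorm (ito_isometry T_gt0 F_usual M_mart W_inc mu_int MW_mart).
Qed.

(* On an interval of length at most [delta] the drift is a perturbation of the
   isometry of norm at most [1/2]. *)
Lemma solve_short s t eta : 0 <= s -> s <= t -> t <= T -> t - s <= delta ->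
  L2m P eta -> exists2 beta, on_interval s t beta & solves s t eta beta.
Proof.
move=> s0 st tT ts leta; have sT := le_trans st tT.
apply: (lax_milgram (on_interval_semi_inner s t) (on_interval_complete s0 sT tT)
  (c := fun f g => ip P (drift f) (itophi g)) (k := seminorm (ip P) eta)).
- by move=> g dg; apply: (drift_linear s0 tT); apply: itoL; exact: on_F dg.
- by move=> f df; apply: ito_lin; exact: on_drift df.
- move=> f g df dg; have [lD hD] := drift_bound (on_F df) df.2 b_ge0 s0 st tT
    (fun w => W_small w s0 st tT ts).
  apply: (le_trans (cauchy_schwarz sP lD (itoL (on_F dg)))).
  rewrite seminorm_ito ?mulrA//; last exact: on_F dg.
  rewrite ler_wpM2r ?seminorm_ge0//; apply: (le_trans hD).
  by rewrite ler_wpM2r ?seminorm_ge0.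
- exact: ito_lin.
- move=> g dg; apply: (le_trans (cauchy_schwarz sP leta (itoL (on_F dg)))).
  by rewrite seminorm_ito//; exact: on_F dg.
Qed.

Let split_time s u t f : s <= u -> u <= t -> supported f s t ->
  f = restrict_time s u f + restrict_time u t f.
Proof.
move=> su ut sf; apply/funext => z.
rewrite [RHS](_ : _ = restrict_time s u f z + restrict_time u t f z)// !restrict_timeE.
have [h|h] := boolP (s < z.2 <= u).
  by move: h => /andP[_ h]; rewrite [u < _]ltNge h/= addr0.
have [h'|h'] := boolP (u < z.2 <= t); first by rewrite add0r.
rewrite addr0 sf//; apply/negP => /andP[h1 h2].
have [h3|h3] := leP z.2 u; first by rewrite h1 h3 in h.
by rewrite h3 h2 in h'.
Qed.

Let ip_disjoint (f g : OR -> R^o) : (forall z, f z * g z = 0) -> ip mu f g = 0.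
Proof. by move=> fg; rewrite /ip /Rintegral integral0_eq// => z _; rewrite fg. Qed.

(** The coupling is triangular. The later drift [drift beta] does meet the earlier test processes,
    and is therefore subtracted from the data of the earlier problem; the earlier drift is invisible
    to the later test processes by [past_future_orthogonal]. The cross terms of [ip mu] vanish by
    disjointness of supports. *)
Lemma solves_combine s u eta beta beta' : 0 <= s -> s <= u -> u <= T -> L2m P eta ->
  on_interval u T beta -> solves u T eta beta ->
  on_interval s u beta' -> solves s u (eta - drift beta) beta' ->
  on_interval s T (beta' + beta) /\ solves s T eta (beta' + beta).
Proof.
move=> s0 su uT leta db hb db' hb'.
have u0 := le_trans s0 su; have sT := le_trans su uT.
have dbT : on_interval s T beta by exact: on_intervalW su (lexx T) _ db.
have dbT' : on_interval s T beta' by exact: on_intervalW (lexx s) uT _ db'.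
have lD : L2m P (drift beta) := on_drift s0 (lexx T) dbT.
have lD' : L2m P (drift beta') := on_drift s0 (lexx T) dbT'.
split; first exact: (subspaceD (on_interval_subspace s T)).
move=> psi dpsi.
pose p1 := restrict_time s u psi; pose p2 := restrict_time u T psi.
have d1 : on_interval s u p1 by exact: restrict_time_on (on_H dpsi).
have d2 : on_interval u T p2 by exact: restrict_time_on (on_H dpsi).
have d1T : on_interval s T p1 by exact: on_intervalW (lexx s) uT _ d1.
have d2T : on_interval s T p2 by exact: on_intervalW su (lexx T) _ d2.
have l1 := itoL (on_F d1); have l2 := itoL (on_F d2).
have ito_split Y : L2m P Y -> ip P Y (itophi psi) = ip P Y (itophi p1) + ip P Y (itophi p2).
  move=> lY; rewrite (split_time su uT dpsi.2).
  exact: (linear_onD (ito_lin lY) d1T d2T).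
have bb := linear_onD (si_lin (on_interval_semi_inner s T) dpsi) dbT' dbT.
have bc := linear_onD (drift_linear s0 (lexx T) (itoL (on_F dpsi))) dbT' dbT.
rewrite {}bb {}bc !ito_split//.
rewrite (split_time su uT dpsi.2) -/p1 -/p2.
rewrite (linear_onD (si_linr (on_interval_semi_inner s T) dbT') d1T d2T).
rewrite (linear_onD (si_linr (on_interval_semi_inner s T) dbT) d1T d2T).
have -> : ip mu beta' p2 = 0.
  apply: ip_disjoint => z; rewrite /p2 restrict_timeE; case: ifPn => [/andP[h _]|]; last by rewrite mulr0.
  by rewrite (db'.2 z) ?mul0r// negb_and -ltNge h orbT.
have -> : ip mu beta p1 = 0.
  apply: ip_disjoint => z; rewrite /p1 restrict_timeE; case: ifPn => [/andP[_ h]|]; last by rewrite mulr0.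
  by rewrite (db.2 z) ?mul0r// negb_and -leNgt h.
have -> : ip P (drift beta') (itophi p2) = 0.
  apply: (past_future_orthogonal T_gt0 F_usual M_mart W_inc W_adapted W_bounded
    mu_int mu_meas MW_mart u0 uT).
  - by apply: mul_alpha_L2; exact: on_F db'.
  - by apply: supported_mul; have [] := on_intervalW s0 (lexx u) db'.
  - exact: on_F d2.
  - by move=> z zu; rewrite /p2 restrict_timeE ltNge zu.
have := hb' _ d1; have := hb _ d2.
rewrite (linear_onB (si_sub sP) (si_lin sP l1))//.
have alg (x1 x2 y1 y2 y3 z1 z2 : R) : x2 + y3 = z2 -> x1 + y1 = z1 - y2 ->
  x1 + 0 + (0 + x2) + (y1 + 0 + (y2 + y3)) = z1 + z2 by lra.
exact: alg.
Qed.

(** Induction on the number of windows of length [delta], with the starting time universally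
    quantified since it moves backward. The data [eta] stays fixed; only the problem on the first
    window has modified data. *)
Lemma solve_exists eta : L2m P eta -> forall n s, 0 <= s -> s <= T -> T - s <= n%:R * delta ->
  exists2 beta, on_interval s T beta & solves s T eta beta.
Proof.
move=> leta; elim=> [|n IH] s s0 sT hs.
  (* With no window left the interval is empty, and the short problem on it is already solvable. *)
  have sE : s = T by apply/eqP; rewrite eq_le sT -subr_le0 (le_trans hs)// mul0r.
  by apply: solve_short => //; rewrite sE subrr ltW.
pose u := Num.min (s + delta) T.
have su : s <= u by rewrite le_min sT lerDl ltW.
have uT : u <= T by rewrite ge_min lexx orbT.
have u0 := le_trans s0 su.
have [|beta db hb] := IH u u0 uT.
  have nd : 0 <= n%:R * delta by rewrite mulr_ge0// ltW.
  rewrite /u; case: (leP (s + delta) T) => h; last by rewrite subrr.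
  by move: hs; rewrite -natr1 mulrDl mul1r; lra.
have lD : L2m P (drift beta) := on_drift u0 (lexx T) db.
have [||beta' db' hb'] := @solve_short s u (eta - drift beta) s0 su uT.
- by rewrite lerBlDl /u ge_min lexx.
- exact: (subspaceB (si_sub sP)).
have [dB hB] := solves_combine s0 su uT leta db hb db' hb'.
by exists (beta' + beta).
Qed.

Lemma decomposition_nice xi : L2m P xi -> exists U0 beta A,
  [/\ L2 P (F 0) U0, on_interval 0 T beta,
    martingale P T F A /\ {ae P, forall w, A 0 w = 0},
    A T = xi - itophi beta - drift beta - U0 &
    L2m P (A T) /\ forall phi, L2 mu GH phi -> ip P (A T) (itophi phi) = 0].
Proof.
move=> lxi.
have [|beta db hb] := @solve_exists xi lxi (Num.bound (T / delta)).+1 0 (lexx 0) (ltW T_gt0).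
  rewrite subr0 -ler_pdivrMr//; apply: ltW.
  apply: lt_le_trans (archi_boundP _) _; first by rewrite divr_ge0// ltW.
  by rewrite ler_nat.
have T00 : 0 <= (0 : R) <= T by rewrite lexx ltW.
have TT : 0 <= T <= T by rewrite lexx ltW.
have lD : L2m P (drift beta) := on_drift (lexx 0) (lexx T) db.
have lI := itoL (on_F db).
pose eta0 := xi - itophi beta - drift beta.
have leta0 : L2m P eta0 by do 2 (apply: (subspaceB (si_sub sP)) => //).
have F_sig t : 0 <= t <= T -> sigma_algebra setT (F t) by have [h _ _ _ _] := F_usual; exact: h.
have [U0 [lU0 _ ipU0]] := cond_exp_exists (F_sig _ T00) (filtration_sub F_usual T00) leta0.
have lU0m := L2_L2m (filtration_sub F_usual T00) lU0.
pose eta := eta0 - U0.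
have leta : L2m P eta by exact: (subspaceB (si_sub sP)).
have /choice[A hA] t : exists Z, 0 <= t <= T -> [/\ L2 P (F t) Z, is_cond_exp P (F t) eta Z &
    forall X, L2 P (F t) X -> ip P Z X = ip P eta X].
  have [tT|] := boolP (0 <= t <= T); last by exists 0.
  have [Z hZ] := cond_exp_exists (F_sig _ tT) (filtration_sub F_usual tT) leta.
  by exists Z.
(* At time [T] the variable [eta] itself replaces the chosen version, so that [A T] is the remainder
   at every point. It is a version of its own conditional expectation because [F T] contains all
   events. *)
pose A' t := if t == T then eta else A t.
have hA' t : 0 <= t <= T -> L2 P (F t) (A' t) /\ is_cond_exp P (F t) eta (A' t).
  move=> tT; rewrite /A'; case: eqP => [->|_]; last by have [] := hA t tT.
  rewrite F_T; split => //; split => //; first exact: leta.1.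
  exact: L2m_integrable.
have lA' t (tT : 0 <= t <= T) := L2_L2m (filtration_sub F_usual tT) (hA' t tT).1.
exists U0, beta, A'; split => //.
- split.
    split; first by move=> t tT; exact: (hA' t tT).1.1.
      by move=> t tT; apply: L2m_integrable; exact: lA'.
    move=> s t s0 st tT; have ss : 0 <= s <= T by rewrite s0 (le_trans st).
    have tt : 0 <= t <= T by rewrite (le_trans s0).
    split; first exact: (hA' s ss).1.1.
      by apply: L2m_integrable; exact: lA'.
    move=> B' FB; have [_ _ ->//] := (hA' s ss).2.
    have [_ _ ->//] := (hA' t tt).2.
    exact: (filtration_mono F_usual s0 st tT).
  have A0 : A' 0 = A 0 by rewrite /A' lt_eqF.
  (* [A 0] is the projection of [eta0 - U0] onto L2 of [F 0], where [U0] is the projection of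
     [eta0]: its square has integral zero. *)
  apply: (@ip_eq0_ae _ _ _ P); first exact: lA'.
  rewrite A0; have [lA _ ipA] := hA 0 T00.
  have lA0 := L2_L2m (filtration_sub F_usual T00) lA.
  rewrite ipA// (linear_onB (si_sub sP) (si_lin sP lA0))//.
  by rewrite ipU0// subrr.
- by rewrite /A' eqxx.
- have -> : A' T = eta by rewrite /A' eqxx.
  split => // phi lphi.
  have lphiF := GHF lphi.
  (* The equations are available for processes supported in []0, T]] only. Cutting [phi] down to it
     changes the integral by a null variable, since [mu] charges nothing else. *)
  pose psi := restrict_time 0 T phi.
  have dpsi : on_interval 0 T psi by apply: restrict_time_on => //; exact: ltW.
  have lpsi := on_F dpsi.
  have ldiff := subspaceB (si_sub sF) lphiF lpsi.
  have null : seminorm (ip P) (itophi (phi - psi)) = 0.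
    rewrite seminorm_ito//; apply: (seminorm_null T_gt0 W_inc mu_int).
      exact: L2_L2m ldiff.
    move=> z hz; rewrite [(phi - psi) z](_ : _ = phi z - psi z)//.
    by rewrite /psi restrict_timeE hz subrr.
  have lin := ito_linear T_gt0 F_usual M_mart W_inc mu_int MW_mart leta.
  have -> : ip P eta (itophi phi) = ip P eta (itophi psi).
    apply/eqP; rewrite -subr_eq0 -(linear_onB (si_sub sF) lin lphiF lpsi).
    by rewrite (seminorm0_ip leta (itoL ldiff) null).
  rewrite (linear_onB (si_sub sP) (si_lin sP (itoL lpsi)))//.
  (* Subtracting [U0] does not spoil orthogonality: it is [F 0]-measurable and [psi] starts after
     time 0. *)
  rewrite [X in _ - X](ito_future T_gt0 F_usual M_mart W_inc mu_int MW_mart (lexx 0) (ltW T_gt0))//; last first.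
    by move=> z z0; rewrite /psi restrict_timeE ltNge z0.
  rewrite subr0 (linear_onB (si_sub sP) (si_lin sP (itoL lpsi)))//; last exact: (subspaceB (si_sub sP)).
  rewrite (linear_onB (si_sub sP) (si_lin sP (itoL lpsi)))//.
  rewrite (ito_isometry T_gt0 F_usual M_mart W_inc mu_int MW_mart)//; last exact: on_F db.
  have alg (x y z : R) : x + y = z -> z - x - y = 0 by lra.
  exact: (alg _ _ _ (hb _ dpsi)).
Qed.

End partial_information.

(** * Versions of the quadratic variation *)

Section transfer.
Context d {Omega : measurableType d} {R : realType}.
Variables (P : probability Omega R) (T : R) (F : R -> set (set Omega)).
Hypothesis T_gt0 : 0 < T.
Hypothesis F_usual : usual_filtration P T F.
Notation OR := (Omega * measurableTypeR R)%type.
Variables (M V W : R -> Omega -> R) (mu : {finite_measure set OR -> \bar R}).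
Hypothesis M_mart : square_integrable_martingale P T F M.
Hypothesis VW : {ae P, forall w, V ^~ w = W ^~ w}.
Hypothesis W_inc : forall w, increasing_path T (W ^~ w).
Hypothesis mu_int : forall f : OR -> \bar R, (forall z, 0 <= f z)%E ->
  measurable_fun setT f ->
  (\int[mu]_z f z = \int[P]_w \int[path_measure T W w]_t f (w, t))%E.
Hypothesis mu_meas : forall f : OR -> \bar R, (forall z, 0 <= f z)%E ->
  measurable_fun setT f ->
  measurable_fun setT (fun w => \int[path_measure T W w]_t f (w, t))%E.
Hypothesis MW_mart : martingale P T F (fun t w => M t w ^+ 2 - W t w).

Notation GF := (predictable_rect T F : set (set OR)).
Let GM := predictable_rect_measurable T_gt0 F_usual.
Let sM := L2_semi_inner mu (@subset_refl _ (@measurable _ OR)).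
Let sP := L2_semi_inner P (@subset_refl _ (@measurable _ Omega)).

Notation time := (setT `*` `[0, T]%classic : set OR).

Lemma usual_complete : measure_is_complete P.
Proof.
have [_ FM _ _ FN] := F_usual; move=> N /FN; apply: FM.
by rewrite lexx ltW.
Qed.

Lemma g_sigma_time (H : R -> set (set Omega)) : usual_filtration P T H ->
  <<s (predictable_rect T H : set (set OR)) >> time.
Proof.
move=> H_usual; have H0 : H 0 setT by apply: (filtration_setT H_usual); rewrite lexx ltW.
have -> : time = (setT `*` [set 0]) `|` (setT `*` `]0, T]%classic).
  apply/seteqP; split => -[w t] /=.
    move=> [_]; rewrite !in_itv/= => /andP[]; rewrite le_eqVlt => /orP[/eqP <-|-> ->].
      by left.
    by right.
  move=> [[_ ->]|[_]]; rewrite !in_itv/=; first by rewrite lexx ltW.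
  by move=> /andP[/ltW -> ->].
apply: (@measurableU _ (g_sigma_algebraType _)).
  by apply: sub_sigma_algebra; left; exists setT.
exact: g_sigma_rect.
Qed.

(** [predictable] says nothing about times outside [[0, T]]; setting the process to 0 there gives a
    function measurable on the whole product. *)
Definition on_time (phi : R -> Omega -> R) : OR -> R^o :=
  fun z => \1_time z * phi z.2 z.1.

Lemma on_timeE phi w t : on_time phi (w, t) = if 0 <= t <= T then phi t w else 0.
Proof.
rewrite /on_time indicE (_ : _ \in _ = (0 <= t <= T)).
  by case: ifPn; rewrite ?mul1r// mul0r.
by apply/idP/idP => [/set_mem[_]|h]; [rewrite /= in_itv|apply/mem_set; split => //=; rewrite in_itv].
Qed.

Lemma predictable_on_time (H : R -> set (set Omega)) phi : usual_filtration P T H ->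
  predictable T H phi -> G_measurable (predictable_rect T H : set (set OR)) (on_time phi).
Proof.
move=> H_usual pphi.
pose X : measurableType _ := g_sigma_algebraType (predictable_rect T H : set (set OR)).
have := (@measurable_restrictT _ _ X R (time : set X) _ (g_sigma_time H_usual)).1 pphi.
apply: eq_measurable_fun => z _.
by rewrite patchE /on_time indicE; case: ifPn => _; rewrite ?mul1r ?mul0r.
Qed.

(** The inner integrals along [V] and [W] agree off a null set. On that set the paths of [V] are
    arbitrary, so measurability of the integral along [V] comes from completeness of [P]. *)
Lemma dol_integralE (phi : R -> Omega -> \bar R) (f : OR -> \bar R) :
  (forall z, 0 <= f z)%E -> measurable_fun setT f ->
  (forall w t, f (w, t) = if 0 <= t <= T then phi t w else 0%E) ->
  dol_integral P T V phi = (\int[mu]_z f z)%E.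
Proof.
move=> f0 mf fE; apply: etrans (esym (mu_int f0 mf)); rewrite /dol_integral.
have hae : {ae P, forall w, setT w ->
    (\int[path_measure T W w]_t f (w, t) =
     \int[stieltjes T (V ^~ w)]_(t in `[0%R, T]%classic) phi t w)%E}.
  apply: filterS VW => w VWw _; rewrite VWw [RHS]integral_mkcond.
  apply: eq_integral => t _; rewrite fE patchE mem_setE in_itv/=.
  by case: ifP.
symmetry; apply: ge0_ae_eq_integral => //.
- exact: mu_meas.
- exact: (ae_measurable_fun usual_complete hae (mu_meas f0 mf)).
- by move=> w _; exact: integral_ge0.
- move=> w _; apply: integral_ge0 => t; rewrite /= in_itv/= => ht.
  by have := f0 (w, t); rewrite fE ht.
Qed.

Lemma on_time_sqr_dol phi : measurable_fun setT (on_time phi) ->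
  dol_integral P T V (fun t w => (phi t w ^+ 2)%:E) = (\int[mu]_z (on_time phi z ^+ 2)%:E)%E.
Proof.
move=> mf; apply: dol_integralE.
- by move=> z; rewrite lee_fin sqr_ge0.
- by apply/measurable_EFinP/measurable_funX.
- by move=> w t; rewrite on_timeE; case: ifP => // _; rewrite expr0n.
Qed.

Lemma M2_on_time (H : R -> set (set Omega)) phi : usual_filtration P T H ->
  M2 P T H V phi -> L2 mu (predictable_rect T H : set (set OR)) (on_time phi).
Proof.
move=> H_usual [pphi]; have mH := predictable_on_time H_usual pphi.
rewrite on_time_sqr_dol//.
exact: G_measurable_measurable (predictable_rect_measurable T_gt0 H_usual) mH.
Qed.

Lemma on_time_M2 (H : R -> set (set Omega)) phi : usual_filtration P T H ->
  predictable T H phi -> L2 mu (predictable_rect T H : set (set OR)) (on_time phi) ->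
  M2 P T H V phi.
Proof.
move=> H_usual pphi lphi; split => //; rewrite on_time_sqr_dol//.
  exact: lphi.2.
exact: G_measurable_measurable (predictable_rect_measurable T_gt0 H_usual) lphi.1.
Qed.

Lemma ereal_squeeze_geo (u : nat -> \bar R) : (forall n, 0 <= u n)%E ->
  (forall n, u n <= (2^-1 ^+ n)%:E)%E -> u n @[n --> \oo] --> 0%E.
Proof.
move=> u0 u1; apply: (@squeeze_cvge _ _ _ _ (cst 0%E) _ (fun n => (2^-1 ^+ n)%:E)).
- by apply: nearW => n; rewrite u0 u1.
- exact: cvg_cst.
- apply: cvg_EFin; first exact: nearW.
  have : (fun n => 2^-1 ^+ n) @ \oo --> (0 : R).
    by apply: cvg_expr; rewrite ger0_norm ?invr_ge0// invf_lt1// ltr1n.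
  by [].
Qed.

(** One sequence of steps at distance [2^-n] serves both limits: by [ito_spec] the error of the
    integrals equals the error of the integrands. *)
Lemma ito_is_ito_integral phi : predictable T F phi -> L2 mu GF (on_time phi) ->
  is_ito_integral P T F M V phi (ito P T F M mu (on_time phi)).
Proof.
move=> pphi lphi.
have [lI hI] := itoP T_gt0 F_usual M_mart W_inc mu_int MW_mart lphi.
have TT : 0 <= T <= T by rewrite ltW/=.
split; first exact: on_time_M2.
  by split; [exact: lI.1|rewrite /square_integrable unlock; exact: lI.2].
have /choice[L hL] n : exists L, is_step T F L /\
    seminorm (ip mu) (on_time phi - step_process L) <= 2^-1 ^+ n.
  have [L sL h] := step_process_dense T_gt0 F_usual W_inc mu_int lphi (@geo2_gt0 R n).
  by exists L.
have sq n : 0 <= seminorm (ip mu) (on_time phi - step_process (L n)) ^+ 2 <= 2^-1 ^+ n.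
  rewrite sqr_ge0/=; have := (hL n).2; have := @geo2_gt0 R n.
  have : 2^-1 ^+ n <= 1 :> R by apply: exprn_ile1; rewrite ?invr_ge0// invf_le1// ler1n.
  have := seminorm_ge0 (ip mu) (on_time phi - step_process (L n)).
  by set s := seminorm _ _; set e := 2^-1 ^+ n => *; nra.
have lsp n : L2m mu (step_process (L n)).
  exact: (step_process_L2m T_gt0 F_usual mu (hL n).1).
have ld n : L2m mu (on_time phi - step_process (L n)).
  by apply: (subspaceB (si_sub sM)) => //; exact: L2_L2m lphi.
exists L; split.
- by move=> n; apply: is_step_simple; exact: (hL n).1.
- have E n : dol_integral P T V (fun t w => ((phi t w - simple_process (L n) t w) ^+ 2)%:E) =
      (seminorm (ip mu) (on_time phi - step_process (L n)) ^+ 2)%:E.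
    rewrite (seminorm_sqr sM)// EFin_ip_sqr//.
    have /L2mP[md _] := ld n.
    apply: dol_integralE.
    + by move=> z; rewrite lee_fin sqr_ge0.
    + by apply/measurable_EFinP/measurable_funX.
    + move=> w t; rewrite [(_ - _) _](_ : _ = on_time phi (w, t) - simple_process (L n) t w)//.
      rewrite on_timeE; case: ifPn => // ht.
      rewrite (_ : simple_process _ _ _ = 0) ?subrr ?expr0n//.
      rewrite /simple_process big_seq big1// => x /((hL n).1)[c [A [h1 h2 h3 _ _]]].
      rewrite indicE mem_setE in_itv/=.
      have [/andP[h4 h5]|_] := boolP (x.1.1 < t <= x.1.2); last by rewrite mulr0.
      case/negP: ht; rewrite (le_trans h5 h3) andbT ltW//.
      exact: le_lt_trans h4.
  under eq_fun do rewrite E.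
  by apply: ereal_squeeze_geo => n; rewrite lee_fin; have /andP[] := sq n.
- have E n : 'E_P[(fun w => (ito P T F M mu (on_time phi) w - simple_integral M (L n) w) ^+ 2)%R]%E =
      (seminorm (ip mu) (on_time phi - step_process (L n)) ^+ 2)%:E.
    have lD : L2m P (ito P T F M mu (on_time phi) - (simple_integral M (L n) : Omega -> R^o)).
      apply: (subspaceB (si_sub sP)); last exact: (simple_integral_L2m T_gt0 F_usual M_mart (hL n).1).
      by apply: (L2_L2m _ lI); exact: (filtration_sub F_usual TT).
    rewrite -hI; last exact: (hL n).1.
    by rewrite (seminorm_sqr sP)// EFin_ip_sqr// unlock.
  under eq_fun do rewrite E.
  by apply: ereal_squeeze_geo => n; rewrite lee_fin; have /andP[] := sq n.
Qed.

End transfer.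

Lemma martingale_ae_eq d (Omega : measurableType d) (R : realType)
    (P : probability Omega R) (T : R) (F : R -> set (set Omega)) (X Y : R -> Omega -> R) :
  usual_filtration P T F -> martingale P T F X -> adapted T F Y ->
  (forall t, {ae P, forall w, X t w = Y t w}) -> martingale P T F Y.
Proof.
move=> F_usual [adX iX mX] adY XY.
have mes Z t : adapted T F Z -> 0 <= t <= T -> measurable_fun setT (EFin \o Z t).
  move=> adZ tT; apply/measurable_EFinP.
  exact: G_measurable_measurable (filtration_sub F_usual tT) (adZ t tT).
have eqB t B : 0 <= t <= T -> measurable B ->
    (\int[P]_(w in B) (X t w)%:E = \int[P]_(w in B) (Y t w)%:E)%E.
  move=> tT mB; apply: ae_eq_integral => //.
  - by apply: measurable_funS (mes X t adX tT).
  - by apply: measurable_funS (mes Y t adY tT).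
  - by apply: filterS (XY t) => w -> _.
have iY t : 0 <= t <= T -> P.-integrable setT (EFin \o Y t).
  move=> tT; have /integrableP[_ fin] := iX t tT; apply/integrableP; split; first exact: mes.
  rewrite (_ : (\int[P]_x _ = \int[P]_x `|(EFin \o X t) x|)%E)//.
  apply: ae_eq_integral => //.
  - by apply: measurableT_comp => //; exact: mes.
  - by apply: measurableT_comp => //; exact: mes.
  - by apply: filterS (XY t) => w /= -> _.
split => // s t s0 st tT; have sT : 0 <= s <= T by rewrite s0 (le_trans st).
have tT' : 0 <= t <= T by rewrite (le_trans s0).
have [_ _ h] := mX s t s0 st tT.
split; [exact: adY|exact: iY|move=> B FB].
have mB := filtration_sub F_usual sT FB.
by rewrite -!eqB// h.
Qed.

(* Discarding a null set, which belongs to [F 0], makes the paths of the quadratic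
   variation well behaved everywhere. *)
Lemma qv_nice_version d (Omega : measurableType d) (R : realType)
    (P : probability Omega R) (T : R) (F : R -> set (set Omega)) (M V : R -> Omega -> R)
    (rho : R -> R) :
  0 < T -> usual_filtration P T F -> square_integrable_martingale P T F M ->
  is_predictable_qv P T F M V -> (forall x, 0 <= x -> 0 <= rho x) ->
  {ae P, forall w, forall s t, 0 <= s -> s <= t -> t <= T ->
     V t w - V s w <= rho (t - s)} ->
  exists W, [/\ {ae P, forall w, V ^~ w = W ^~ w},
    forall w, increasing_path T (W ^~ w), adapted T F W,
    forall w s t, 0 <= s -> s <= t -> t <= T -> W t w - W s w <= rho (t - s) &
    martingale P T F (fun t w => M t w ^+ 2 - W t w)].
Proof.
move=> T0 F_usual [[adM _ _] _] [_ _ V_inc MV_mart] rho_ge0 V_rho.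
pose good w := increasing_path T (V ^~ w) /\ forall s t, 0 <= s -> s <= t -> t <= T ->
  V t w - V s w <= rho (t - s).
have good_ae : {ae P, forall w, good w} by apply: filterS2 V_inc V_rho.
pose N := [set w | ~ good w].
have FN : F 0 N.
  have [_ _ _ _ h] := F_usual; apply: h.
  by have [A [mA PA0 hA]] := good_ae; exists A; split.
have F0N t : 0 <= t <= T -> <<s F t >> (~` N).
  move=> /andP[t0 tT]; apply: (@measurableC _ (g_sigma_algebraType (F t))).
  by apply: sub_sigma_algebra; apply: (filtration_mono F_usual (lexx 0) t0 tT).
(* The zero path put on the bad set is increasing, and its increments respect the modulus because
   [rho] is nonnegative. *)
pose W t w := \1_(~` N) w * V t w.
have Wgood w : good w -> W ^~ w = V ^~ w.
  by move=> gw; apply/funext => t; rewrite /W indicE mem_set ?mul1r// => h; apply: h.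
have Wbad w : ~ good w -> W ^~ w = fun=> 0.
  by move=> gw; apply/funext => t; rewrite /W indicE memNset ?mul0r// => h; apply: h.
have VW : {ae P, forall w, V ^~ w = W ^~ w}.
  by apply: filterS good_ae => w /Wgood.
(* [V] is the difference of the adapted processes [M^2] and [M^2 - V]. *)
have adV : adapted T F V.
  move=> t tT; have [adX _ _] := MV_mart.
  rewrite (_ : V t = (fun w => M t w ^+ 2 - (M t w ^+ 2 - V t w))); last first.
    by apply/funext => w; rewrite subKr.
  apply: (@measurable_funB _ (g_sigma_algebraType (F t))); last exact: adX.
  by apply: (@measurable_funX _ (g_sigma_algebraType (F t))); exact: adM.
have adW : adapted T F W.
  move=> t tT; apply: (@measurable_funM _ (g_sigma_algebraType (F t))); last exact: adV.
  by apply: (@measurable_indic _ (g_sigma_algebraType (F t))); exact: F0N.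
exists W; split => //.
- move=> w; have [gw|gw] := pselect (good w); first by rewrite Wgood//; exact: gw.1.
  by rewrite Wbad//; split => // t _; exact: cvg_cst.
- move=> w s t s0 st tT; have [gw|gw] := pselect (good w).
    have E r : W r w = V r w by exact: (congr1 (@^~ r) (Wgood w gw)).
    by rewrite !E; exact: gw.2.
  have E := Wbad w gw; rewrite (_ : W t w = 0); last exact: (congr1 (@^~ t) E).
  by rewrite (_ : W s w = 0) ?subrr ?rho_ge0 ?subr_ge0//; exact: (congr1 (@^~ s) E).
- apply: (martingale_ae_eq F_usual MV_mart).
    move=> t tT; apply: (@measurable_funB _ (g_sigma_algebraType (F t))); last exact: adW.
    by apply: (@measurable_funX _ (g_sigma_algebraType (F t))); exact: adM.
  move=> t; apply: filterS VW => w E.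
  by congr (_ - _); exact: (congr1 (@^~ t) E).
Qed.

(** A right limit at 0 says nothing about [rho 0], hence the condition [0 < x]. *)
Lemma small_modulus (R : realType) (rho : R -> R) (e : R) : 0 < e ->
  rho x @[x --> 0^'+] --> (0 : R) ->
  exists2 delta, 0 < delta & forall x, 0 < x -> x <= delta -> rho x <= e.
Proof.
move=> e0 /cvgrPdist_le/(_ _ e0)[delta /= d0 hd].
exists (delta / 2) => [|x x0 xd]; first by rewrite divr_gt0.
have := hd x; rewrite /ball_/= !sub0r !normrN (gtr0_norm x0) => /(_ _ x0) h.
by apply: le_trans (ler_norm _) (h _); rewrite (le_lt_trans xd)// ltr_pdivrMr// ltr_pMr// ltr1n.
Qed.

(** Values beyond [K] become 0 rather than [K] or [- K]. Applied to [alpha], this alters a null set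
    only and gives the bound at every point. *)
Definition truncate {R : realType} (K x : R) : R := \1_(`[- K, K]%classic) x * x.

Lemma truncateE {R : realType} (K x : R) : truncate K x = if `|x| <= K then x else 0.
Proof.
rewrite /truncate indicE mem_setE in_itv/= -ler_norml.
by case: ifP; rewrite ?mul1r ?mul0r.
Qed.

Lemma measurable_truncate {R : realType} (K : R) : measurable_fun setT (truncate K).
Proof. by apply: measurable_funM => //; apply: measurable_indic; exact: measurable_itv. Qed.

(** * The bounded version of the drift density *)

Section drift_identification.
Context d {Omega : measurableType d} {R : realType}.
Variables (P : probability Omega R) (T : R) (F : R -> set (set Omega)).
Hypothesis T_gt0 : 0 < T.
Hypothesis F_usual : usual_filtration P T F.
Notation OR := (Omega * measurableTypeR R)%type.
Variables (V W : R -> Omega -> R) (mu : {finite_measure set OR -> \bar R}).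
Hypothesis VW : {ae P, forall w, V ^~ w = W ^~ w}.
Hypothesis mu_int : forall f : OR -> \bar R, (forall z, 0 <= f z)%E ->
  measurable_fun setT f ->
  (\int[mu]_z f z = \int[P]_w \int[path_measure T W w]_t f (w, t))%E.
Hypothesis mu_meas : forall f : OR -> \bar R, (forall z, 0 <= f z)%E ->
  measurable_fun setT f ->
  measurable_fun setT (fun w => \int[path_measure T W w]_t f (w, t))%E.
Variables (alpha : R -> Omega -> R) (K : R).
Hypothesis K_ge0 : 0 <= K.
Hypothesis alpha_predictable : predictable T F alpha.
Hypothesis alpha_bounded : dol_measure P T V
  [set z | 0 <= z.2 <= T /\ K < `|alpha z.2 z.1|] = 0%E.

Let GM := predictable_rect_measurable T_gt0 F_usual.

Definition truncated_drift_density : OR -> R^o := truncate K \o on_time T alpha.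

Let m_alpha : measurable_fun setT (on_time T alpha).
Proof.
exact: (G_measurable_measurable GM (predictable_on_time T_gt0 F_usual alpha_predictable)).
Qed.

Lemma truncated_drift_predictable :
  G_measurable (predictable_rect T F : set (set OR)) truncated_drift_density.
Proof.
apply: (@measurableT_comp _ _ _ (g_sigma_algebraType _)); first exact: measurable_truncate.
exact: (predictable_on_time T_gt0 F_usual alpha_predictable).
Qed.

Lemma truncated_drift_bounded z : `|truncated_drift_density z| <= K.
Proof.
by rewrite /truncated_drift_density /= truncateE; case: ifP => //; rewrite normr0.
Qed.

(** The set [E] of large values is null for [mu]; its indicator being nonnegative, the iterated
    integral forces almost every path to have a null section. *)
Lemma truncated_drift_ae : {ae P, forall w, {ae path_measure T W w, forall t,
  truncated_drift_density (w, t) = on_time T alpha (w, t)}}.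
Proof.
pose E : set OR := [set z | K < `|on_time T alpha z|].
have mE : measurable E.
  have := measurableT_comp (@normr_measurable R setT) m_alpha.
  move=> /(_ measurableT _ (measurable_itv `]K, +oo[)); rewrite setTI.
  rewrite (_ : _ @^-1` _ = E)//.
  by apply/seteqP; split => z /=; rewrite in_itv/= andbT.
have f0 z : (0 <= (\1_E z)%:E :> \bar R)%E by rewrite lee_fin.
have mf : measurable_fun setT (fun z => (\1_E z)%:E : \bar R).
  by apply/measurable_EFinP; exact: measurable_indic.
have : (\int[mu]_z (\1_E z)%:E = 0)%E.
  rewrite -alpha_bounded; symmetry.
  apply: (dol_integralE T_gt0 F_usual VW mu_int mu_meas f0 mf) => w t.
  have EE : ((w, t) \in E) = (K < `|on_time T alpha (w, t)|).
    by apply/idP/idP => [/set_mem//|h]; exact/mem_set.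
  rewrite !indicE EE on_timeE; case: ifPn => ht.
    congr (_%:E); congr ((nat_of_bool _)%:R).
    by apply/idP/idP => [h|/set_mem[]//]; apply/mem_set.
  (* Off [[0, T]] the extension by 0 stays below [K], so [E] adds no points there. *)
  by rewrite normr0 ltNge K_ge0.
rewrite (mu_int f0 mf) => h.
have /(ae_eq_integral_abs P measurableT (mu_meas f0 mf)) :
    (\int[P]_w `|\int[path_measure T W w]_t (\1_E (w, t))%:E| = 0)%E.
  by under eq_integral do rewrite gee0_abs ?integral_ge0//.
apply: filterS => w /(_ I) /= h0.
have ms : measurable_fun setT (fun t : measurableTypeR R => (\1_E (w, t))%:E : \bar R).
  by apply: (measurableT_comp mf); exact: pair1_measurable.
have /(ae_eq_integral_abs (path_measure T W w) measurableT ms) :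
    (\int[path_measure T W w]_t `|(\1_E (w, t))%:E| = 0)%E.
  by under eq_integral do rewrite gee0_abs ?lee_fin//.
apply: filterS => t /(_ I) /= [] /eqP; rewrite indicE pnatr_eq0 eqb0 notin_setE => nE.
by rewrite /truncated_drift_density /= truncateE leNgt; case: ifPn => // /negPn.
Qed.

Lemma drift_qv_integral (beta : OR -> R^o) : measurable_fun setT beta ->
  {ae P, forall w, drift T W truncated_drift_density beta w =
    qv_integral T V (fun t w' => beta (w', t) * alpha t w') T w}.
Proof.
move=> mb; apply: filterS2 VW truncated_drift_ae => w VWw hae.
rewrite /drift /path_integral /qv_integral VWw /Rintegral; congr fine.
have mp : measurable_fun setT (fun t : measurableTypeR R => (w, t)) by exact: pair1_measurable.
have mtr : measurable_fun setT truncated_drift_density.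
  exact: (G_measurable_measurable GM truncated_drift_predictable).
rewrite [RHS]integral_mkcond.
transitivity (\int[path_measure T W w]_t (beta (w, t) * on_time T alpha (w, t))%:E)%E.
  apply: ae_eq_integral => //.
  - apply/measurable_EFinP; apply: measurable_funM.
      exact: (measurableT_comp mb mp).
    exact: (measurableT_comp mtr mp).
  - apply/measurable_EFinP; apply: measurable_funM.
      exact: (measurableT_comp mb mp).
    exact: (measurableT_comp m_alpha mp).
  - by apply: filterS hae => t -> _.
apply: eq_integral => t _; rewrite patchE mem_setE in_itv/= on_timeE.
by case: ifP => // _; rewrite mulr0.
Qed.

End drift_identification.

(** * Return from [W], [mu] and the bounded drift density to the given processes *)

Unset Implicit Arguments.

Theorem proposition3p3
  (R : realType) (d : measure_display) (Omega : measurableType d)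
  (P : probability Omega R) (T : R) (T_gt0 : 0 < T)
  (F H : R -> set (set Omega))
  (F_usual : usual_filtration P T F) (H_usual : usual_filtration P T H)
  (F_T : F T = measurable)
  (H_sub_F : forall t, 0 <= t <= T -> H t `<=` F t)
  (* V is <M> *)
  (M V alpha S : R -> Omega -> R)
  (M_martingale : square_integrable_martingale P T F M)
  (M_cadlag : cadlag P T M)
  (M_0 : {ae P, forall w, M 0 w = 0})
  (V_qv : is_predictable_qv P T F M V)
  (S_adapted : adapted T F S)
  (S_cadlag : cadlag P T S)
  (S_square_integrable : forall t, 0 <= t <= T -> square_integrable P (S t))
  (S_decomposition : semimartingale_decomposition P T F M V alpha S)
  (rho : R -> R)
  (rho_ge0 : forall x, 0 <= x -> 0 <= rho x)
  (rho_0 : rho x @[x --> 0^'+] --> (0 : R))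
  (V_rho : {ae P, forall w, forall s t, 0 <= s -> s <= t -> t <= T ->
              V t w - V s w <= rho (t - s)})
  (K : R) (K_ge0 : 0 <= K)
  (alpha_bounded : dol_measure P T V
     [set z | 0 <= z.2 <= T /\ K < `|alpha z.2 z.1|] = 0%E)
  (xi : Omega -> R) (xi_L2 : L2_rv P (F T) xi) :
  exists (U0 : Omega -> R) (beta A : R -> Omega -> R) (J : Omega -> R),
    [/\ L2_rv P (F 0) U0,
        M2 P T H V beta,
        L2_martingale P T F A /\ weakly_orthogonal P T F H M V A,
        is_semimartingale_integral P T F M V alpha S beta J &
        {ae P, forall w, xi w = U0 w + J w + A T w}].
Proof.
have T_ge0 := ltW T_gt0.
have T00 : 0 <= (0 : R) <= T by rewrite lexx.
have TT : 0 <= T <= T by rewrite T_ge0/=.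
have [W [VW W_inc W_adapted W_rho MW_mart]] :=
  qv_nice_version T_gt0 F_usual M_martingale V_qv rho_ge0 V_rho.
have W_meas t : 0 <= t <= T -> measurable_fun setT (W t).
  move=> tT; exact: G_measurable_measurable (filtration_sub F_usual tT) (W_adapted t tT).
(* As [rho] is not assumed monotone, an increment is compared with the total increment of the path
   before [rho] is used. *)
have W_bd w s t : 0 <= s -> s <= t -> t <= T -> W t w - W s w <= rho T.
  move=> s0 st tT; have [incW _] := W_inc w.
  have := W_rho w 0 T (lexx 0) T_ge0 (lexx T); rewrite subr0; apply: le_trans.
  apply: lerB; apply: incW => //; first exact: le_trans st.
  exact: le_trans st tT.
have W_lt w : W T w - W 0 w < rho T + 1 by rewrite ltr_pwDr// W_bd.
pose mu := dolm T_ge0 W_inc W_meas W_lt P.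
have mu_int := integral_dolm T_ge0 W_inc W_meas W_lt P.
have mu_meas := measurable_integral_path T_ge0 W_inc W_meas W_lt.
(* With [b = c^-2], the product of [Num.sqrt b] and [K] is [K / (2 (K + 1))], at most the 1/2 that
   Lax-Milgram tolerates; the added 1 keeps [c] positive when [K = 0]. *)
pose c := 2 * (K + 1).
have c_gt0 : 0 < c by rewrite mulr_gt0// ltr_pwDr.
pose b := c^-1 ^+ 2.
have b_gt0 : 0 < b by rewrite exprn_gt0// invr_gt0.
have [delta delta_gt0 hdelta] := small_modulus b_gt0 rho_0.
have W_small w s t : 0 <= s -> s <= t -> t <= T -> t - s <= delta -> W t w - W s w <= b.
  (* Equal times are settled apart, since [hdelta] does not control [rho 0]. *)
  move=> s0 st tT ts; move: (st); rewrite le_eqVlt => /orP[/eqP ->|st'].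
    by rewrite subrr ltW.
  by apply: le_trans (W_rho w s t s0 st tT) (hdelta _ _ ts); rewrite subr_gt0.
have Kb : Num.sqrt b * K <= 2^-1.
  rewrite sqrtr_sqr ger0_norm ?invr_ge0 ?(ltW c_gt0)// mulrC ler_pdivrMr// /c.
  by rewrite mulKf// lerDl.
have [alpha_pred _ _] := S_decomposition.
have lxi : L2m P xi.
  move: xi_L2; rewrite F_T => -[mxi]; rewrite /square_integrable unlock; by split.
have [U0 [beta [A [lU0 dbeta [A_mart A0] AT [lAT orth]]]]] :=
  decomposition_nice T_gt0 F_usual F_T H_usual H_sub_F M_martingale W_inc W_adapted
    W_bd W_small delta_gt0 K_ge0 (ltW b_gt0) Kb mu_int mu_meas MW_mart
    (truncated_drift_predictable T_gt0 F_usual K alpha_pred)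
    (truncated_drift_bounded T alpha K_ge0) lxi.
have GHF : (predictable_rect T H : set (set (Omega * measurableTypeR R))) `<=`
    <<s predictable_rect T F >>.
  by move=> B /(predictable_rect_mono T_ge0 H_sub_F); exact: sub_sigma_algebra.
have predHF phi : predictable T H phi -> predictable T F phi.
  move=> pphi _ Y mY; have := pphi (g_sigma_time T_gt0 H_usual) Y mY.
  by apply: smallest_sub => //; exact: smallest_sigma_algebra.
pose phi t w := beta (w, t).
(* The solution already vanishes off []0, T]], so passing to a process and back loses nothing. *)
have phiE : on_time T phi = beta.
  apply/funext => -[w t]; rewrite on_timeE; case: ifPn => // ht.
  rewrite dbeta.2//; apply: contra ht => /andP[/= h1 h2].
  by rewrite (ltW h1).
have pphi : predictable T H phi.
  apply: measurable_funTS; rewrite (_ : (fun z => _) = beta); first exact: dbeta.1.1.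
  by apply/funext => -[].
have lphiF : L2 mu (predictable_rect T F) (on_time T phi).
  by rewrite phiE; apply: (L2_sub GHF); exact: dbeta.1.
exists U0, phi, A, (fun w => ito P T F M mu beta w +
  drift T W (truncated_drift_density T alpha K) beta w); split.
- by split; [exact: lU0.1|rewrite /square_integrable unlock; exact: lU0.2].
- by apply: (on_time_M2 T_gt0 F_usual VW mu_int mu_meas H_usual pphi); rewrite phiE; exact: dbeta.1.
- split; first by split => //; rewrite /square_integrable unlock; exact: lAT.2.
  move=> psi hpsi.
  have lpsi := M2_on_time T_gt0 F_usual VW mu_int mu_meas H_usual hpsi.
  have lpsiF := L2_sub GHF lpsi.
  exists (ito P T F M mu (on_time T psi)).
    exact: (ito_is_ito_integral T_gt0 F_usual M_martingale VW W_inc mu_int mu_meas MW_mart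
      (predHF _ hpsi.1) lpsiF).
  have lI := ito_L2m T_gt0 F_usual M_martingale W_inc mu_int MW_mart lpsiF.
  by rewrite unlock; apply: etrans (esym (EFin_ip lAT lI)) _; rewrite orth.
- split => //; exists (ito P T F M mu beta).
    rewrite -phiE.
    exact: (ito_is_ito_integral T_gt0 F_usual M_martingale VW W_inc mu_int mu_meas MW_mart
      (predHF _ pphi) lphiF).
  have mbeta : measurable_fun setT beta.
    exact: (G_measurable_measurable (predictable_rect_measurable T_gt0 H_usual) dbeta.1.1).
  have := drift_qv_integral T_gt0 F_usual VW mu_int mu_meas K_ge0 alpha_pred alpha_bounded mbeta.
  by apply: filterS => w ->.
(* The identity holds at every point, [A T] having been chosen as the remainder itself. *)
- apply: nearW => w; rewrite AT.
  rewrite [(_ - _ - _ - _) w](_ : _ = xi w - ito P T F M mu beta w -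
    drift T W (truncated_drift_density T alpha K) beta w - U0 w)//.
  have alg (x y z u : R) : x = u + (y + z) + (x - y - z - u) by ring.
  exact: alg.
Qed.
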